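(* For every $d\in\mathbb Z$ there is a morphism of prop(erad)s $$s^\diamond:\mathcal{L}ieb^\diamond_{d,d}\longrightarrow\mathcal{RG}ra_d$$ sending the cobracket generator to the ribbon graph with one vertex and one edge (a loop; it has two boundaries, labelled $1$ and $2$), and the bracket generator to the ribbon graph with two vertices, labelled $1$ and $2$, joined by one edge (it has one boundary).
   Context: $\mathbb K$ is a field of characteristic $0$; $V[k]^i=V^{i+k}$; Koszul sign rule. **Involutive Lie bialgebras.** A Lie $n$-bialgebra is a graded vector space $U$ with a degree $0$ Lie cobracket $\vartriangle:U\to U\wedge U$ and a Lie bracket on $U[n]$, such that $\vartriangle[a,b]=\sum a_1\otimes[a_2,b]+[a,b_1]\otimes b_2-(-1)^{(|a|+n)(|b|+n)}([b,a_1]\otimes a_2+b_1\otimes[b_2,a])$, where $\vartriangle a=\sum a_1\otimes a_2$ and $\vartriangle b=\sum b_1\otimes b_2$. For $n$ even it is involutive if the composition $[\,,]\circ\vartriangle$ vanishes. For $c+d$ even, $\mathcal{L}ieb^\diamond_{c,d}$ is the properad whose representations in $V$ are involutive Lie $(c+d-2)$-bialgebra structures on $V[1-c]$. It is generated by a cobracket of degree $1-c$ (arity: 2 outputs, 1 input) with symmetry $\mathrm{sgn}_2^{\otimes c}$ and a bracket of degree $1-d$ (1 output, 2 inputs) with symmetry $\mathrm{sgn}_2^{\otimes d}$, modulo co-Jacobi, Jacobi, the bialgebra compatibility and the involutivity relation. **The properad $\mathcal{RG}ra_d$.** A ribbon graph is a finite set $H$ of half-edges with a fixed-point-free involution $\sigma_1$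 (orbits = edges) and a permutation $\sigma_0$ (orbits = vertices, each with cyclically ordered half-edges); its boundaries are the orbits of $\sigma_0^{-1}\sigma_1$. The one-vertex graph $\bullet$ without edges and with one boundary is also allowed. Corners are the intervals between cyclically consecutive half-edges at a vertex (one corner if there is at most one half-edge); each corner belongs to one boundary, and the corners of a boundary are cyclically ordered. $\mathcal{RG}ra_d(m,n)$ is spanned by ribbon graphs with vertices labelled $1,\dots,n$ (inputs) and boundaries labelled $1,\dots,m$ (outputs), with an orientation: an ordering of the edges for $d$ even (odd permutations give a sign), a direction on each edge for $d$ odd (flips give a sign). Each edge has degree $1-d$. Composition glues the $i$-th boundary of $\Gamma_1$ into the $i$-th vertex of $\Gamma_2$ by erasing the vertex and summing over all ways to reattach its half-edges to the corners of the boundary respecting cyclic orders; horizontal composition is disjoint union; the unit is $\bullet$. The properad consists of connected graphs. (For $d$ odd, an orientation of the two generators' images is fixed once and for all, e.g. the edge is directed from vertex $1$ to vertex $2$.) *)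

(* Defs.v *)
From HB Require Import structures.
From mathcomp Require Import all_boot all_fingroup all_algebra.
From mathcomp Require Import generic_quotient ring_quotient freeg.
From mathcomp Require Import boolp.

Set Implicit Arguments.
Unset Strict Implicit.
Unset Printing Implicit Defensive.

Import GRing.Theory.
Local Open Scope ring_scope.
Local Open Scope quotient_scope.

Section ModuleQuotient.
Variables (K : fieldType) (V : lmodType K) (S : V -> Prop).

Inductive lspan : V -> Prop :=
| span0 : lspan 0
| spanD a s x : S s -> lspan x -> lspan (a *: s + x).

Definition span_pred : {pred V} := fun x => `[< lspan x >].

Lemma spanP x : reflect (lspan x) (x \in span_pred).
Proof. exact: asboolP. Qed.

Lemma span_add x y : lspan x -> lspan y -> lspan (x + y).
Proof.
by elim=> [|a s z Ss _ IH] sy; rewrite ?add0r // -addrA; apply: spanD (IH sy).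
Qed.

Lemma span_scale a x : lspan x -> lspan (a *: x).
Proof.
elim=> [|b s z Ss _ IH]; first by rewrite scaler0; apply: span0.
by rewrite scalerDr scalerA; apply: spanD.
Qed.

Lemma span_gen s : S s -> lspan s.
Proof. by move=> Ss; rewrite -[s]addr0 -[s]scale1r; apply: spanD span0. Qed.

Fact span_zmod_closed : zmod_closed span_pred.
Proof.
split=> [|x y /spanP sx /spanP sy]; first exact/spanP/span0.
by apply/spanP/span_add; rewrite // -scaleN1r; apply: span_scale.
Qed.
HB.instance Definition _ := GRing.isZmodClosed.Build V span_pred span_zmod_closed.

(* The quotient of V by the linear span of S. *)
Definition lquot := Quotient.quot span_pred.
HB.instance Definition _ := GRing.Zmodule.on lquot.
HB.instance Definition _ := Quotient.on lquot.

Definition lproj (x : V) : lquot := \pi x.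
Definition lrepr (x : lquot) : V := repr x.

Lemma lreprK x : lproj (lrepr x) = x.
Proof. exact: reprK. Qed.

Lemma lprojP x y : reflect (lspan (x - y)) (lproj x == lproj y).
Proof.
by rewrite /lproj -[_ == _]/(\pi_(Quotient.quot span_pred) x == \pi y) -Quotient.idealrBE;
   apply: spanP.
Qed.

Lemma lprojD x y : lproj (x + y) = lproj x + lproj y.
Proof. exact: (raddfD \pi_(Quotient.quot span_pred)). Qed.

Lemma lrepr_proj x : lspan (lrepr (lproj x) - x).
Proof. by apply/lprojP; rewrite lreprK. Qed.

Definition lquot_scale a (x : lquot) : lquot := lproj (a *: lrepr x).

Lemma lprojZ a x : lquot_scale a (lproj x) = lproj (a *: x).
Proof.
by apply/eqP/lprojP; rewrite -scalerBr; apply/span_scale/lrepr_proj.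
Qed.

Fact lquot_scaleA a b v : lquot_scale a (lquot_scale b v) = lquot_scale (a * b) v.
Proof. by rewrite -[v]lreprK !lprojZ scalerA. Qed.
Fact lquot_scale1 : left_id 1 lquot_scale.
Proof. by move=> v; rewrite -[v]lreprK !lprojZ scale1r. Qed.
Fact lquot_scaleDr : right_distributive lquot_scale +%R.
Proof.
by move=> a u v; rewrite -[u]lreprK -[v]lreprK -lprojD !lprojZ scalerDr lprojD.
Qed.
Fact lquot_scaleDl v : {morph lquot_scale^~ v : a b / a + b}.
Proof. by move=> a b; rewrite -[v]lreprK !lprojZ scalerDl lprojD. Qed.

HB.instance Definition _ := GRing.Zmodule_isLmodule.Build K lquot
  lquot_scaleA lquot_scale1 lquot_scaleDr lquot_scaleDl.

End ModuleQuotient.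


(* Bijections between the label sets 'I_m = {0, ..., m-1}; label i of the     *)
(* mathematical text is the ordinal of value i-1.                             *)
Section OrdinalBijections.

Definition obij m n := {f : {ffun 'I_m -> 'I_n} | injectiveb f && (m == n)}.
HB.instance Definition _ m n := Choice.on (obij m n).

Definition obij_fun m n (f : obij m n) : 'I_m -> 'I_n := val f.
Coercion obij_fun : obij >-> Funclass.

Fact obij_of_proof m n (f : 'I_m -> 'I_n) (g : 'I_n -> 'I_m) :
  cancel f g -> cancel g f ->
  let F := [ffun i => f i] in injectiveb F && (m == n).
Proof.
move=> fK gK /=; apply/andP; split.
  by apply/injectiveP => i j; rewrite !ffunE; apply: (can_inj fK).
by rewrite -[m]card_ord -[n]card_ord; apply/eqP/bij_eq_card; exists g; eassumption.
Qed.

Definition obij_of m n f g fK gK : obij m n := exist _ [ffun i => f i] (@obij_of_proof m n f g fK gK).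

Lemma obij_inj m n (f : obij m n) : injective f.
Proof. by case/andP: (valP f) => /injectiveP. Qed.

Lemma obij_eq_dom m n (f : obij m n) : m = n.
Proof. by case/andP: (valP f) => _ /eqP. Qed.

Lemma obij_surj m n (f : obij m n) j : exists i, f i = j.
Proof.
have le_nm : (#|'I_n| <= #|'I_m|)%N by rewrite !card_ord (obij_eq_dom f).
by have /codomP[i ->] := inj_card_onto (@obij_inj m n f) le_nm j; exists i.
Qed.

Definition oid n : obij n n := obij_of (f := id) (g := id) (frefl _) (frefl _).

Fact ocomp_proof m n p (g : obij n p) (f : obij m n) :
  let F := [ffun i => g (f i)] in injectiveb F && (m == p).
Proof.
apply/andP; split; last by apply/eqP; rewrite (obij_eq_dom f); apply: obij_eq_dom g.
by apply/injectiveP => i j; rewrite !ffunE => /obij_inj/obij_inj.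
Qed.
Definition ocomp m n p (g : obij n p) (f : obij m n) : obij m p :=
  exist _ [ffun i => g (f i)] (ocomp_proof g f).

Lemma split_lshift m n (i : 'I_m) : split (lshift n i) = inl i.
Proof. exact: (unsplitK (inl i)). Qed.
Lemma split_rshift m n (i : 'I_n) : split (rshift m i) = inr i.
Proof. exact: (unsplitK (inr i)). Qed.

Definition osum_fun a b a' b' (f : 'I_a -> 'I_a') (g : 'I_b -> 'I_b')
    (i : 'I_(a + b)) : 'I_(a' + b') :=
  match split i with inl x => lshift b' (f x) | inr y => rshift a' (g y) end.

Fact osum_proof a b a' b' (f : obij a a') (g : obij b b') :
  let F := [ffun i => osum_fun f g i] in injectiveb F && (a + b == a' + b')%N.
Proof.
apply/andP; split; last by rewrite (obij_eq_dom f) (obij_eq_dom g).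
apply/injectiveP => i j; rewrite !ffunE /osum_fun.
case: (split_ordP i) => x ->; case: (split_ordP j) => y ->;
  rewrite ?split_lshift ?split_rshift.
- by move/lshift_inj/obij_inj->.
- by move/eqP; rewrite eq_lrshift.
- by move/eqP; rewrite eq_rlshift.
- by move/rshift_inj/obij_inj->.
Qed.
(* f on the first block, g on the second one. *)
Definition osum a b a' b' (f : obij a a') (g : obij b b') : obij (a + b) (a' + b') :=
  exist _ [ffun i => osum_fun f g i] (osum_proof f g).

Definition omid_fun a b c d (i : 'I_((a + b) + (c + d))) : 'I_((a + c) + (b + d)) :=
  match split i with
  | inl u => match split u with
             | inl x => lshift (b + d) (lshift c x)
             | inr y => rshift (a + c) (lshift d y)
             end
  | inr v => match split v with
             | inl z => lshift (b + d) (rshift a z)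
             | inr t => rshift (a + c) (rshift b t)
             end
  end.
Fact omid_funK a b c d : cancel (@omid_fun a b c d) (@omid_fun a c b d).
Proof.
move=> i; rewrite /omid_fun; case: (split_ordP i) => u ->;
  by case: (split_ordP u) => x ->; rewrite ?(split_lshift, split_rshift).
Qed.
(* Exchange the second and the third of four blocks. *)
Definition omid a b c d : obij ((a + b) + (c + d)) ((a + c) + (b + d)) :=
  obij_of (@omid_funK a b c d) (@omid_funK a c b d).

Definition oswapr_fun a b c (i : 'I_((a + b) + c)) : 'I_((a + c) + b) :=
  match split i with
  | inl u => match split u with
             | inl x => lshift b (lshift c x)
             | inr y => rshift (a + c) y
             end
  | inr z => lshift b (rshift a z)
  end.
Fact oswapr_funK a b c : cancel (@oswapr_fun a b c) (@oswapr_fun a c b).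
Proof.
move=> i; rewrite /oswapr_fun; case: (split_ordP i) => u ->; rewrite ?(split_lshift, split_rshift) //.
by case: (split_ordP u) => x ->; rewrite ?(split_lshift, split_rshift).
Qed.
(* Exchange the last two of three blocks. *)
Definition oswapr a b c : obij ((a + b) + c) ((a + c) + b) :=
  obij_of (@oswapr_funK a b c) (@oswapr_funK a c b).

Definition oswapl_fun a b c (i : 'I_(a + (b + c))) : 'I_(b + (a + c)) :=
  match split i with
  | inl x => rshift b (lshift c x)
  | inr v => match split v with
             | inl y => lshift (a + c) y
             | inr z => rshift b (rshift a z)
             end
  end.
Fact oswapl_funK a b c : cancel (@oswapl_fun a b c) (@oswapl_fun b a c).
Proof.
move=> i; rewrite /oswapl_fun; case: (split_ordP i) => u ->; rewrite ?(split_lshift, split_rshift) //.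
by case: (split_ordP u) => x ->; rewrite ?(split_lshift, split_rshift).
Qed.
(* Exchange the first two of three blocks. *)
Definition oswapl a b c : obij (a + (b + c)) (b + (a + c)) :=
  obij_of (@oswapl_funK a b c) (@oswapl_funK b a c).

Definition ocast m n (e : m = n) : obij m n :=
  obij_of (cast_ordK e) (cast_ordKV e).

(* (a + b) + c blocks re-bracketed, the value being unchanged. *)
Definition oassoc a b c : obij ((a + b) + c) (a + (b + c)) := ocast (esym (addnA a b c)).
Definition oassocV a b c : obij (a + (b + c)) ((a + b) + c) := ocast (addnA a b c).

(* The cyclic shift i |-> i + 1 mod n; for n = 2 the transposition. *)
Definition oshift n : obij n n := obij_of (@ordSK n) (@ord_predK n).

End OrdinalBijections.

Section Properads.
Variable K : fieldType.

(* The underlying data of a properad in graded K-modules.                     *)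
(* P m n p is the space of elements of degree p with m outputs and n inputs.  *)
(* The S-bimodule structure is given as a functor on bijections of label      *)
(* sets: prelab f g renames the output i to f i and the input j to g j.       *)
(* The composite pcompose k_gt0 e y x is y o x along k > 0 edges: the last k     *)
(* outputs of x are plugged, in order, into the first k inputs of y; in the   *)
(* composite the outputs and inputs of x come before those of y.              *)
(* Composition of general connected graphs is obtained by iteration.          *)
Record properad_data := PropData {
  pcar :> nat -> nat -> int -> lmodType K;
  prelab : forall m n m' n' p,
    obij m m' -> obij n n' -> pcar m n p -> pcar m' n' p;
  pid : pcar 1%N 1%N 0;
  pcompose : forall k m1 n1 m2 n2 p q r, (0 < k)%N -> q + p = r ->
    pcar m2 (k + n2)%N q -> pcar (m1 + k)%N n1 p -> pcar (m1 + m2)%N (n1 + n2)%N r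
}.

Definition koszul (p q : int) : K := (-1) ^+ (`|p| * `|q|)%N.

Record is_properad (P : properad_data) : Prop := IsProperad {
  prelab_linear : forall m n m' n' p (f : obij m m') (g : obij n n'),
    linear (@prelab P m n m' n' p f g);
  prelab_id : forall m n p (x : P m n p), prelab (oid m) (oid n) x = x;
  prelab_comp : forall m n m' n' m'' n'' p (f : obij m m') (g : obij n n')
    (f' : obij m' m'') (g' : obij n' n'') (x : P m n p),
    prelab f' g' (prelab f g x) = prelab (ocomp f' f) (ocomp g' g) x;
  pcompose_linearl : forall k m1 n1 m2 n2 p q r (hk : (0 < k)%N) (e : q + p = r)
    (x : P (m1 + k)%N n1 p),
    linear (fun y : P m2 (k + n2)%N q => pcompose hk e y x);
  pcompose_linearr : forall k m1 n1 m2 n2 p q r (hk : (0 < k)%N) (e : q + p = r)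
    (y : P m2 (k + n2)%N q),
    linear (fun x : P (m1 + k)%N n1 p => pcompose hk e y x);
  pcompose_relab : forall k m1 n1 m2 n2 k' m1' n1' m2' n2' p q r
    (hk : (0 < k)%N) (hk' : (0 < k')%N) (e : q + p = r)
    (h : obij k k') (f1 : obij m1 m1') (g1 : obij n1 n1')
    (f2 : obij m2 m2') (g2 : obij n2 n2')
    (y : P m2 (k + n2)%N q) (x : P (m1 + k)%N n1 p),
    pcompose hk' e (prelab f2 (osum h g2) y) (prelab (osum f1 h) g1 x)
    = prelab (osum f1 f2) (osum g1 g2) (pcompose hk e y x);
  pcompose_idr : forall m n q (h1 : (0 < 1)%N) (e : q + 0 = q) (y : P m (1 + n)%N q),
    pcompose (m1 := 0) h1 e y (pid P) = y;
  pcompose_idl : forall m n p (h1 : (0 < 1)%N) (e : 0 + p = p) (x : P (m + 1)%N n p),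
    pcompose (n2 := 0) h1 e (pid P) x = prelab (oid _) (ocast (esym (addn0 n))) x;
  (* Associativity, for graphs with three vertices x, y, z: first y is above  *)
  (* x (k edges) and z is above y (l edges) and x (j edges, possibly none).   *)
  pcompose_chain : forall j k l m1 n1 m2 n2 m3 n3 p q r s t u
    (hk : (0 < k)%N) (hl : (0 < l)%N) (hjl : (0 < j + l)%N) (hkj : (0 < k + j)%N)
    (eyx : q + p = s) (ezy : r + q = t) (e : r + s = u) (e' : t + p = u)
    (x : P (m1 + j + k)%N n1 p) (y : P (m2 + l)%N (k + n2)%N q)
    (z : P m3 (j + (l + n3))%N r),
    prelab (oassoc m1 m2 m3) (oassoc n1 n2 n3)
      (pcompose hjl e (prelab (oid m3) (oassocV j l n3) z)
         (prelab (omid m1 j m2 l) (oid _) (pcompose hk eyx y x)))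
    = pcompose hkj e'
        (prelab (oid _) (omid k n2 j n3)
           (pcompose hl ezy (prelab (oid m3) (oswapl j l n3) z) y))
        (prelab (ocomp (oassoc m1 k j) (oswapr m1 j k)) (oid n1) x);
  (* Next y and z are both above x, and not joined to each other.             *)
  pcompose_above : forall k l m1 n1 m2 n2 m3 n3 p q r s t u
    (hk : (0 < k)%N) (hl : (0 < l)%N)
    (eyx : q + p = s) (ezx : r + p = t) (e : r + s = u) (e' : q + t = u)
    (x : P (m1 + l + k)%N n1 p) (y : P m2 (k + n2)%N q) (z : P m3 (l + n3)%N r),
    pcompose hl e z (prelab (oswapr m1 l m2) (oid _) (pcompose hk eyx y x))
    = koszul q r *: prelab (oswapr m1 m3 m2) (oswapr n1 n3 n2)
        (pcompose hk e' y (prelab (oswapr m1 k m3) (oid _)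
           (pcompose hl ezx z (prelab (oswapr m1 l k) (oid n1) x))));
  (* Last z is above both x and y, which are not joined to each other.        *)
  pcompose_below : forall k l m1 n1 m2 n2 m3 n3 p q r s t u
    (hk : (0 < k)%N) (hl : (0 < l)%N)
    (ezx : r + p = s) (ezy : r + q = t) (e : s + q = u) (e' : t + p = u)
    (x : P (m1 + k)%N n1 p) (y : P (m2 + l)%N n2 q) (z : P m3 (k + (l + n3))%N r),
    pcompose hl e (prelab (oid _) (oswapl n1 l n3) (pcompose hk ezx z x)) y
    = koszul p q *: prelab (oswapl m1 m2 m3) (oswapl n1 n2 n3)
        (pcompose hk e' (prelab (oid _) (oswapl n2 k n3)
           (pcompose hl ezy (prelab (oid m3) (oswapl k l n3) z) y)) x)
}.

Record properad := Properad {
  pdata :> properad_data;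
  pdataP : is_properad pdata
}.

Record properad_morphism (P Q : properad) := PropMorphism {
  pmor :> forall m n p, {linear P m n p -> Q m n p};
  pmor_relab : forall m n m' n' p (f : obij m m') (g : obij n n') (x : P m n p),
    pmor m' n' p (prelab f g x) = prelab f g (pmor m n p x);
  pmor_id : pmor 1%N 1%N 0 (pid P) = pid Q;
  pmor_comp : forall k m1 n1 m2 n2 p q r (hk : (0 < k)%N) (e : q + p = r)
    (y : P m2 (k + n2)%N q) (x : P (m1 + k)%N n1 p),
    pmor _ _ r (pcompose hk e y x) = pcompose hk e (pmor _ _ q y) (pmor _ _ p x)
}.

End Properads.

Section InvolutiveLieBialgebras.
Variables (K : fieldType) (c d : int).

(* The relations of involutive Lie bialgebras, for a cobracket D and a        *)
(* bracket B in a properad; c + d is meant to be even.  In lieb_compat,       *)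
(* bd (a, b) = a_1 (x) [a_2, b], and by the symmetries of D and B the other   *)
(* terms are those of the relation                                            *)
(*   D [a, b] = a_1 (x) [a_2, b] + [a, b_1] (x) b_2                           *)
(*              - (-1)^(|a||b|) ([b, a_1] (x) a_2 + b_1 (x) [b_2, a])         *)
(* on V[1-c], in the order a_1 (x) [a_2, b], b_1 (x) [b_2, a],                *)
(* [b, a_1] (x) a_2, [a, b_1] (x) b_2.  Rewriting this relation on V produces *)
(* the Koszul sign (-1)^((1-c)(1-d)), since D precedes B on the left-hand     *)
(* side and follows it on the right-hand side.                                *)
Record lieb_relations (P : properad_data K) (D : P 2%N 1%N (1 - c)) (B : P 1%N 2%N (1 - d))
    : Prop := LiebRelations {
  lieb_cobracket_sym : prelab (oshift 2) (oid 1) D = (-1) ^ c *: D;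
  lieb_bracket_sym : prelab (oid 1) (oshift 2) B = (-1) ^ d *: B;
  lieb_cojacobi :
    let DD : P 3%N 1%N _ := pcompose (k := 1) (m1 := 1) (n2 := 0) isT erefl D D in
    let rot : P 3%N 1%N _ -> P 3%N 1%N _ := prelab (oshift 3) (oid 1) in
    DD + rot DD + rot (rot DD) = 0;
  lieb_jacobi :
    let BB : P 1%N 3%N _ := pcompose (k := 1) (m1 := 0) (n2 := 1) isT erefl B B in
    let rot : P 1%N 3%N _ -> P 1%N 3%N _ := prelab (oid 1) (oshift 3) in
    BB + rot BB + rot (rot BB) = 0;
  lieb_compat :
    let db : P 2%N 2%N (1 - c + (1 - d)) :=
      pcompose (k := 1) (m1 := 0) (n2 := 0) isT erefl D B in
    let bd : P 2%N 2%N (1 - c + (1 - d)) :=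
      pcompose (k := 1) (m1 := 1) (n2 := 1) isT (addrC (1 - d) (1 - c)) B D in
    db = koszul K (1 - c) (1 - d) *:
      (bd + (-1) ^ d *: prelab (oid 2) (oshift 2) bd
          + (-1) ^ c *: prelab (oshift 2) (oid 2) bd
          + (-1) ^ (c + d) *: prelab (oshift 2) (oshift 2) bd);
  lieb_involutive :
    pcompose (k := 2) (m1 := 0) (n2 := 0) isT erefl B D = 0 :> P 1%N 1%N (1 - d + (1 - c))
}.

(* Formal properadic monomials in a cobracket and a bracket. *)
Inductive lieb_term : nat -> nat -> int -> Type :=
| LCobracket : lieb_term 2 1 (1 - c)
| LBracket : lieb_term 1 2 (1 - d)
| LId : lieb_term 1 1 0
| LRelab m n m' n' p of obij m m' & obij n n' & lieb_term m n p :
    lieb_term m' n' p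
| LComp k m1 n1 m2 n2 p q r of (0 < k)%N & q + p = r &
    lieb_term m2 (k + n2) q & lieb_term (m1 + k) n1 p :
    lieb_term (m1 + m2) (n1 + n2) r.

HB.instance Definition _ m n p := gen_eqMixin (lieb_term m n p).
HB.instance Definition _ m n p := gen_choiceMixin (lieb_term m n p).

Fixpoint lieb_eval (P : properad_data K) (D : P 2%N 1%N (1 - c)) (B : P 1%N 2%N (1 - d))
    m n p (t : lieb_term m n p) : P m n p :=
  match t with
  | LCobracket => D
  | LBracket => B
  | LId => pid P
  | LRelab _ _ _ _ _ f g t => prelab f g (lieb_eval D B t)
  | LComp _ _ _ _ _ _ _ _ hk e t u => pcompose hk e (lieb_eval D B t) (lieb_eval D B u)
  end.

(* A formal linear combination of monomials is a consequence of the axioms of *)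
(* properads and of the above relations iff it vanishes in all properads with *)
(* a cobracket and a bracket that satisfy these relations.                    *)
Definition lieb_null m n p (x : {freeg (lieb_term m n p) / K}) : Prop :=
  forall (P : properad K) (D : P 2%N 1%N (1 - c)) (B : P 1%N 2%N (1 - d)),
    lieb_relations D B -> fglift (lieb_eval D B (p := p)) x = 0.

Definition lieb_car m n p := lquot (@lieb_null m n p).

Definition lieb_mon m n p (t : lieb_term m n p) : lieb_car m n p :=
  lproj _ << t >>.

Definition lieb_data : properad_data K := PropData (K := K)
  (pcar := fun m n p => lieb_car m n p)
  (fun m n m' n' p f g x => fglift (fun t => lieb_mon (LRelab f g t)) (lrepr x))
  (lieb_mon LId)
  (fun k m1 n1 m2 n2 p q r hk e y x =>
     fglift (fun t => fglift (fun u => lieb_mon (LComp hk e t u)) (lrepr x)) (lrepr y)).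

End InvolutiveLieBialgebras.

Section FreeLift.
Variables (K : fieldType) (T : choiceType) (M : lmodType K).
Implicit Types (f : T -> M) (D : {freeg T / K}).

Lemma fglift_sumE f D : fglift f D = \sum_(z <- dom D) coeff z D *: f z.
Proof.
have liftD (x y : {freeg T / K}) : fglift f (x + y) = fglift f x + fglift f y.
  have addf : additive (fglift f) by exact: lift_is_additive.
  have f0 : fglift f 0 = 0 by rewrite -(subrr (0 : {freeg T / K})) addf subrr.
  by rewrite -[y in LHS]opprK addf -[- y]sub0r addf f0 sub0r opprK.
have f0 : fglift f 0 = 0 by rewrite -freeg_nil fglift_Freeg /prelift big_nil.
by rewrite -{1}[D]freeg_sumE (big_morph _ liftD f0); apply: eq_bigr => z _; rewrite liftU.
Qed.

Fact fglift_linear f : linear (fglift f).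
Proof.
have addf : additive (fglift f) by exact: lift_is_additive.
have f0 : fglift f 0 = 0 by rewrite -(subrr (0 : {freeg T / K})) addf subrr.
have liftD (x y : {freeg T / K}) : fglift f (x + y) = fglift f x + fglift f y.
  by rewrite -[y in LHS]opprK addf -[- y]sub0r addf f0 sub0r opprK.
move=> a x y; rewrite liftD; congr (_ + _).
rewrite -[a *: x]/(fgscale a x) /fgscale (big_morph _ liftD f0) fglift_sumE.
by rewrite scaler_sumr; apply: eq_bigr => z _; rewrite liftU scalerA.
Qed.

HB.instance Definition _ f :=
  GRing.isLinear.Build K {freeg T / K} M *:%R (fglift f) (fglift_linear f).

Lemma eq_fglift f g D : f =1 g -> fglift f D = fglift g D.
Proof. by move=> fg; rewrite !fglift_sumE; apply: eq_bigr => z _; rewrite fg. Qed.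
End FreeLift.

Lemma linear_fglift (K : fieldType) (T : choiceType) (M N : lmodType K)
  (f : T -> M) (g : M -> N) (D : {freeg T / K}) :
  linear g -> g (fglift f D) = fglift (g \o f) D.
Proof.
move=> lin_g; pose L := GRing.isLinear.Build K M N *:%R g lin_g.
pose G : {linear M -> N} := HB.pack g L.
rewrite -[g]/(G : _ -> _) !fglift_sumE linear_sum; apply: eq_bigr => z _.
by rewrite linearZ.
Qed.

Lemma linear0_of (K : fieldType) (M N : lmodType K) (g : M -> N) :
  linear g -> g 0 = 0.
Proof. by move=> lin_g; rewrite -[0 in LHS](addNr 0) -scaleN1r lin_g scaleN1r addNr. Qed.

Lemma linearZ_of (K : fieldType) (M N : lmodType K) (g : M -> N) :
  linear g -> forall a x, g (a *: x) = a *: g x.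
Proof.
by move=> lin_g a x; rewrite -[a *: x]addr0 lin_g linear0_of // addr0.
Qed.

Fact lproj_linear (K : fieldType) (V : lmodType K) (S : V -> Prop) : linear (@lproj K V S).
Proof. by move=> a x y; rewrite lprojD -lprojZ. Qed.

Section LiebProperad.
Variables (K : fieldType) (c d : int).

Section Value.
Variables (P : properad K) (D : P 2%N 1%N (1 - c)) (B : P 1%N 2%N (1 - d)).
Hypothesis DB : lieb_relations D B.

Definition lieb_val m n p (x : lieb_car K c d m n p) : P m n p :=
  fglift (@lieb_eval K c d P D B m n p) (lrepr x).

Lemma lieb_val_proj m n p (x : {freeg (lieb_term c d m n p) / K}) :
  lieb_val (lproj (@lieb_null K c d m n p) x) = fglift (@lieb_eval K c d P D B m n p) x.
Proof.
apply/eqP; rewrite -subr_eq0 /lieb_val -linearB; apply/eqP.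
elim: (lrepr_proj (@lieb_null K c d m n p) x) => [|a s z Ss _ IH]; first exact: linear0.
by rewrite linearP /= IH addr0 (Ss P D B DB) scaler0.
Qed.

Lemma lieb_val_mon m n p (t : lieb_term c d m n p) :
  lieb_val (lieb_mon K t) = lieb_eval D B t.
Proof. by rewrite lieb_val_proj liftU scale1r. Qed.

Lemma lieb_val_linear m n p : linear (@lieb_val m n p).
Proof.
move=> a x y; rewrite -[x]lreprK -[y]lreprK -lproj_linear !lieb_val_proj.
exact: linearP.
Qed.

Lemma lieb_val_relab m n m' n' p (f : obij m m') (g : obij n n') x :
  lieb_val (@prelab K (lieb_data K c d) m n m' n' p f g x) = prelab f g (lieb_val x).
Proof.
rewrite (linear_fglift _ _ (@lieb_val_linear m' n' p)).
rewrite (linear_fglift _ _ (prelab_linear (pdataP P) f g)).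
by apply: eq_fglift => t; rewrite /= lieb_val_mon.
Qed.

Lemma lieb_val_comp k m1 n1 m2 n2 p q r (hk : (0 < k)%N) (e : q + p = r) y x :
  lieb_val (@pcompose K (lieb_data K c d) k m1 n1 m2 n2 p q r hk e y x)
  = pcompose hk e (lieb_val y) (lieb_val x).
Proof.
rewrite (linear_fglift _ _ (@lieb_val_linear _ _ r)).
rewrite (linear_fglift _ _ (pcompose_linearl (pdataP P) hk e _)).
apply: eq_fglift => t /=.
rewrite (linear_fglift _ _ (@lieb_val_linear _ _ r)).
rewrite (linear_fglift _ _ (pcompose_linearr (pdataP P) hk e _)).
by apply: eq_fglift => u; rewrite /= lieb_val_mon.
Qed.

End Value.

Lemma lieb_ext m n p (x y : lieb_car K c d m n p) :
  (forall (P : properad K) (D : P 2%N 1%N (1 - c)) (B : P 1%N 2%N (1 - d)),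
     lieb_relations D B -> lieb_val D B x = lieb_val D B y) -> x = y.
Proof.
move=> eq_xy; rewrite -[x]lreprK -[y]lreprK; apply/eqP/lprojP/span_gen => P D B DB.
by rewrite linearB; apply/eqP; rewrite subr_eq0; apply/eqP/eq_xy.
Qed.


Lemma lieb_is_properad : is_properad (lieb_data K c d).
Proof.
split.
- move=> m n m' n' p f g a x y; apply: lieb_ext => P D B DB.
  rewrite lieb_val_linear // !lieb_val_relab // lieb_val_linear //.
  exact: (prelab_linear (pdataP P)).
- move=> m n p x; apply: lieb_ext => P D B DB.
  by rewrite lieb_val_relab // (prelab_id (pdataP P)).
- move=> m n m' n' m'' n'' p f g f' g' x; apply: lieb_ext => P D B DB.
  by rewrite !lieb_val_relab // (prelab_comp (pdataP P)).
- move=> k m1 n1 m2 n2 p q r hk e x a y y'; apply: lieb_ext => P D B DB.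
  rewrite lieb_val_linear // !lieb_val_comp // lieb_val_linear //.
  exact: (pcompose_linearl (pdataP P)).
- move=> k m1 n1 m2 n2 p q r hk e y a x x'; apply: lieb_ext => P D B DB.
  rewrite lieb_val_linear // !lieb_val_comp // lieb_val_linear //.
  exact: (pcompose_linearr (pdataP P)).
- move=> *; apply: lieb_ext => P D B DB.
  rewrite !(lieb_val_relab DB, lieb_val_comp DB); exact: (pcompose_relab (pdataP P)).
- move=> m n q h1 e y; apply: lieb_ext => P D B DB.
  rewrite (lieb_val_comp (m1 := 0) (n1 := 1) (m2 := m) (n2 := n) DB) /=.
  rewrite (lieb_val_mon DB); exact: (pcompose_idr (pdataP P)).
- move=> m n p h1 e x; apply: lieb_ext => P D B DB.
  rewrite (lieb_val_comp (n2 := 0) DB) lieb_val_relab //=.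
  rewrite (lieb_val_mon DB); exact: (pcompose_idl (pdataP P)).
- move=> *; apply: lieb_ext => P D B DB.
  rewrite !(lieb_val_relab DB, lieb_val_comp DB); exact: (pcompose_chain (pdataP P)).
- move=> *; apply: lieb_ext => P D B DB.
  rewrite (linearZ_of (@lieb_val_linear _ _ _ DB _ _ _)) !(lieb_val_relab DB, lieb_val_comp DB).
  exact: (pcompose_above (pdataP P)).
- move=> *; apply: lieb_ext => P D B DB.
  rewrite (linearZ_of (@lieb_val_linear _ _ _ DB _ _ _)) !(lieb_val_relab DB, lieb_val_comp DB).
  exact: (pcompose_below (pdataP P)).
Qed.

Definition Lieb : properad K := Properad lieb_is_properad.
Definition lieb_cobracket : Lieb 2%N 1%N (1 - c) := lieb_mon K (LCobracket c d).
Definition lieb_bracket : Lieb 1%N 2%N (1 - d) := lieb_mon K (LBracket c d).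

Lemma lieb_generators : lieb_relations lieb_cobracket lieb_bracket.
Proof.
have valD (P : properad K) D B (DB : @lieb_relations K c d P D B) m n p x y :
    lieb_val D B (x + y : Lieb m n p) = lieb_val D B x + lieb_val D B y.
  by rewrite -[x]scale1r lieb_val_linear // !scale1r.
have valZ (P : properad K) D B (DB : @lieb_relations K c d P D B) m n p a x :
    lieb_val D B (a *: x : Lieb m n p) = a *: lieb_val D B x.
  exact: (linearZ_of (@lieb_val_linear _ _ _ DB m n p)).
have val0 (P : properad K) D B (DB : @lieb_relations K c d P D B) m n p :
    lieb_val D B (0 : Lieb m n p) = 0.
  exact: (linear0_of (@lieb_val_linear _ _ _ DB m n p)).
split; cbv zeta; apply: lieb_ext => P D B DB;
  rewrite ?(valD, valZ, val0, lieb_val_relab DB) //.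
- by rewrite (lieb_val_mon DB) (lieb_cobracket_sym DB).
- by rewrite (lieb_val_mon DB) (lieb_bracket_sym DB).
- rewrite (lieb_val_comp (k := 1) (m1 := 1) (n1 := 1) (m2 := 2) (n2 := 0) DB).
  rewrite (lieb_val_mon DB); exact: (lieb_cojacobi DB).
- rewrite (lieb_val_comp (k := 1) (m1 := 0) (n1 := 2) (m2 := 1) (n2 := 1) DB).
  rewrite (lieb_val_mon DB); exact: (lieb_jacobi DB).
- rewrite (lieb_val_comp (k := 1) (m1 := 0) (n1 := 2) (m2 := 2) (n2 := 0) DB).
  rewrite (lieb_val_comp (k := 1) (m1 := 1) (n1 := 1) (m2 := 1) (n2 := 1) DB).
  rewrite !(lieb_val_mon DB); exact: (lieb_compat DB).
- rewrite (lieb_val_comp (k := 2) (m1 := 0) (n1 := 1) (m2 := 1) (n2 := 0) DB).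
  rewrite !(lieb_val_mon DB); exact: (lieb_involutive DB).
Qed.

End LiebProperad.

(* (e, false) and (e, true) are the tail and the head of the edge e. *)
Notation hedge k := ('I_k * bool)%type.

Section RibbonGraphs.

Fact hflip_inj k : injective (fun h : hedge k => (h.1, ~~ h.2)).
Proof. by move=> [e b] [e' b'] [-> /negb_inj->]. Qed.
Definition hflip k : {perm hedge k} := perm (@hflip_inj k).

(* A candidate ribbon graph with k numbered and directed edges, m boundaries  *)
(* and n vertices: the rotation sigma_0, and the labels of the vertex and of  *)
(* the boundary of a half-edge.  sigma_1 is hflip.                            *)
Definition ribbon k m n :=
  ({perm hedge k} * {ffun hedge k -> 'I_n} * {ffun hedge k -> 'I_m})%type.
HB.instance Definition _ k m n := Finite.on (ribbon k m n).

Definition rg_rot k m n (G : ribbon k m n) := G.1.1.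
Definition rg_vert k m n (G : ribbon k m n) := G.1.2.
Definition rg_bnd k m n (G : ribbon k m n) := G.2.

(* h |-> sigma_0^-1 (sigma_1 h), since (s * t) h = t (s h) in {perm _}. *)
Definition rg_face k m n (G : ribbon k m n) : {perm hedge k} :=
  (hflip k * (rg_rot G)^-1)%g.

(* The labels are bijections from the orbits of sigma_0 to the vertex labels, *)
(* and from those of sigma_0^-1 sigma_1 to the boundary labels; the graph is  *)
(* connected.  The only graph without edges has m = n = 1.                    *)
Definition rg_wf k m n (G : ribbon k m n) : bool :=
  [&& [forall h, forall h',
         (rg_vert G h == rg_vert G h') == (h' \in porbit (rg_rot G) h)],
      [forall h, forall h',
         (rg_bnd G h == rg_bnd G h') == (h' \in porbit (rg_face G) h)],
      if k == 0%N then (m == 1%N) && (n == 1%N)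
      else [forall i, exists h, rg_vert G h == i] &&
           [forall i, exists h, rg_bnd G h == i]
    & [forall h, forall h',
         connect (fun x y => (y == rg_rot G x) || (y == hflip k x)) h h']].

Definition rg_relab k m n m' n' (f : obij m m') (g : obij n n')
    (G : ribbon k m n) : ribbon k m' n' :=
  (rg_rot G, [ffun h => g (rg_vert G h)], [ffun h => f (rg_bnd G h)]).

Fact rg_relab_wf k m n m' n' (f : obij m m') (g : obij n n') (G : ribbon k m n) :
  rg_wf G -> rg_wf (rg_relab f g G).
Proof.
case/and4P=> /forallP vG /forallP bG sG cG; apply/and4P; split=> //.
- apply/forallP => h; apply/forallP => h'; rewrite !ffunE (inj_eq (@obij_inj _ _ g)).
  exact: (forallP (vG h)).
- apply/forallP => h; apply/forallP => h'; rewrite !ffunE (inj_eq (@obij_inj _ _ f)).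
  exact: (forallP (bG h)).
case: ifP sG => _; first by rewrite (obij_eq_dom f) (obij_eq_dom g).
case/andP=> /forallP vS /forallP bS; apply/andP; split; apply/forallP => i.
- have [j <-] := obij_surj g i; have /existsP[h /eqP <-] := vS j.
  by apply/existsP; exists h; rewrite ffunE.
- have [j <-] := obij_surj f i; have /existsP[h /eqP <-] := bS j.
  by apply/existsP; exists h; rewrite ffunE.
Qed.

(* The renumbering s and the reversal of the edges marked by r carry G to G'. *)
Definition rg_iso k m n (s : {perm 'I_k}) (r : {ffun 'I_k -> bool})
    (G G' : ribbon k m n) : bool :=
  let th (h : hedge k) : hedge k := (s h.1, h.2 (+) r h.1) in
  [forall h, [&& rg_rot G' (th h) == th (rg_rot G h),
                 rg_vert G' (th h) == rg_vert G h
               & rg_bnd G' (th h) == rg_bnd G h]].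

(* t is the permutation induced by s on T', embedded in T by j: the first     *)
(* element of j T' met after j x in its s-cycle is j (t x).  In other words   *)
(* the cycles of t are those of s from which the elements outside j T' have   *)
(* been erased.                                                               *)
Definition first_return (T T' : finType) (j : T' -> T) (s : {perm T}) (t : {perm T'})
    : bool :=
  [forall x, exists i : 'I_#|T|,
     ((s ^+ i.+1)%g (j x) == j (t x)) &&
     [forall l : 'I_i, (s ^+ l.+1)%g (j x) \notin codom j]].

Definition hedge_up k2 k1 (h : hedge k2) : hedge (k2 + k1) := (lshift k1 h.1, h.2).
Definition hedge_low k2 k1 (h : hedge k1) : hedge (k2 + k1) := (rshift k2 h.1, h.2).

Fact hflip_low_inj k2 k1 :
  injective (fun h : hedge (k2 + k1) => (h.1, (k2 <= h.1)%N (+) h.2)).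
Proof. by move=> [e b] [e' b'] /= [<- /addbI->]. Qed.
Definition hflip_low k2 k1 : {perm hedge (k2 + k1)} := perm (@hflip_low_inj k2 k1).

(* G arises from G1 and G2 by gluing the last c boundaries of G1 into the     *)
(* first c vertices of G2.  The half-edges of G2 at these vertices become     *)
(* half-edges at vertices of G1.  To say that they are inserted in corners is *)
(* to say that G1 is recovered from the rotation of G by erasing the          *)
(* half-edges of G2.  Let w be the boundary permutation of G where those are  *)
(* considered as free ends attached to G1, thus running around the boundaries *)
(* of G1.  The free ends met in a glued boundary are those of the             *)
(* corresponding vertex of G2, and they are met in the cyclic order opposite  *)
(* to its own: the boundary of a disc around the vertex is glued to that of   *)
(* G1 with reversed orientation.  The remaining conditions are the            *)
(* bookkeeping of labels.  Every way of reattaching corresponds to exactly    *)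
(* one G, where the edges of G2 are numbered before those of G1.              *)
Definition rg_glued c k1 m1 n1 k2 m2 n2 (G2 : ribbon k2 m2 (c + n2))
    (G1 : ribbon k1 (m1 + c) n1) (G : ribbon (k2 + k1) (m1 + m2) (n1 + n2)) : bool :=
  let up := @hedge_up k2 k1 in let low := @hedge_low k2 k1 in
  let w := (hflip_low k2 k1 * (rg_rot G)^-1)%g in
  [&& first_return low (rg_rot G) (rg_rot G1),
      first_return up w (rg_rot G2)^-1%g,
      [forall h, forall h', forall i : 'I_c,
         (rg_bnd G1 h == rshift m1 i) && (rg_vert G2 h' == lshift n2 i) ==>
         (up h' \in porbit w (low h))],
      [forall h, rg_vert G (low h) == lshift n2 (rg_vert G1 h)],
      [forall h, forall i : 'I_n2,
         (rg_vert G2 h == rshift c i) ==> (rg_vert G (up h) == rshift n1 i)],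
      [forall h, forall i : 'I_m1,
         (rg_bnd G1 h == lshift c i) ==> (rg_bnd G (low h) == lshift m2 i)]
    & [forall h, rg_bnd G (up h) == rshift m1 (rg_bnd G2 h)]].

Definition rg_point : ribbon 0 1 1 := (1%g, [ffun=> ord0], [ffun=> ord0]).
Definition rg_loop : ribbon 1 2 1 :=
  (hflip 1, [ffun=> ord0], [ffun h : hedge 1 => inord (nat_of_bool h.2)]).
Definition rg_edge : ribbon 1 1 2 :=
  (1%g, [ffun h : hedge 1 => inord (nat_of_bool h.2)], [ffun=> ord0]).

Fact rg_point_wf : rg_wf rg_point.
Proof. by apply/and4P; split=> //; apply/forallP => -[[]]. Qed.

Lemma hedge1E (h : hedge 1) : h = (ord0, h.2).
Proof. by case: h => e b; rewrite (ord1 e). Qed.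

Lemma inord_bool_eq (a b : bool) : ((inord a : 'I_2) == inord b) = (a == b).
Proof. by case: a; case: b; rewrite -val_eqE /= !inordK. Qed.

Lemma inord_bool_onto (i : 'I_2) : inord (i == 1%N :> nat) = i.
Proof. by apply: val_inj; case: i => [[|[|i]] //= lt_i]; rewrite inordK. Qed.

Lemma porbit_hflip1 (h h' : hedge 1) : h' \in porbit (hflip 1) h.
Proof.
rewrite (hedge1E h) (hedge1E h'); have [->|ne] := eqVneq h.2 h'.2; first exact: porbit_id.
have -> : (ord0, h'.2) = (hflip 1 ^+ 1)%g (ord0 : 'I_1, h.2).
  by rewrite expg1 permE /=; move: ne; case: h.2; case: h'.2.
exact: mem_porbit.
Qed.

Fact rg_loop_wf : rg_wf rg_loop.
Proof.
apply/and4P; split.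
- by apply/forallP => h; apply/forallP => h'; rewrite /= !ffunE eqxx porbit_hflip1.
- apply/forallP => h; apply/forallP => h'; rewrite /rg_face /rg_rot /= !ffunE mulgV.
  rewrite inord_bool_eq (hedge1E h) (hedge1E h') /=.
  apply/eqP; apply/idP/idP => [/eqP ->|]; first exact: porbit_id.
  by case/porbitP=> i; rewrite expg1n perm1 => -[->].
- apply/andP; split; apply/forallP => i.
    by apply/existsP; exists (ord0, false); rewrite /= ffunE (ord1 i).
  by apply/existsP; exists (ord0, i == 1%N :> nat); rewrite /= ffunE inord_bool_onto.
- apply/forallP => h; apply/forallP => h'; rewrite (hedge1E h) (hedge1E h').
  have [->|ne] := eqVneq h.2 h'.2; first exact: connect0.
  by apply: connect1; rewrite /= !permE /=; move: ne; case: h.2; case: h'.2; rewrite ?eqxx.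
Qed.

Fact rg_edge_wf : rg_wf rg_edge.
Proof.
apply/and4P; split.
- apply/forallP => h; apply/forallP => h'; rewrite /rg_rot /= !ffunE.
  rewrite inord_bool_eq (hedge1E h) (hedge1E h') /=.
  apply/eqP; apply/idP/idP => [/eqP ->|]; first exact: porbit_id.
  by case/porbitP=> i; rewrite expg1n perm1 => -[->].
- apply/forallP => h; apply/forallP => h'.
  by rewrite /rg_face /rg_rot /= !ffunE invg1 mulg1 eqxx porbit_hflip1.
- apply/andP; split; apply/forallP => i.
    by apply/existsP; exists (ord0, i == 1%N :> nat); rewrite /= ffunE inord_bool_onto.
  by apply/existsP; exists (ord0, false); rewrite /= ffunE (ord1 i).
- apply/forallP => h; apply/forallP => h'; rewrite (hedge1E h) (hedge1E h').
  have [->|ne] := eqVneq h.2 h'.2; first exact: connect0.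
  by apply: connect1; rewrite /= !permE /=; move: ne; case: h.2; case: h'.2; rewrite ?eqxx.
Qed.

End RibbonGraphs.

Section RibbonProperad.
Variables (K : fieldType) (d : int).

(* Ribbon graphs with k edges, in degree p. *)
Definition rg m n p k := {G : ribbon k m n | rg_wf G && (k%:Z * (1 - d) == p)}.
HB.instance Definition _ m n p k := Finite.on (rg m n p k).

Definition rg_basis m n p := {k : nat & rg m n p k}.
HB.instance Definition _ m n p := Choice.on (rg_basis m n p).

Definition rg_gen m n p k (G : rg m n p k) : {freeg (rg_basis m n p) / K} :=
  << Tagged (rg m n p) G >>.

Definition rg_sign k (s : {perm 'I_k}) (r : {ffun 'I_k -> bool}) : K :=
  if odd `|d| then \prod_i (-1) ^+ r i else (-1) ^+ s.

(* Orientations: a graph with numbered and directed edges is identified, up   *)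
(* to sign, with its renumberings and reversals.  For d even only the         *)
(* numbering contributes a sign, for d odd only the directions do.            *)
Definition rg_null m n p (x : {freeg (rg_basis m n p) / K}) : Prop :=
  exists k (s : {perm 'I_k}) (r : {ffun 'I_k -> bool}) (G G' : rg m n p k),
    rg_iso s r (val G) (val G') /\ x = rg_gen G' - rg_sign s r *: rg_gen G.

Definition rg_car m n p := lquot (@rg_null m n p).

Definition rg_class m n p k (G : rg m n p k) : rg_car m n p := lproj _ (rg_gen G).

Fact rg_relab_proof m n m' n' p k (f : obij m m') (g : obij n n') (G : rg m n p k) :
  rg_wf (rg_relab f g (val G)) && (k%:Z * (1 - d) == p).
Proof. by case/andP: (valP G) => wfG degG; apply/andP; split; first exact: rg_relab_wf. Qed.

Definition rg_comp c m1 n1 m2 n2 p q r k2 k1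
    (G2 : rg m2 (c + n2)%N q k2) (G1 : rg (m1 + c)%N n1 p k1) :
    rg_car (m1 + m2)%N (n1 + n2)%N r :=
  \sum_(G : rg (m1 + m2)%N (n1 + n2)%N r (k2 + k1)%N
        | rg_glued (val G2) (val G1) (val G)) rg_class G.

Fact rg_point_proof : rg_wf rg_point && (0%:Z * (1 - d) == 0).
Proof. by rewrite rg_point_wf mul0r eqxx. Qed.
Fact rg_loop_proof : rg_wf rg_loop && (1%:Z * (1 - d) == 1 - d).
Proof. by rewrite rg_loop_wf mul1r eqxx. Qed.
Fact rg_edge_proof : rg_wf rg_edge && (1%:Z * (1 - d) == 1 - d).
Proof. by rewrite rg_edge_wf mul1r eqxx. Qed.

(* Operations on classes are the linear extensions of those on graphs, which  *)
(* are compatible with rg_null; lrepr chooses representatives.                *)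
Definition RGra : properad_data K := PropData (K := K)
  (pcar := fun m n p => rg_car m n p)
  (fun m n m' n' p f g x =>
     fglift (fun b : rg_basis m n p =>
       rg_class (exist _ (rg_relab f g (val (tagged b))) (rg_relab_proof f g (tagged b)) :
                 rg m' n' p (tag b))) (lrepr x))
  (rg_class (exist _ rg_point rg_point_proof : rg 1 1 0 0))
  (fun c m1 n1 m2 n2 p q r _ _ y x =>
     fglift (fun b2 => fglift (fun b1 => rg_comp r (tagged b2) (tagged b1)) (lrepr x))
       (lrepr y)).

Definition RGra_loop : RGra 2%N 1%N (1 - d) :=
  rg_class (exist _ rg_loop rg_loop_proof : rg 2 1 (1 - d) 1).
Definition RGra_edge : RGra 1%N 2%N (1 - d) :=
  rg_class (exist _ rg_edge rg_edge_proof : rg 1 2 (1 - d) 1).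

End RibbonProperad.

(* Main.v *)
Require Import Defs.
From HB Require Import structures.
From mathcomp Require Import all_boot all_fingroup all_algebra.
From mathcomp Require Import freeg boolp zify.
Import GRing.Theory.

Set Implicit Arguments.
Unset Strict Implicit.
Unset Printing Implicit Defensive.

(** Gluing boundaries of a graph G1 into vertices of a graph G2 produces graphs
    G whose edges are those of G1 and those of G2.  The proof rests on one
    remark: G1 is G with the edges of G2 deleted, and G2 is G with the edges of
    G1 contracted.  Let s be the rotation of G, and a1, a2 the involutions that
    flip the edges of G1, resp. of G2, and fix the other half-edges.  Deletion
    replaces s by its first return to the half-edges of G1, and contraction
    replaces a1 o s by its first return to the half-edges of G2.  The orbits of
      s^-1,  s^-1 o a1,  s^-1 o a1 o a2
    are the vertices of G, then the boundaries of G1 together with the vertices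
    of G2, some of them glued in pairs, and finally the boundaries of G.  So a
    gluing amounts to labellings of these three levels of orbits.  Passing
    through Gi turns the labels of inputs of Gi into labels of outputs of Gi and
    leaves the other labels alone ([step], [glue]).

    Two gluings in a row have four levels.  [extend_labels] supplies the level
    which one of the two ways to bracket does not display, and the graph that
    the other bracketing needs is then read off by restriction ([glue_chain],
    [glue_above]).  Replacing s by a1 o a2 o s exchanges vertices and boundaries,
    deletion and contraction, and reverses the order of the levels, so that the
    remaining cases are dual to these ([glue_dual], [glue_chain_rev],
    [glue_below]).  An intermediate graph is determined by the total graph, hence
    an iterated composite is a sum over total graphs without multiplicities
    ([comp_comp_r], [comp_comp_l]) and the laws compare the index sets of two
    such sums.  The only sign is that of the exchange of two blocks of edges
    ([odd_oswap]); it is the Koszul sign.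

    A composite of two generators is a sum over graphs with four half-edges.
    Such a graph is a small table, and the tables that occur are found by
    computation ([enum_gluedP]).  Exchanging the two edges and reversing one of
    them changes the sign of an orientation, for d even because of the exchange
    and for d odd because of the reversal ([swap_sign1]).  In the co-Jacobi, the
    Jacobi and the compatibility relation this makes the graphs cancel in pairs.
    In the involutivity relation a single graph of genus one occurs, and such an
    exchange is an automorphism of it: it equals its opposite and vanishes in
    characteristic 0.  The morphism is the evaluation of formal monomials in the
    two generators, [lieb_val]. *)

(** * First returns of a permutation *)

Section FirstReturn.
Implicit Types T : finType.

Lemma mem_porbitP T (s : {perm T}) x y : reflect (exists n, y = iter n s x) (y \in porbit s x).
Proof.
by apply: (iffP (porbitP _ _ _)) => -[n ->]; exists n; rewrite permX.
Qed.

Lemma iter_in_porbit T (s : {perm T}) n x : iter n s x \in porbit s x.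
Proof. by apply/mem_porbitP; exists n. Qed.

Lemma porbitV_mem T (s : {perm T}) x y : (y \in porbit s^-1%g x) = (y \in porbit s x).
Proof. by rewrite porbitV. Qed.

Lemma porbit_step T (s : {perm T}) x : porbit s (s x) = porbit s x.
Proof. exact: (porbit_perm s 1). Qed.

Lemma porbit_trans T (s : {perm T}) y x z :
  y \in porbit s x -> z \in porbit s y -> z \in porbit s x.
Proof. by rewrite -eq_porbit_mem => /eqP ->. Qed.

Definition next_in T (A : pred T) (s : {perm T}) x y :=
  exists n, [/\ iter n.+1 s x = y, A y & forall l, (l < n)%N -> ~~ A (iter l.+1 s x)].

Lemma next_in_fun T (A : pred T) s x y y' : next_in A s x y -> next_in A s x y' -> y = y'.
Proof.
move=> [n [<- An nA]] [n' [<- An' nA']]; case: (ltngtP n n') => [lt|lt|-> //].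
- by rewrite (negPf (nA' _ lt)) in An.
- by rewrite (negPf (nA _ lt)) in An'.
Qed.

Lemma next_in_orbit T (A : pred T) s x y : next_in A s x y -> y \in porbit s x.
Proof. by case=> n [<- _ _]; apply: iter_in_porbit. Qed.

Lemma next_in_ex T (A : pred T) s x z : z \in porbit s x -> A z -> exists y, next_in A s x y.
Proof.
move=> zx Az.
have [m Am] : exists m, A (iter m.+1 s x).
  by move: zx; rewrite -porbit_step; case/mem_porbitP=> m Em; exists m; rewrite iterSr -Em.
have exA : exists m, A (iter m.+1 s x) by exists m.
case: (ex_minnP exA) => n An nmin.
exists (iter n.+1 s x), n; split=> // l ltl; apply/negP => Al.
by have := nmin _ Al; rewrite leqNgt ltl.
Qed.

Lemma next_in_inv T (A : pred T) s x y : A x -> next_in A s x y -> next_in A s^-1%g y x.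
Proof.
move=> Ax [n [Ey Ay nA]].
have back l : (l <= n.+1)%N -> iter l s^-1%g y = iter (n.+1 - l) s x.
  elim: l => [|l IH] ln; first by rewrite subn0 Ey.
  rewrite iterS IH; last exact: ltnW.
  by rewrite subSn // iterS permK.
exists n; split=> //; first by rewrite back // subnn.
move=> l ln; rewrite back; last lia.
have -> : (n.+1 - l.+1 = (n - l.+1).+1)%N by lia.
by apply: nA; lia.
Qed.

(** The first visit to a smaller set can be found by stages, along the visits
    to a larger one. *)
Lemma next_in_trans T (A B : pred T) s x z y : subpred A B ->
  next_in B s x z -> ~~ A z -> next_in A s z y -> next_in A s x y.
Proof.
move=> AB [n [Ez Bz nB]] nAz [m [Ey Ay nA]].
exists (n + m.+1)%N; split=> //.
- have -> : ((n + m.+1).+1 = m.+1 + n.+1)%N by lia.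
  by rewrite iterD Ez.
- move=> l ln; case: (ltngtP l n) => [lt|lt|->].
  + exact: contra (@AB _) (nB _ lt).
  + have -> : (l.+1 = (l - n.+1).+1 + n.+1)%N by lia.
    by rewrite iterD Ez; apply: nA; lia.
  + by rewrite Ez.
Qed.

Lemma next_in_sub T (A B : pred T) s x y : subpred A B -> next_in B s x y -> A y -> next_in A s x y.
Proof.
move=> AB [n [Ey By nB]] Ay; exists n; split=> // l ln.
exact: contra (@AB _) (nB _ ln).
Qed.

Lemma eq_next_in T (A : pred T) (s s' : {perm T}) x y :
  s x = s' x -> (forall z, z \in porbit s x -> ~~ A z -> s z = s' z) ->
  next_in A s x y -> next_in A s' x y.
Proof.
move=> Ex Es [n [Ey Ay nA]].
have E l : (l <= n)%N -> iter l.+1 s' x = iter l.+1 s x.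
  elim: l => [|l IH] ln /=; first by rewrite Ex.
  have := IH (ltnW ln); rewrite -!iterS => Hl; rewrite !(iterS l.+1) Hl.
  by rewrite -Es ?nA ?iter_in_porbit.
exists n; split=> //; first by rewrite E.
by move=> l ln; rewrite E ?nA // ltnW.
Qed.

Lemma next_in_map T (U : finType) (th : T -> U) (A : pred T) (A' : pred U) (s : {perm T}) (s' : {perm U}) x y :
  (forall z, s' (th z) = th (s z)) -> (forall z, A' (th z) = A z) ->
  next_in A s x y -> next_in A' s' (th x) (th y).
Proof.
move=> ths thA [n [Ey Ay nA]].
have E l : iter l s' (th x) = th (iter l s x) by elim: l => //= l ->.
exists n; split; rewrite ?E ?Ey ?thA // => l ln.
by rewrite E thA nA.
Qed.

(** Permutations that agree outside A move x in the same way until A is met.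
    So either they all bring x to one and the same point of A, or none of them
    ever leaves the complement of A and x has the same orbit under all. This
    is how orbits at different levels of a gluing are compared. *)
Lemma hit_or_miss T (A : pred T) (s : {perm T}) x :
  (exists y, A y /\ forall s' : {perm T}, (forall z, ~~ A z -> s' z = s z) -> y \in porbit s' x) \/
  (forall s' : {perm T}, (forall z, ~~ A z -> s' z = s z) ->
     porbit s' x =i porbit s x /\ forall y, y \in porbit s' x -> ~~ A y).
Proof.
have [[m Am]|no] := pselect (exists m, A (iter m s x)).
  have exA : exists m, A (iter m s x) by exists m.
  left; case: (ex_minnP exA) => n An nmin.
  exists (iter n s x); split=> // s' ss'; apply/mem_porbitP; exists n.
  have : (n <= n)%N by []; elim: {-2}n => //= l IH ln.
  rewrite -IH ?(ltnW ln) // ss' //; apply/negP => /nmin; lia.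
right=> s' ss'.
have nA m : ~~ A (iter m s x) by apply/negP => ?; apply: no; exists m.
have E m : iter m s' x = iter m s x by elim: m => //= m ->; rewrite ss'.
split=> [y|y /mem_porbitP[m ->]]; last by rewrite E.
by apply/mem_porbitP/mem_porbitP => -[m ->]; exists m; rewrite E.
Qed.

(** The relation [first_return] without its bound on return times, which the
    order of the permutation supplies. *)
Definition ret T T' (j : T' -> T) (s : {perm T}) (t : {perm T'}) :=
  forall x, next_in (mem (codom j)) s (j x) (j (t x)).

Lemma first_returnP T T' (j : T' -> T) s t : reflect (ret j s t) (first_return j s t).
Proof.
apply: (iffP forallP) => H x.
  have /existsP[i /andP[/eqP Ei /forallP nA]] := H x.
  exists i; split; rewrite -?permX ?Ei ?inE ?codom_f // => l ln.
  by rewrite -permX; apply: (nA (Ordinal ln)).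
have [n [En An nA]] := H x.
suff ltn : (n < #|T|)%N.
  apply/existsP; exists (Ordinal ltn); rewrite permX En eqxx /=.
  by apply/forallP => l; rewrite permX; apply: nA.
have gt0 : (0 < #|porbit s (j x)|)%N by rewrite (cardD1 (j x)) porbit_id.
have le := max_card (mem (porbit s (j x))).
rewrite ltnNge; apply/negP => leT.
have := nA #|porbit s (j x)|.-1; rewrite prednK // => /(_ (leq_trans le leT)).
by rewrite iter_porbit inE codom_f.
Qed.

Section Ret.
Variables (T T' : finType) (j : T' -> T).
Hypothesis jI : injective j.
Implicit Types (s a : {perm T}) (t b : {perm T'}).

Lemma ret_fun s t t' : ret j s t -> ret j s t' -> t = t'.
Proof. by move=> H H'; apply/permP => x; apply: jI; apply: next_in_fun (H x) (H' x). Qed.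

Lemma retV s t : ret j s t -> ret j s^-1%g t^-1%g.
Proof.
move=> H x; have := next_in_inv _ (H (t^-1%g x)); rewrite permKV; apply.
exact: codom_f.
Qed.

Lemma ret_ex s : exists t, ret j s t.
Proof.
have ex x : exists y, next_in (mem (codom j)) s (j x) (j y).
  have [y ny] := next_in_ex (porbit_id s (j x)) (codom_f j x : mem (codom j) (j x)).
  by have [_ [_ /codomP[z Ez] _]] := ny; exists z; rewrite -Ez.
have [f Hf] := choice ex.
have fI : injective f.
  move=> x y E; apply: jI.
  have := next_in_inv (codom_f j x) (Hf x); rewrite E => /next_in_fun; apply.
  exact: next_in_inv (codom_f j y) (Hf y).
by exists (perm fI) => x; rewrite permE.
Qed.

(** Before the orbit comes back to the image of j, a permutation supported
    there intervenes in the first step only. *)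
Lemma ret_mull s t a b : (forall x, a (j x) = j (b x)) ->
  (forall z, z \notin codom j -> a z = z) -> ret j s t -> ret j (a * s)%g (b * t)%g.
Proof.
move=> ab aid H x; have [n [En An nA]] := H (b x).
have E l : (l <= n)%N -> iter l.+1 (a * s)%g (j x) = iter l.+1 s (j (b x)).
  elim: l => [|l IH] ln; first by rewrite /= permM ab.
  rewrite iterS IH; last exact: ltnW.
  by rewrite permM aid //; apply: nA.
exists n; rewrite permM; split=> //; first by rewrite E.
by move=> l ln; rewrite E ?nA // ltnW.
Qed.

Lemma ret_mulr s t a b : (forall x, a (j x) = j (b x)) ->
  (forall z, z \notin codom j -> a z = z) -> ret j s t -> ret j (s * a)%g (t * b)%g.
Proof.
move=> ab aid H.
have abV x : a^-1%g (j x) = j (b^-1%g x) by apply: (@perm_inj _ a); rewrite ab !permKV.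
have aidV z : z \notin codom j -> a^-1%g z = z.
  by move=> nz; apply: (@perm_inj _ a); rewrite permKV aid.
have := retV (ret_mull abV aidV (retV H)).
by rewrite !invMg !invgK.
Qed.

(** Erasing points from the cycles of s neither splits nor merges the cycles
    that keep a point. *)
Lemma ret_orbit s t : ret j s t -> forall x y, (j y \in porbit s (j x)) = (y \in porbit t x).
Proof.
move=> H x y; apply/idP/idP; last first.
  case/mem_porbitP=> n ->; elim: n => [|n IH] /=; first exact: porbit_id.
  exact: porbit_trans IH (next_in_orbit (H _)).
case/mem_porbitP=> n; elim/ltn_ind: n x => -[|n] IH x.
  by move=> /jI ->; apply: porbit_id.
move=> E; have [m [Em Am nA]] := H x.
have le : (m <= n)%N.
  by rewrite leqNgt; apply/negP => /nA; rewrite -E inE codom_f.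
have : y \in porbit t (t x).
  apply: (IH (n - m)%N); first by rewrite ltnS leq_subr.
  by rewrite -Em -iterD E -subSS subnK.
by rewrite porbit_step.
Qed.

Lemma eq_ret s s' t : (forall x z, z \in porbit s (j x) -> s z = s' z) ->
  ret j s t -> ret j s' t.
Proof.
move=> E H x; apply: eq_next_in (H x); first by apply: (E x); apply: porbit_id.
by move=> z zx _; apply: (E x).
Qed.
End Ret.

(** Deleting edges in two stages or at once gives the same cycles. *)
Lemma ret_comp (T T' T'' : finType) (j : T' -> T) (i : T'' -> T') s t u :
  injective j -> ret j s t -> ret i t u -> ret (j \o i) s u.
Proof.
move=> jI H H' x.
have [n [En _ nA]] := H' x.
have sub : subpred (mem (codom (j \o i))) (mem (codom j)).
  by move=> z /codomP[w ->]; apply: codom_f.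
have := codom_f (j \o i) (u x); rewrite /= -En.
elim: n {En} (i x) nA => [|n IH] y nA Ay; first exact: next_in_sub sub (H y) Ay.
apply: next_in_trans sub (H y) _ _.
  by apply: contra (nA 0%N isT) => /codomP[w /= /jI ->]; apply: codom_f.
rewrite iterSr; apply: IH; rewrite -?iterSr //.
by move=> l ln; rewrite -iterSr; apply: nA.
Qed.

Lemma ret_comp_fun (T T' T'' : finType) (j : T' -> T) (i : T'' -> T') s t u :
  injective j -> injective i -> ret j s t -> ret (j \o i) s u -> ret i t u.
Proof.
move=> jI iI H H'; have [v Hv] := ret_ex iI t.
by rewrite (ret_fun (inj_comp jI iI) H' (ret_comp jI H Hv)).
Qed.

Lemma ret_map (T T' U U' : finType) (th : T -> U) (th' : T' -> U') (j : T' -> T) (j' : U' -> U)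
    (s : {perm T}) (t : {perm T'}) (s' : {perm U}) (t' : {perm U'}) :
  injective th -> bijective th' ->
  (forall z, s' (th z) = th (s z)) -> (forall z, t' (th' z) = th' (t z)) ->
  (forall z, j' (th' z) = th (j z)) -> ret j s t -> ret j' s' t'.
Proof.
move=> thI [ti tK iK] Hs Ht Hj H x; rewrite -[x]iK Ht !Hj.
apply: next_in_map (H _) => // z; rewrite !inE.
apply/codomP/codomP => [[w]|[w ->]]; last by exists (th' w); rewrite Hj.
by rewrite -[w]iK Hj => /thI ->; exists (ti w).
Qed.

Lemma porbit_map (T U : finType) (th : T -> U) (s : {perm T}) (s' : {perm U}) x y :
  injective th ->
  (forall z, s' (th z) = th (s z)) -> (th y \in porbit s' (th x)) = (y \in porbit s x).
Proof.
move=> thI H.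
have E l : iter l s' (th x) = th (iter l s x) by elim: l => //= l ->.
by apply/mem_porbitP/mem_porbitP => -[n En]; exists n; [apply: thI; rewrite En E | rewrite E -En].
Qed.

End FirstReturn.

(** * Gluing of graphs with named vertices and boundaries *)

Section NamedGraphs.
Variable U : eqType.
Implicit Types (H : finType) (I O : pred U).

(** Vertices and boundaries carry names from one type U. Gluing is then by
    equality of names, and no reordering of label sets is needed when several
    graphs are composed. *)
Record graph H := Graph
  { rot : {perm H}; flip : {perm H}; vert : H -> U; bnd : H -> U }.

Definition face H (g : graph H) : {perm H} := (flip g * (rot g)^-1)%g.

Definition orbit_labels H (s : {perm H}) (L : H -> U) :=
  forall x y, (L x == L y) = (y \in porbit s x).

(** A graph without half-edges is a point: its single vertex and its single
    boundary still have a name, though no half-edge carries it. *)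
Definition fills H I (L : H -> U) :=
  (forall h, I (L h)) /\
  (inhabited H /\ (forall u, I u -> exists h, L h = u) \/
   ~ inhabited H /\ exists u, I =1 pred1 u).

(** Connectedness in the form in which it is used: a property that is
    invariant under both permutations holds everywhere or nowhere. *)
Definition conn H (g : graph H) := forall P : pred H,
  (forall x, P (rot g x) = P x) -> (forall x, P (flip g x) = P x) -> forall x y, P x = P y.

(** The predicates I and O are the sets of names of the inputs (vertices) and
    of the outputs (boundaries). *)
Record wf H I O (g : graph H) : Prop := Wf {
  flipK : involutive (flip g);
  vert_orbit : orbit_labels (rot g) (vert g);
  bnd_orbit : orbit_labels (face g) (bnd g);
  vert_fills : fills I (vert g);
  bnd_fills : fills O (bnd g);
  wf_conn : conn g }.

(** The effect on the name l of an orbit of passing through a graph with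
    inputs I and outputs O: an input is consumed and an output appears in its
    place; any other name persists. *)
Definition step I O (l l' : U) := if I l then O l' else ~~ O l' && (l' == l).

(** The half-edges of the composite are those of the graph glued below,
    included by low, and those of the graph above, included by up. The
    permutation a flips the edges of the graph below only. *)
Record parts (H1 H2 H : finType) (low : H1 -> H) (up : H2 -> H)
    (f1 : {perm H1}) (f2 : {perm H2}) (f a : {perm H}) : Prop := Parts {
  low_inj : injective low;
  up_inj : injective up;
  low_up : forall x y, low x <> up y;
  parts_cover : forall z, (exists x, z = low x) \/ (exists y, z = up y);
  f_low : forall x, f (low x) = low (f1 x);
  f_up : forall y, f (up y) = up (f2 y);
  a_low : forall x, a (low x) = low (f1 x);
  a_up : forall y, a (up y) = up y }.

(** Here g arises from x and y by gluing the outputs of x to the inputs of y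
    of the same name. The function L of the field glue_mid names the orbits of
    a o rot^-1 in the order of {perm _}, that is of the boundaries of x and of
    the vertices of y when the half-edges of y are free ends on x. *)
Record glue (H1 H2 H : finType) (low : H1 -> H) (up : H2 -> H) (a : {perm H})
    I1 O1 I2 O2 (x : graph H1) (y : graph H2) (g : graph H) : Prop := Glue {
  glue_parts : parts low up (flip x) (flip y) (flip g) a;
  glue_low : ret low (rot g) (rot x);
  glue_up : ret up (a * (rot g)^-1)%g (rot y)^-1%g;
  glue_mid : exists L, [/\ orbit_labels (a * (rot g)^-1)%g L,
     forall h, step I1 O1 (vert g h) (L h), forall h, step I2 O2 (L h) (bnd g h),
     forall h, L (low h) = bnd x h & forall h, L (up h) = vert y h];
  glue_vert : forall h, vert g (low h) = vert x h;
  glue_bnd : forall h, bnd g (up h) = bnd y h }.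

Definition compI I1 O1 I2 : pred U := fun u => I1 u || I2 u && ~~ O1 u.
Definition compO O1 I2 O2 : pred U := fun u => O2 u || O1 u && ~~ I2 u.

Lemma orbit_labels_eq H (s : {perm H}) L x y :
  orbit_labels s L -> y \in porbit s x -> L y = L x.
Proof. by move=> sL; rewrite -sL => /eqP. Qed.

Lemma orbit_labelsV H (s : {perm H}) L : orbit_labels s L -> orbit_labels s^-1%g L.
Proof. by move=> sL x y; rewrite porbitV_mem. Qed.

Lemma ret_labels H H' (j : H' -> H) s t L : injective j -> ret j s t ->
  orbit_labels s L -> orbit_labels t (L \o j).
Proof. by move=> jI jst sL x y; rewrite /= sL (ret_orbit jI jst). Qed.

Lemma invol_invg H (s : {perm H}) : involutive s -> s^-1%g = s.
Proof. by move=> sK; apply/permP => x; apply: (@perm_inj _ s); rewrite permKV sK. Qed.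

Lemma fills_mem H I (L : H -> U) (h : H) : fills I L -> I (L h).
Proof. by case. Qed.

Lemma fills_onto H I (L : H -> U) (h : H) u : fills I L -> I u -> exists h', L h' = u.
Proof. by case=> _ [[_ onto] /onto|[[]]]. Qed.

Lemma fills_point H I (L : H -> U) : fills I L -> ~ inhabited H -> exists u, I =1 pred1 u.
Proof. by case=> _ [[]|[]]. Qed.

(** Mirror image of the dual map: its vertices are the boundaries of g. With
    the inverse of the face permutation, rather than the face permutation
    itself, as rotation the construction is an involution without conjugation. *)
Definition dual H (g : graph H) := Graph (rot g * flip g)%g (flip g) (bnd g) (vert g).

Lemma dualK H (g : graph H) : involutive (flip g) -> dual (dual g) = g.
Proof.
move=> fK; case: g fK => r f v b /= fK; rewrite /dual /=; congr Graph.
by rewrite -mulgA -{1}(invol_invg fK) mulVg mulg1.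
Qed.

Lemma face_dual H (g : graph H) : face (dual g) = (rot g)^-1%g.
Proof. by rewrite /face /dual /= invMg mulgA mulgV mul1g. Qed.

Lemma rot_dual H (g : graph H) : involutive (flip g) -> rot (dual g) = (face g)^-1%g.
Proof. by move=> fK; rewrite /face /= invMg invgK (invol_invg fK). Qed.

Lemma wf_dual H I O (g : graph H) : wf I O g -> wf O I (dual g).
Proof.
case=> fK vo bo vf bf co; split=> //.
- by rewrite rot_dual //; apply: orbit_labelsV.
- by rewrite face_dual; apply: orbit_labelsV.
- move=> P Pr Pf; apply: co => // x; rewrite -Pf.
  by have := Pr x; rewrite permM.
Qed.

Lemma step_dual I O l l' : step I O l l' -> step O I l' l.
Proof.
rewrite /step; case: (boolP (I l)) => Il; first by move=> ->.
by case/andP=> /negPf -> /eqP ->; rewrite eqxx.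
Qed.

Lemma parts_dual (H1 H2 H : finType) (low : H1 -> H) (up : H2 -> H)
    (f1 : {perm H1}) (f2 : {perm H2}) (f a : {perm H}) :
  involutive f1 -> parts low up f1 f2 f a -> parts up low f2 f1 f (a * f)%g.
Proof.
move=> f1K [li ui lu co fl fu al au]; split=> //.
- by move=> x y /esym; apply: lu.
- by move=> z; case: (co z); [right|left].
- by move=> h; rewrite permM au fu.
- by move=> h; rewrite permM al fl f1K.
Qed.

Lemma parts_off_low (H1 H2 H : finType) (low : H1 -> H) (up : H2 -> H)
    (f1 : {perm H1}) (f2 : {perm H2}) (f a : {perm H}) :
  parts low up f1 f2 f a -> forall z, z \notin codom low -> a z = z.
Proof.
move=> p z nz; case: (parts_cover p z) nz => [[h ->]|[h -> _]]; first by rewrite codom_f.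
exact: a_up p h.
Qed.

Lemma parts_off_up (H1 H2 H : finType) (low : H1 -> H) (up : H2 -> H)
    (f1 : {perm H1}) (f2 : {perm H2}) (f a : {perm H}) :
  parts low up f1 f2 f a -> forall z, z \notin codom up -> a z = f z.
Proof.
move=> p z nz; case: (parts_cover p z) nz => [[h -> _]|[h ->]]; last by rewrite codom_f.
by rewrite (a_low p) (f_low p).
Qed.

(** Deletion and contraction are exchanged by duality while the intermediate
    permutation stays the same, so that the levels of the gluing are read
    backwards. *)
Lemma glue_dual (H1 H2 H : finType) (low : H1 -> H) (up : H2 -> H) a I1 O1 I2 O2 x y g :
  involutive (flip x) -> involutive (flip y) ->
  glue low up a I1 O1 I2 O2 x y g ->
  glue up low (a * flip g)%g O2 I2 O1 I1 (dual y) (dual x) (dual g).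
Proof.
move=> fx fy [p gl gu [L [Lo s1 s2 Ll Lu]] gv gb].
have q := parts_dual fx p.
have mid : (a * flip g * (rot (dual g))^-1 = a * (rot g)^-1)%g.
  by rewrite /= invMg mulgA -(mulgA a) mulgV mulg1.
have aK : involutive a.
  move=> z; case: (parts_cover p z) => -[h ->]; last by rewrite !(a_up p).
  by rewrite !(a_low p) fx.
split=> //.
- have := retV gu; rewrite invMg !invgK (invol_invg aK) => gu1.
  have := ret_mulr (a_low q) (parts_off_low q) gu1.
  by rewrite -mulgA (mulgA a) -{1}(invol_invg aK) mulVg mul1g.
- rewrite mid /= invMg (invol_invg fx).
  exact: ret_mull (a_low p) (parts_off_low p) (retV gl).
- by exists L; rewrite mid; split=> // h /=; apply: step_dual.
Qed.

(** A composite of connected graphs along at least one name is connected and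
    has the expected names. The statements on boundaries are those on vertices
    for the dual gluing. Points need care: if x is a point, its vertex gets
    its half-edges from the glued vertex of y. *)
Lemma glue_wf (H1 H2 H : finType) (low : H1 -> H) (up : H2 -> H) a I1 O1 I2 O2 x y g :
  (exists u, O1 u && I2 u) -> wf I1 O1 x -> wf I2 O2 y ->
  glue low up a I1 O1 I2 O2 x y g ->
  orbit_labels (rot g) (vert g) -> orbit_labels (face g) (bnd g) ->
  wf (compI I1 O1 I2) (compO O1 I2 O2) g.
Proof.
move=> K wx wy G.
have vert_part : forall (H1 H2 H : finType) (low : H1 -> H) (up : H2 -> H) a I1 O1 I2 O2 x y g,
    (exists u, O1 u && I2 u) -> wf I1 O1 x -> wf I2 O2 y ->
    glue low up a I1 O1 I2 O2 x y g -> fills (compI I1 O1 I2) (vert g).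
  clear; move=> H1 H2 H low up a I1 O1 I2 O2 x y g [k /andP[k1 k2]] wx wy G.
  have [L [Lo s1 s2 Ll Lu]] := glue_mid G; have p := glue_parts G.
  split=> [h|].
    rewrite /compI; case: (parts_cover p h) => -[h' ->].
      by rewrite (glue_vert G) (fills_mem _ (vert_fills wx)).
    have := s1 (up h'); rewrite /step; case: (I1 _) => //=.
    by case/andP=> nO /eqP <-; rewrite nO Lu (fills_mem _ (vert_fills wy)).
  have [h1|n1] := pselect (inhabited H1).
    left; split=> [|u]; first by case: h1 => h; exists; apply: low h.
    have [h] := h1; case/orP => [uI|/andP[uI nO]].
      have [h' <-] := fills_onto h (vert_fills wx) uI.
      by exists (low h'); rewrite (glue_vert G).
    have [[h2]|n2] := pselect (inhabited H2).
      have [h' Eh] := fills_onto h2 (vert_fills wy) uI.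
      exists (up h'); have := s1 (up h'); rewrite /step Lu Eh (negPf nO).
      by case: (I1 _) => //= /eqP.
    have [u2 E2] := fills_point (vert_fills wy) n2.
    by move: k2 uI nO; rewrite !E2 /= => /eqP <- /eqP ->; rewrite k1.
  have [u1 E1] := fills_point (vert_fills wx) n1.
  have [v1 F1] := fills_point (bnd_fills wx) n1.
  have ek : k = v1 by move: k1; rewrite F1 => /eqP.
  have [[h2]|n2] := pselect (inhabited H2).
    (* The vertex of the point x is the glued vertex of y. *)
  left; split=> [|u]; first by exists; apply: up h2.
    case/orP => [uI|/andP[uI nO]].
      have [h' Eh] := fills_onto h2 (vert_fills wy) k2.
      exists (up h'); have := s1 (up h'); rewrite /step Lu Eh k1 E1 /=.
      by case: eqP => // -> _; move: uI; rewrite E1 => /eqP.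
    have [h' Eh] := fills_onto h2 (vert_fills wy) uI.
    exists (up h'); have := s1 (up h'); rewrite /step Lu Eh (negPf nO).
    by case: (I1 _) => //= /eqP.
  right; split=> [[h]|]; first by case: (parts_cover p h) => -[h' _]; [apply: n1|apply: n2].
  have [u2 E2] := fills_point (vert_fills wy) n2.
  have ek2 : k = u2 by move: k2; rewrite E2 => /eqP.
  exists u1 => u; rewrite /compI E1 E2 F1 -ek2 ek /=.
  by case: (u == v1); rewrite ?orbF ?andbF.
move=> vo bo; have [L [Lo s1 s2 Ll Lu]] := glue_mid G; have p := glue_parts G.
split=> //.
- move=> z; case: (parts_cover p z) => -[h ->].
    by rewrite !(f_low p) (flipK wx).
  by rewrite !(f_up p) (flipK wy).
- exact: (vert_part _ _ _ _ _ _ _ _ _ _ _ _ _ _ wx wy G).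
- have E u : compO O1 I2 O2 u = compI O2 I2 O1 u by [].
  have := vert_part _ _ _ _ _ _ _ _ _ _ _ _ _ _ (wf_dual wy) (wf_dual wx) (glue_dual (flipK wx) (flipK wy) G).
  by apply; case: K => k; rewrite andbC; exists k.
have [k /andP[k1 k2]] := K.
move=> P Pr Pf.
have Po z z' : z' \in porbit (rot g) z -> P z' = P z.
  by case/mem_porbitP=> n ->; elim: n => //= n <-; rewrite Pr.
have Pl : forall h h', P (low h) = P (low h').
  apply: (wf_conn wx (P := P \o low)) => h /=; last by rewrite -(f_low p) Pf.
  exact: Po (next_in_orbit (glue_low G h)).
have Pw z z' : z' \in porbit (a * (rot g)^-1)%g z -> P z' = P z.
  case/mem_porbitP=> n ->; elim: n => //= n <-; rewrite permM -Pr permKV.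
  move: (iter _ _ _) => t; case: (parts_cover p t) => -[h ->]; last by rewrite (a_up p).
  by rewrite (a_low p).
have Pu : forall h h', P (up h) = P (up h').
  apply: (wf_conn wy (P := P \o up)) => h /=; last by rewrite -(f_up p) Pf.
  have := Pw _ _ (next_in_orbit (glue_up G (rot y h))); rewrite permK /= => <-.
  by [].
have Plu h h' : P (low h) = P (up h').
  have [h1 E1] := fills_onto h (bnd_fills wx) k1.
  have [h2 E2] := fills_onto h' (vert_fills wy) k2.
  rewrite (Pl h h1) (Pu h' h2); apply/esym/Pw.
  by rewrite -Lo Ll Lu E1 E2.
by move=> z z'; case: (parts_cover p z) => -[h ->]; case: (parts_cover p z') => -[h' ->].
Qed.

(** A vertex of g at which only half-edges of y are visible is either a vertex
    of y, or the orbit meets a half-edge of x, whose vertex is known, unless x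
    is a point, which has a single vertex. *)
Lemma glue_vert_uniq (H1 H2 H : finType) (low : H1 -> H) (up : H2 -> H) a I1 O1 I2 O2 x y g g' :
  wf I1 O1 x -> orbit_labels (rot g) (vert g) -> orbit_labels (rot g') (vert g') ->
  glue low up a I1 O1 I2 O2 x y g -> glue low up a I1 O1 I2 O2 x y g' ->
  rot g = rot g' -> vert g =1 vert g'.
Proof.
move=> wx vo vo' G G' E h.
have [L [Lo s1 _ Ll Lu]] := glue_mid G; have [L' [Lo' s1' _ Ll' Lu']] := glue_mid G'.
have p := glue_parts G.
case: (parts_cover p h) => -[t ->]; first by rewrite (glue_vert G) (glue_vert G').
have := s1 (up t); have := s1' (up t); rewrite Lu Lu' /step.
case: (boolP (O1 (vert y t))) => [Oy|_]; last first.
  by case: (I1 _) => //= /eqP <-; case: (I1 _) => //= /eqP <-.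
case: (boolP (I1 (vert g' _))) => //= Ig'; case: (boolP (I1 (vert g _))) => //= Ig _ _.
have [[h1]|n1] := pselect (inhabited H1); last first.
  have [u1 E1] := fills_point (vert_fills wx) n1.
  by move: Ig Ig'; rewrite !E1 => /eqP -> /eqP ->.
have [t' Et'] := fills_onto h1 (bnd_fills wx) Oy.
have wt : low t' \in porbit (a * (rot g)^-1)%g (up t) by rewrite -Lo Ll Lu Et'.
have [[z [/codomP[s Ez] zP]]|no] := hit_or_miss (mem (codom low)) (rot g)^-1%g (up t); last first.
  have [|_ /(_ _ wt)] := no (a * (rot g)^-1)%g; last by rewrite inE codom_f.
  by move=> z nz; rewrite permM (parts_off_low p).
have := zP (rot g)^-1%g (fun _ _ => erefl); rewrite porbitV_mem Ez => st.
rewrite -(orbit_labels_eq vo st); rewrite E in st.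
by rewrite -(orbit_labels_eq vo' st) (glue_vert G) (glue_vert G').
Qed.

(** [glue_vert_uniq] gives the vertices, and for the dual gluings the
    boundaries. *)
Lemma glue_uniq (H1 H2 H : finType) (low : H1 -> H) (up : H2 -> H) a I1 O1 I2 O2 I O x y g g' :
  wf I1 O1 x -> wf I2 O2 y -> wf I O g -> wf I O g' ->
  glue low up a I1 O1 I2 O2 x y g -> glue low up a I1 O1 I2 O2 x y g' ->
  flip g = flip g' -> rot g = rot g' -> vert g =1 vert g' /\ bnd g =1 bnd g'.
Proof.
move=> wx wy wg wg' G G' Ef Er; split.
  exact: glue_vert_uniq wx (vert_orbit wg) (vert_orbit wg') G G' Er.
have := glue_dual (flipK wx) (flipK wy) G'; rewrite -Ef => dG'.
apply: (glue_vert_uniq (wf_dual wy) (vert_orbit (wf_dual wg)) (vert_orbit (wf_dual wg'))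
  (glue_dual (flipK wx) (flipK wy) G) dG').
by rewrite /= Ef Er.
Qed.

(** A glued vertex of y has the same mid-level orbit as a half-edge of x, and
    up to the first half-edge of x the rotation of g acts as the mid-level
    permutation: the vertex in g is one of x. *)
Lemma step_of_labels (H1 H2 H : finType) (low : H1 -> H) (up : H2 -> H) a I1 O1 I2 O2 O x y g L :
  wf I1 O1 x -> wf I2 O2 y -> wf (compI I1 O1 I2) O g ->
  parts low up (flip x) (flip y) (flip g) a ->
  ret up (a * (rot g)^-1)%g (rot y)^-1%g ->
  (forall u, ~~ (I1 u && I2 u)) ->
  orbit_labels (a * (rot g)^-1)%g L ->
  (forall h, L (low h) = bnd x h) -> (forall h, L (up h) = vert y h) ->
  (forall h, vert g (low h) = vert x h) ->
  (forall h, ~~ O1 (vert y h) -> vert g (up h) = vert y h) ->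
  forall h, step I1 O1 (vert g h) (L h).
Proof.
move=> wx wy wg p gu I12 Lo Ll Lu gv gw h; rewrite /step.
case: (parts_cover p h) => -[t ->] {h}.
  by rewrite Ll gv (fills_mem _ (vert_fills wx)) (fills_mem _ (bnd_fills wx)).
rewrite Lu; case: (boolP (O1 (vert y t))) => [Ot|nO]; last first.
  rewrite gw //= eqxx; case: ifP => // It; have := I12 (vert y t).
  by rewrite It (fills_mem _ (vert_fills wy)).
suff -> : I1 (vert g (up t)) by [].
have [[h1]|n1] := pselect (inhabited H1).
  have [t' Et'] := fills_onto h1 (bnd_fills wx) Ot.
  have wt : low t' \in porbit (a * (rot g)^-1)%g (up t) by rewrite -Lo Ll Lu Et'.
  have [[z [/codomP[s Ez] zP]]|no] := hit_or_miss (mem (codom low)) (rot g)^-1%g (up t); last first.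
    have [|_ /(_ _ wt)] := no (a * (rot g)^-1)%g; last by rewrite inE codom_f.
    by move=> z nz; rewrite permM (parts_off_low p).
  have := zP (rot g)^-1%g (fun _ _ => erefl); rewrite porbitV_mem Ez => st.
  by rewrite -(orbit_labels_eq (vert_orbit wg) st) gv (fills_mem _ (vert_fills wx)).
have [u E1] := fills_point (vert_fills wx) n1.
have [v F1] := fills_point (bnd_fills wx) n1.
have [|hh Ehh] := fills_onto (u := u) (up t) (vert_fills wg).
  by rewrite /compI E1 /= eqxx.
case: (parts_cover p hh) => -[s Es]; first by case: n1.
rewrite Es in Ehh.
have Os : O1 (vert y s).
  apply/negP => /negP/gw; rewrite Ehh => Eu; have := I12 u.
  by rewrite E1 /= eqxx Eu (fills_mem _ (vert_fills wy)).
have Est : vert y s = vert y t by move: Os Ot; rewrite !F1 => /eqP -> /eqP ->.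
have Ea : a = 1%g.
  by apply/permP => z; rewrite perm1; case: (parts_cover p z) => -[w ->]; [case: n1 | exact: a_up p w].
have : up s \in porbit (rot g) (up t).
  by move: (Lo (up t) (up s)); rewrite !Lu Est eqxx Ea mul1g porbitV_mem.
by move=> /(orbit_labels_eq (vert_orbit wg)) <-; rewrite Ehh E1 /= eqxx.
Qed.

(** It suffices to know the labels where they are prescribed by x and y, and
    that glued names have a common mid-level orbit. If an orbit meets both
    kinds of half-edges its name must be glued, for otherwise the boundary of
    g would be inherited from x as well as from y. *)
Lemma glue_of_labels (H1 H2 H : finType) (low : H1 -> H) (up : H2 -> H) a I1 O1 I2 O2 x y g :
  wf I1 O1 x -> wf I2 O2 y -> wf (compI I1 O1 I2) (compO O1 I2 O2) g ->
  parts low up (flip x) (flip y) (flip g) a ->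
  ret low (rot g) (rot x) ->
  ret up (a * (rot g)^-1)%g (rot y)^-1%g ->
  (forall u, ~~ (I1 u && I2 u)) -> (forall u, ~~ (O1 u && O2 u)) ->
  (forall h h', bnd x h = vert y h' -> up h' \in porbit (a * (rot g)^-1)%g (low h)) ->
  (forall h, vert g (low h) = vert x h) ->
  (forall h, ~~ O1 (vert y h) -> vert g (up h) = vert y h) ->
  (forall h, ~~ I2 (bnd x h) -> bnd g (low h) = bnd x h) ->
  (forall h, bnd g (up h) = bnd y h) ->
  glue low up a I1 O1 I2 O2 x y g.
Proof.
move=> wx wy wg p gl gu I12 O12 meet gv gw gc gb.
set w := (a * (rot g)^-1)%g in gu meet *.
have lw : ret low w (face x) by apply: ret_mull (a_low p) (parts_off_low p) (retV gl).
have exL h : exists u, (forall t, h = low t -> u = bnd x t) /\ (forall t, h = up t -> u = vert y t).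
  case: (parts_cover p h) => -[t ->].
    by exists (bnd x t); split=> [s /(low_inj p) -> //|s /(low_up p)].
  by exists (vert y t); split=> [s /esym /(low_up p) //|s /(up_inj p) ->].
have [L HL] := choice exL.
have Ll h : L (low h) = bnd x h by case: (HL (low h)) => + _; apply.
have Lu h : L (up h) = vert y h by case: (HL (up h)) => _; apply.
have lu h h' : (bnd x h == vert y h') = (up h' \in porbit w (low h)).
  apply/eqP/idP => [/meet //|hh'].
  case: (boolP (I2 (bnd x h))) => [Ih|/gc nI].
    have [h2 E2] := fills_onto h' (vert_fills wy) Ih.
    have up2 := meet h h2 (esym E2).
    rewrite -E2; apply/eqP; rewrite (vert_orbit wy) -porbitV_mem -(ret_orbit (up_inj p) gu).
    by apply: porbit_trans hh'; rewrite porbit_sym.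
  have agree z : ~~ mem (codom up) z -> face g z = w z.
    by move=> nz; rewrite !permM (parts_off_up p).
  have [[z [/codomP[s ->] zP]]|no] := hit_or_miss (mem (codom up)) w (low h); last first.
    by have [_ /(_ _ hh')] := no w (fun _ _ => erefl); rewrite inE codom_f.
  have := orbit_labels_eq (bnd_orbit wg) (zP _ agree); rewrite nI gb => E.
  have := O12 (bnd x h); rewrite (fills_mem h (bnd_fills wx)) -E.
  by rewrite (fills_mem s (bnd_fills wy)).
have Lo : orbit_labels w L.
  move=> z z'; case: (parts_cover p z) => -[h ->]; case: (parts_cover p z') => -[h' ->].
  - by rewrite !Ll (ret_orbit (low_inj p) lw) (bnd_orbit wx).
  - by rewrite Ll Lu lu.
  - by rewrite Ll Lu eq_sym lu porbit_sym.
  - by rewrite !Lu (ret_orbit (up_inj p) gu) porbitV_mem (vert_orbit wy).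
split=> //; exists L; split=> //; first exact: step_of_labels wx wy wg p gu I12 Lo Ll Lu gv gw.
move=> h; apply: step_dual.
have p' := parts_dual (flipK wx) p.
have mid : (a * flip g * (rot (dual g))^-1 = w)%g.
  by rewrite /= invMg mulgA -(mulgA a) mulgV mulg1.
apply: (step_of_labels (wf_dual wy) (wf_dual wx) (wf_dual wg) p' (L := L)); rewrite ?mid //.
- by rewrite /= invMg (invol_invg (flipK wx)).
- by move=> u; rewrite andbC.
Qed.

End NamedGraphs.

(** * Associativity of gluing *)

Section Ternary.
Variable U : eqType.
Implicit Types (I O : pred U).

Lemma step_comp I O I' O' (l l1 l2 : U) : step I O l l1 -> step I' O' l1 l2 ->
  step (compI I O I') (compO O I' O') l l2.
Proof.
rewrite /step /compI /compO; case: (I l) => /= [Ol|/andP[nO /eqP E]]; last rewrite E in nO *.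
  by case: ifP => [_ ->|E /andP[_ /eqP ->]] //; rewrite Ol E orbT.
rewrite nO andbT; case: ifP => [_ ->|nI /andP[/negPf nO' /eqP E2]] //.
by rewrite nO' E2 (negPf nO) eqxx.
Qed.

Lemma eq_porbit (T : finType) (s s' : {perm T}) x :
  (forall z, z \in porbit s x -> s z = s' z) -> porbit s' x =i porbit s x.
Proof.
move=> E y.
have it n : iter n s' x = iter n s x by elim: n => //= n ->; rewrite E ?iter_in_porbit.
by apply/mem_porbitP/mem_porbitP => -[n ->]; exists n; rewrite it.
Qed.

Section Extend.
Variables (H1 H2 H3 H12 H : finType) (i1 : H1 -> H12) (i2 : H2 -> H12).
Variables (low : H12 -> H) (up : H3 -> H) (a' : {perm H12}) (a12 a1 : {perm H}).
Variables (I1 O1 I2 O2 I3 O3 O : pred U).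
Variables (x : graph U H1) (y : graph U H2) (z : graph U H3) (g' : graph U H12) (g : graph U H).
Hypothesis K : exists u, O1 u && I2 u.
Hypothesis I23 : forall u, ~~ (I2 u && I3 u).
Hypotheses (wx : wf I1 O1 x) (wy : wf I2 O2 y) (wz : wf I3 O3 z).
Hypothesis wg' : wf (compI I1 O1 I2) (compO O1 I2 O2) g'.
Hypothesis wg : wf (compI (compI I1 O1 I2) (compO O1 I2 O2) I3) O g.
Hypothesis G' : glue i1 i2 a' I1 O1 I2 O2 x y g'.
Hypothesis G : glue low up a12 (compI I1 O1 I2) (compO O1 I2 O2) I3 O3 g' z g.
Hypotheses (a1l : forall u, a1 (low u) = low (a' u)) (a1u : forall h, a1 (up h) = up h).

Lemma extend_low_off h : h \notin codom low -> a1 h = h.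
Proof.
by case: (parts_cover (glue_parts G) h) => -[t ->]; [rewrite codom_f | rewrite a1u].
Qed.

Lemma extend_ret : ret low (a1 * (rot g)^-1)%g (a' * (rot g')^-1)%g.
Proof. exact: ret_mull a1l extend_low_off (retV (glue_low G)). Qed.

(** Let g be glued from g' and z, where g' is glued from x and y. The orbits
    of the level between x and y are known on the half-edges of g' only.
    Starting anywhere in g, all the levels below z move in the same way until
    g' is met; the name found there is the name of the orbit. An orbit that
    never meets g' is a vertex of z and keeps its name, except when g' is a
    point: then its vertex has no half-edge in g' and its name must be
    translated by hand. *)
Lemma extend_labels : exists L1 L2 : H -> U,
  [/\ orbit_labels (a1 * (rot g)^-1)%g L1, orbit_labels (a12 * (rot g)^-1)%g L2,
      forall h, step I1 O1 (vert g h) (L1 h), forall h, step I2 O2 (L1 h) (L2 h)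
    & forall h, step I3 O3 (L2 h) (bnd g h)] /\
  [/\ forall h, L1 (low (i1 h)) = bnd x h, forall h, L1 (low (i2 h)) = vert y h,
      forall h, L2 (low h) = bnd g' h & forall h, L2 (up h) = vert z h].
Proof.
have p := glue_parts G; have p' := glue_parts G'.
have [L2 [Lo2 s12 s3 Ll2 Lu2]] := glue_mid G.
have [L1' [Lo1' s1' s2' Ll1' Lu1']] := glue_mid G'.
have [k /andP[k1 k2]] := K.
pose q (s : {perm H}) := forall t, t \notin codom low -> s t = (rot g)^-1%g t.
have q0 : q (rot g)^-1%g by [].
have q1 : q (a1 * (rot g)^-1)%g by move=> t nt; rewrite permM extend_low_off.
have q2 : q (a12 * (rot g)^-1)%g by move=> t nt; rewrite permM (parts_off_low p).
have Lo1l u u' : (L1' u == L1' u') = (low u' \in porbit (a1 * (rot g)^-1)%g (low u)).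
  by rewrite Lo1' (ret_orbit (low_inj p) extend_ret).
pose hits h u := forall s, q s -> low u \in porbit s h.
pose miss h := forall s, q s -> porbit s h =i porbit (rot g)^-1%g h /\
                       forall t, t \in porbit s h -> t \notin codom low.
have hitP h : (exists u, hits h u) \/ miss h.
  have [[t [/codomP[u ->] Ht]]|no] := hit_or_miss (mem (codom low)) (rot g)^-1%g h.
    by left; exists u => s qs; apply: Ht.
  by right.
have missP h : miss h -> [/\ ~ inhabited H12 & I1 (vert g h)] \/
    [/\ ~~ I1 (vert g h), ~~ O1 (vert g h), ~~ I2 (vert g h), I3 (vert g h) & L2 h = vert g h].
  move=> mh.
  have nhit : inhabited H12 -> ~~ compI I1 O1 I2 (vert g h).
    case=> t; apply/negP => /(fills_onto t (vert_fills wg'))[u Eu].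
    have : low u \in porbit (rot g)^-1%g h.
      by rewrite porbitV_mem -(vert_orbit wg) (glue_vert G) Eu.
    by case: (mh _ q0) => _ /[apply]; rewrite codom_f.
  have good : ~~ compI I1 O1 I2 (vert g h) ->
    [/\ ~~ I1 (vert g h), ~~ O1 (vert g h), ~~ I2 (vert g h), I3 (vert g h) & L2 h = vert g h].
    move=> nI; have := s12 h; rewrite /step (negPf nI) => /andP[nO /eqP E].
    rewrite E in nO *; have := fills_mem h (vert_fills wg).
    rewrite [compI _ _ I3 _]/compI (negPf nI) /= => /andP[I3h _].
    have := I23 (vert g h); rewrite I3h andbT => nI2.
    move: nI nO; rewrite /compI /compO (negPf nI2) /= orbF => ->.
    by rewrite andbT negb_or => /andP[_ ->].
  have [h12|n12] := pselect (inhabited H12); first by right; apply/good/nhit.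
  have n2 : ~ inhabited H2 by case=> t; apply: n12; exists; apply: i2 t.
  have n1 : ~ inhabited H1 by case=> t; apply: n12; exists; apply: i1 t.
  have [v E2] := fills_point (vert_fills wy) n2.
  have [w E1] := fills_point (bnd_fills wx) n1.
  have /orP[I1h|nI1] := orbN (I1 (vert g h)); first by left.
  right; apply: good; rewrite /compI (negPf nI1) /=.
  by move: k1 k2; rewrite !E1 !E2 /= => /eqP -> /eqP ->; case: (_ == _).
(* When g' is a point, the name of its vertex becomes the name k of its
   boundary. *)
pose R h l := (exists u, hits h u /\ l = L1' u) \/
              (miss h /\ l = if I1 (vert g h) then k else vert g h).
have exL h : exists l, R h l.
  case: (hitP h) => [[u hu]|mh]; first by exists (L1' u); left; exists u.
  by eexists; right; split; [exact: mh | reflexivity].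
have [L1 HL] := choice exL.
have Ll u : L1 (low u) = L1' u.
  case: (HL (low u)) => [[u' [hu ->]]|[mu _]].
    by apply/eqP; rewrite Lo1l porbit_sym; apply: hu.
  by case: (mu _ q0) => _ /(_ _ (porbit_id _ _)); rewrite codom_f.
have hitL h u : hits h u -> [/\ vert g h = vert g (low u), L1 h = L1' u & L2 h = L2 (low u)].
  move=> hu; split.
  - have := hu _ q0; rewrite porbitV_mem => E.
    by rewrite (orbit_labels_eq (vert_orbit wg) E).
  - case: (HL h) => [[u' [hu' ->]]|[mu _]].
      apply/eqP; rewrite Lo1l; apply: porbit_trans (hu _ q1).
      by rewrite porbit_sym; apply: hu'.
    by case: (mu _ q0) => _ /(_ _ (hu _ q0)); rewrite codom_f.
  - by rewrite (orbit_labels_eq Lo2 (hu _ q2)).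
have sub u : [/\ step I1 O1 (vert g (low u)) (L1' u) & step I2 O2 (L1' u) (L2 (low u))].
  by rewrite (glue_vert G) Ll2; split; [apply: s1'|apply: s2'].
have missL h : miss h -> L1 h = if I1 (vert g h) then k else vert g h.
  move=> mh; case: (HL h) => [[u [hu _]]|[_ ->] //].
  by case: (mh _ q0) => _ /(_ _ (hu _ q0)); rewrite codom_f.
exists L1, L2; split; [split=> // [|h|h] | split=> // h].
- move=> h h'.
  have mix t t' u : hits t u -> miss t' ->
      (L1 t == L1 t') = (t' \in porbit (a1 * (rot g)^-1)%g t).
    move=> tu mt'; have [_ -> _] := hitL _ _ tu.
    transitivity false.
      rewrite missL //; case: (missP _ mt') => [[n12]|[/negPf nI1 nO1 nI2 I3t' E2]].
        by case: n12; exists.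
      rewrite nI1; apply/eqP => E; have [_] := sub u; rewrite /step E (negPf nI2).
      case/andP=> _ /eqP El.
      have : low u \in porbit (a12 * (rot g)^-1)%g t' by rewrite -Lo2 El E2.
      by case: (mt' _ q2) => _ /[apply]; rewrite codom_f.
    apply/esym/negbTE/negP; rewrite porbit_sym => tt'.
    have := porbit_trans tt' (tu _ q1).
    by case: (mt' _ q1) => _ /[apply]; rewrite codom_f.
  case: (hitP h) => [[u hu]|mh]; case: (hitP h') => [[u' hu']|mh'].
  + have [_ -> _] := hitL _ _ hu; have [_ -> _] := hitL _ _ hu'.
    rewrite Lo1l -!eq_porbit_mem.
    have /eqP <- : porbit (a1 * (rot g)^-1)%g (low u) == porbit (a1 * (rot g)^-1)%g h.
      by rewrite eq_porbit_mem; apply: hu.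
    have /eqP <- // : porbit (a1 * (rot g)^-1)%g (low u') == porbit (a1 * (rot g)^-1)%g h'.
    by rewrite eq_porbit_mem; apply: hu'.
  + exact: mix hu mh'.
  + by rewrite eq_sym porbit_sym; apply: mix hu' mh.
  + have [-> _] := mh _ q1; rewrite porbitV_mem -(vert_orbit wg) !missL //.
    case: (missP _ mh) => [[n12 I1h]|[/negPf nI1 nO1 nI2 I3h E2]];
      case: (missP _ mh') => [[n12' I1h']|[/negPf nI1' nO1' nI2' I3h' E2']].
    * rewrite I1h I1h' eqxx.
      have n1 : ~ inhabited H1 by case=> t; apply: n12; exists; apply: i1 t.
      have [v E1] := fills_point (vert_fills wx) n1.
      by move: I1h I1h'; rewrite !E1 => /eqP -> /eqP ->; rewrite eqxx.
    * rewrite I1h nI1'; transitivity false; last by apply/esym/eqP => E; rewrite E nI1' in I1h.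
      by apply/eqP => E; rewrite -E k2 in nI2'.
    * rewrite nI1 I1h'; transitivity false; last by apply/esym/eqP => E; rewrite E I1h' in nI1.
      by apply/eqP => E; rewrite E k2 in nI2.
    * by rewrite nI1 nI1'.
- case: (hitP h) => [[u hu]|mh].
    by have [-> -> _] := hitL _ _ hu; case: (sub u).
  rewrite missL // /step; case: (missP _ mh) => [[_ ->] //|[/negPf -> -> _ _ _]] /=.
  exact: eqxx.
- case: (hitP h) => [[u hu]|mh].
    by have [_ -> ->] := hitL _ _ hu; case: (sub u).
  have := s12 h; rewrite missL // /step; case: (missP _ mh) => [[n12 I1h]|[/negPf nI1 nO1 nI2 I3h ->]] /=.
    rewrite /compI /compO I1h /= k2 => /orP[//|/andP[O1L /negP[]]].
    have n1 : ~ inhabited H1 by case=> t; apply: n12; exists; apply: i1 t.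
    have [v E1] := fills_point (bnd_fills wx) n1.
    by move: O1L k1; rewrite !E1 => /eqP -> /eqP <-.
  rewrite nI1 (negPf nI2) /compI /compO nI1 (negPf nI2) eqxx andbT /=.
  by rewrite negb_or => /andP[->].
- by rewrite Ll Ll1'.
- by rewrite Ll Lu1'.
Qed.

End Extend.
End Ternary.

Section Associativity.
Variable U : eqType.
Implicit Types (I O : pred U).

(** The upper graph g'' has the levels between x and y, y and z, and above z,
    all restricted to the half-edges of y and z. *)
Lemma glue_chain (H1 H2 H3 H12 H23 H : finType) (i1 : H1 -> H12) (i2 : H2 -> H12)
    (low : H12 -> H) (up : H3 -> H) (j2 : H2 -> H23) (j3 : H3 -> H23)
    (low1 : H1 -> H) (up23 : H23 -> H)
    (a' : {perm H12}) (a12 a1 : {perm H}) (a2' f23 : {perm H23}) I1 O1 I2 O2 I3 O3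
    (x : graph U H1) (y : graph U H2) (z : graph U H3) (g' : graph U H12) (g : graph U H) :
  low \o i1 = low1 -> low \o i2 = up23 \o j2 -> up = up23 \o j3 ->
  (exists u, O1 u && I2 u) -> (exists u, O2 u && I3 u) ->
  (forall u, ~~ (I2 u && I3 u)) ->
  wf I1 O1 x -> wf I2 O2 y -> wf I3 O3 z ->
  wf (compI I1 O1 I2) (compO O1 I2 O2) g' ->
  wf (compI (compI I1 O1 I2) (compO O1 I2 O2) I3) (compO (compO O1 I2 O2) I3 O3) g ->
  parts j2 j3 (flip y) (flip z) f23 a2' -> parts low1 up23 (flip x) f23 (flip g) a1 ->
  glue i1 i2 a' I1 O1 I2 O2 x y g' ->
  glue low up a12 (compI I1 O1 I2) (compO O1 I2 O2) I3 O3 g' z g ->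
  exists g'', [/\ flip g'' = f23, wf (compI I2 O2 I3) (compO O2 I3 O3) g'',
    glue j2 j3 a2' I2 O2 I3 O3 y z g''
    & glue low1 up23 a1 I1 O1 (compI I2 O2 I3) (compO O2 I3 O3) x g'' g].
Proof.
move=> e1 e2 e3 K12 K23 I23 wx wy wz wg' wg p23 p1 G' G.
have p := glue_parts G; have p' := glue_parts G'.
have l1 h : low (i1 h) = low1 h by rewrite -e1.
have l2 h : low (i2 h) = up23 (j2 h) by rewrite -[RHS]/((up23 \o j2) h) -e2.
have l3 h : up h = up23 (j3 h) by rewrite e3.
have a1l u : a1 (low u) = low (a' u).
  case: (parts_cover p' u) => -[h ->].
    by rewrite (a_low p') !l1 (a_low p1).
  by rewrite (a_up p') !l2 (a_up p1).
have a1u h : a1 (up h) = up h by rewrite l3 (a_up p1).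
have [L1 [L2 [[Lo1 Lo2 s1 s2 s3] [L11 L12 L22 L23]]]] :=
  extend_labels K12 I23 wx wy wg' wg G' G a1l a1u.
have ret1 := extend_ret G a1l a1u.
have u23I := up_inj p1.
have [t Ht] := ret_ex u23I (a1 * (rot g)^-1)%g.
have a1Vl h : a1^-1%g (low1 (flip x h)) = low1 h by rewrite -(a_low p1) permK.
have a1Vu h : a1^-1%g (up23 h) = up23 h by rewrite -{1}(a_up p1 h) permK.
have ret2 : ret up23 (a12 * (rot g)^-1)%g (a2' * t)%g.
  rewrite -(mulgKV a1 a12) -mulgA; apply: ret_mull Ht => [h|h nh]; rewrite permM.
    case: (parts_cover p23 h) => -[s ->].
      by rewrite -l2 (a_low p) (f_up p') l2 a1Vu (a_low p23).
    by rewrite -l3 (a_up p) {1}l3 a1Vu (a_up p23).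
  case: (parts_cover p1 h) nh => -[s -> nh]; last by rewrite codom_f in nh.
  by rewrite -l1 (a_low p) (f_low p') l1 a1Vl l1.
have ret3 : ret up23 (flip g * (rot g)^-1)%g (f23 * t)%g.
  rewrite -(mulgKV a1 (flip g)) -mulgA; apply: ret_mull Ht => [h|h nh]; rewrite permM.
    by rewrite (f_up p1) a1Vu.
  case: (parts_cover p1 h) nh => -[s -> nh]; last by rewrite codom_f in nh.
  by rewrite (f_low p1) a1Vl.
pose g'' := Graph t^-1%g f23 (L1 \o up23) (bnd g \o up23).
have G2 : glue j2 j3 a2' I2 O2 I3 O3 y z g''.
  split=> //=.
  - have := ret_comp (low_inj p) ret1 (glue_up G'); rewrite e2 => R.
    by rewrite -[rot y]invgK; apply: retV (ret_comp_fun u23I (low_inj p23) Ht R).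
  - have := glue_up G; rewrite e3 => R; rewrite invgK.
    exact: ret_comp_fun u23I (up_inj p23) ret2 R.
  - exists (L2 \o up23); rewrite invgK; split=> [|h|h|h|h] /=.
    + exact: ret_labels u23I ret2 Lo2.
    + exact: s2.
    + exact: s3.
    + by rewrite -l2 L22 (glue_bnd G').
    + by rewrite -l3 L23.
  - by move=> h; rewrite -l2 L12.
  - by move=> h; rewrite -l3 (glue_bnd G).
exists g''; split=> //.
  apply: (glue_wf K23 wy wz G2).
    by rewrite -[rot _]invgK; apply: orbit_labelsV; rewrite /= invgK; apply: ret_labels Ht Lo1.
  by rewrite /face /= invgK; apply: ret_labels ret3 (bnd_orbit wg).
split=> //=.
- by rewrite -e1; apply: ret_comp (low_inj p) (glue_low G) (glue_low G').
- by rewrite invgK.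
- exists L1; split=> // h; last by rewrite -l1 L11.
  exact: step_comp (s2 h) (s3 h).
- by move=> h; rewrite -l1 (glue_vert G) (glue_vert G').
Qed.

(** If y and z are glued to x but not to each other, then y and z meet
    different orbits of the level above x, and flipping the edges of z first
    does not change what y sees. The new level, between z and y, has the names
    of the last level on the orbits that meet z (the set S of the proof) and
    those of the first one elsewhere. *)
Lemma glue_above (H1 H2 H3 H12 H13 H : finType) (i1 : H1 -> H12) (i2 : H2 -> H12)
    (low : H12 -> H) (up : H3 -> H) (k1 : H1 -> H13) (k3 : H3 -> H13)
    (low13 : H13 -> H) (up2 : H2 -> H)
    (a' : {perm H12}) (a12 a13 : {perm H}) (b' f13 : {perm H13}) I1 O1 I2 O2 I3 O3
    (x : graph U H1) (y : graph U H2) (z : graph U H3) (g' : graph U H12) (g : graph U H) :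
  low13 \o k1 = low \o i1 -> low13 \o k3 = up -> up2 = low \o i2 ->
  (exists u, O1 u && I2 u) -> (exists u, O1 u && I3 u) ->
  (forall u, ~~ (I2 u && I3 u)) -> (forall u, ~~ (O2 u && I3 u)) ->
  (forall u, ~~ (I2 u && O3 u)) -> (forall u, ~~ (O2 u && O3 u)) ->
  wf I1 O1 x -> wf I2 O2 y -> wf I3 O3 z ->
  wf (compI I1 O1 I2) (compO O1 I2 O2) g' ->
  wf (compI (compI I1 O1 I2) (compO O1 I2 O2) I3) (compO (compO O1 I2 O2) I3 O3) g ->
  parts k1 k3 (flip x) (flip z) f13 b' -> parts low13 up2 f13 (flip y) (flip g) a13 ->
  glue i1 i2 a' I1 O1 I2 O2 x y g' ->
  glue low up a12 (compI I1 O1 I2) (compO O1 I2 O2) I3 O3 g' z g ->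
  exists g'', [/\ flip g'' = f13, wf (compI I1 O1 I3) (compO O1 I3 O3) g'',
    glue k1 k3 b' I1 O1 I3 O3 x z g''
    & glue low13 up2 a13 (compI I1 O1 I3) (compO O1 I3 O3) I2 O2 g'' y g].
Proof.
move=> e1 e3 e2 K12 K13 I2I3 O2I3 I2O3 O2O3 wx wy wz wg' wg p13 q G' G.
have p := glue_parts G; have p' := glue_parts G'.
have l1 h : low (i1 h) = low13 (k1 h) by rewrite -[RHS]/((low13 \o k1) h) e1.
have l2 h : low (i2 h) = up2 h by rewrite e2.
have l3 h : up h = low13 (k3 h) by rewrite -e3.
(* On the edges of x all three factors act, on those of y and z two of them:
   a1 flips the edges of x only. *)
pose a1 := (a12 * a13 * flip g)%g.
have a11 h : a1 (low13 (k1 h)) = low13 (k1 (flip x h)).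
  rewrite /a1 !permM -l1 (a_low p) (f_low p') l1 (a_low q) (f_low p13) (flipK wx).
  by rewrite (f_low q) (f_low p13).
have a12E h : a1 (up2 h) = up2 h.
  by rewrite /a1 !permM -l2 (a_low p) (f_up p') l2 (a_up q) (f_up q) (flipK wy).
have a13E h : a1 (up h) = up h.
  by rewrite /a1 !permM (a_up p) l3 (a_low q) (f_up p13) -l3 (f_up p) (flipK wz).
clearbody a1.
have a1l u : a1 (low u) = low (a' u).
  case: (parts_cover p' u) => -[h ->]; first by rewrite (a_low p') !l1 a11.
  by rewrite (a_up p') l2 a12E.
have [L1 [L2 [[Lo1 Lo2 s1 s2 s3] [L11 L12 L22 L23]]]] :=
  extend_labels K12 I2I3 wx wy wg' wg G' G a1l a13E.
have ret1 := extend_ret G a1l a13E.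
have lI := low_inj q.
have cov h : [\/ exists s, h = low13 (k1 s), exists s, h = up2 s | exists s, h = up s].
  case: (parts_cover q h) => -[s ->]; last by apply: Or32; exists s.
  by case: (parts_cover p13 s) => -[r ->]; [apply: Or31|apply: Or33]; exists r.
pose S h := I3 (L1 h).
have S2 s : S (up2 s) = false.
  by rewrite /S -l2 L12; apply/negbTE; have := I2I3 (vert y s); rewrite (fills_mem s (vert_fills wy)).
have noI2 h : S h -> I2 (L1 h) = false.
  by rewrite /S => Sh; apply/negbTE; have := I2I3 (L1 h); rewrite Sh andbT.
have S12 h : S h = I3 (L2 h).
  have := s2 h; rewrite /step; case: ifP => [I2h O2h|_ /andP[_ /eqP ->] //].
  have := I2I3 (L1 h); rewrite I2h /S /= => /negbTE ->.
  by have := O2I3 (L2 h); rewrite O2h /= => /negbTE ->.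
have S23 h : S h = O3 (bnd g h).
  rewrite S12; have := s3 h; rewrite /step; case: ifP => [_ -> //|nI /andP[nO /eqP E]].
  exact/esym/negbTE.
have S3 s : S (up s) by rewrite S12 L23 (fills_mem _ (vert_fills wz)).
have L2S h : S h -> L2 h = L1 h.
  by move=> /noI2 nI; have := s2 h; rewrite /step nI => /andP[_ /eqP].
have L3n h : S h = false -> bnd g h = L2 h.
  by rewrite S12 => nI; have := s3 h; rewrite /step nI => /andP[_ /eqP].
(* The names of the level between z and y. *)
pose M h := if S h then bnd g h else L1 h.
have sM h : step I3 O3 (L1 h) (M h).
  rewrite /step /M -/(S h); case Sh: (S h); first by rewrite -S23.
  rewrite eqxx andbT; have := s2 h; rewrite /step; case: ifP => [I2h _|_ /andP[_ /eqP E]].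
    by have := I2O3 (L1 h); rewrite I2h.
  by rewrite -E -L3n // -S23 Sh.
have sM2 h : step I2 O2 (M h) (bnd g h).
  rewrite /M; case: ifP => Sh; last by rewrite L3n.
  rewrite /step; have Oh : O3 (bnd g h) by rewrite -S23.
  have := I2O3 (bnd g h); have := O2O3 (bnd g h).
  by rewrite Oh !andbT eqxx andbT => -> /negbTE ->.
(* On S the flip of the edges of x and z is the full flip, elsewhere it is the
   flip of the edges of x. *)
have aS h : S h -> (a13 * (rot g)^-1)%g h = face g h.
  move=> Sh; rewrite !permM; congr (_ _).
  case: (cov h) Sh => -[s ->]; first by rewrite (a_low q) (f_low q).
    by rewrite S2.
  by rewrite l3 (a_low q) (f_low q).
have anS h : S h = false -> (a13 * (rot g)^-1)%g h = (a1 * (rot g)^-1)%g h.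
  move=> Sh; rewrite !permM; congr (_ _).
  case: (cov h) Sh => -[s ->] Sh; first by rewrite a11 (a_low q) (f_low p13).
    by rewrite a12E (a_up q).
  by rewrite S3 in Sh.
have Sface h t : t \in porbit (face g) h -> S t = S h.
  by move/(orbit_labels_eq (bnd_orbit wg)); rewrite !S23 => ->.
have S1 h t : t \in porbit (a1 * (rot g)^-1)%g h -> S t = S h.
  by move/(orbit_labels_eq Lo1); rewrite /S => ->.
have poS h : S h -> porbit (a13 * (rot g)^-1)%g h =i porbit (face g) h.
  by move=> Sh; apply: eq_porbit => t /Sface St; rewrite aS // St.
have ponS h : S h = false -> porbit (a13 * (rot g)^-1)%g h =i porbit (a1 * (rot g)^-1)%g h.
  by move=> Sh; apply: eq_porbit => t /S1 St; rewrite anS // St.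
have LoM : orbit_labels (a13 * (rot g)^-1)%g M.
  have mix h h' : S h -> S h' = false -> (M h == M h') = (h' \in porbit (a13 * (rot g)^-1)%g h).
    move=> Sh Sh'; rewrite poS //; transitivity false; last first.
      by apply/esym/negbTE/negP => /Sface; rewrite Sh Sh'.
    rewrite /M Sh Sh'; apply/eqP => E; have := sM h'.
    by rewrite /M Sh' /step -/(S h') Sh' -E -S23 Sh.
  move=> h h'; case Sh: (S h); case Sh': (S h').
  - by rewrite poS // -(bnd_orbit wg) /M Sh Sh'.
  - exact: mix.
  - by rewrite eq_sym porbit_sym mix.
  - by rewrite ponS // -Lo1 /M Sh Sh'.
have [r Hr] := ret_ex lI (rot g).
have off13 h : h \notin codom low13 -> exists s, h = up2 s.
  by move=> nh; case: (parts_cover q h) nh => -[s -> nh]; [rewrite codom_f in nh|exists s].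
have Hr1 : ret low13 (a1 * (rot g)^-1)%g (b' * r^-1)%g.
  apply: ret_mull (retV Hr) => [h|h /off13[s ->] //].
  case: (parts_cover p13 h) => -[s ->]; first by rewrite a11 (a_low p13).
  by rewrite -l3 a13E (a_up p13) l3.
have Hr13 : ret low13 (a13 * (rot g)^-1)%g (f13 * r^-1)%g.
  apply: ret_mull (retV Hr) => [h|h /off13[s ->]]; first by rewrite (a_low q).
  by rewrite (a_up q).
pose g'' := Graph r f13 (vert g \o low13) (M \o low13).
have G13 : glue k1 k3 b' I1 O1 I3 O3 x z g''.
  split=> //=.
  - apply: (ret_comp_fun lI (low_inj p13) Hr); rewrite e1.
    exact: ret_comp (low_inj p) (glue_low G) (glue_low G').
  - apply: (ret_comp_fun lI (up_inj p13) Hr1); rewrite e3.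
    apply: eq_ret (glue_up G) => h t /(orbit_labels_eq Lo2) Et.
    have St : S t by rewrite S12 Et -S12.
    rewrite !permM; congr (_ _); case: (cov t) St => -[s ->].
    + by rewrite a11 -l1 (a_low p) (f_low p') l1.
    + by rewrite S2.
    + by rewrite a13E (a_up p).
  - exists (L1 \o low13); split=> [|h|h|h|h] /=.
    + exact: ret_labels lI Hr1 Lo1.
    + exact: s1.
    + exact: sM.
    + by rewrite -l1 L11.
    + by rewrite -l3 -L2S // L23.
  - by move=> h; rewrite -l1 (glue_vert G) (glue_vert G').
  - by move=> h; rewrite -l3 /M S3 (glue_bnd G).
exists g''; split=> //.
  apply: (glue_wf K13 wx wz G13); first exact: ret_labels lI Hr (vert_orbit wg).
  exact: ret_labels lI Hr13 LoM.
split=> //=.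
- have := ret_comp (low_inj p) ret1 (glue_up G'); rewrite -e2.
  apply: eq_ret => h t /S1; rewrite S2 => St; by rewrite anS.
- exists M; split=> // [h|h]; first exact: step_comp (s1 h) (sM h).
  by rewrite /M S2 -l2 L12.
- by move=> h; rewrite L3n ?S2 // -l2 L22 (glue_bnd G').
Qed.

End Associativity.

Section DualAssociativity.
Variable U : eqType.
Implicit Types (I O : pred U).

Lemma glue_dual_dual (H1 H2 H : finType) (low : H1 -> H) (up : H2 -> H) (a : {perm H})
    I1 O1 I2 O2 (x : graph U H1) (y : graph U H2) (g : graph U H) :
  involutive (flip x) -> involutive (flip y) -> involutive (flip g) ->
  glue up low (a * flip g)%g O2 I2 O1 I1 (dual y) (dual x) (dual g) ->
  glue low up a I1 O1 I2 O2 x y g.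
Proof.
move=> fx fy fg /(glue_dual (x := dual y) (y := dual x) fy fx).
by rewrite !dualK //= -mulgA -{1}(invol_invg fg) mulVg mulg1.
Qed.

(** Dual to [glue_chain]: the order of x, y, z is reversed. *)
Lemma glue_chain_rev (H1 H2 H3 H12 H23 H : finType) (i1 : H1 -> H12) (i2 : H2 -> H12)
    (low : H12 -> H) (up : H3 -> H) (j2 : H2 -> H23) (j3 : H3 -> H23)
    (low1 : H1 -> H) (up23 : H23 -> H)
    (a' f12 : {perm H12}) (a12 a1 : {perm H}) (a2' : {perm H23}) I1 O1 I2 O2 I3 O3
    (x : graph U H1) (y : graph U H2) (z : graph U H3) (g'' : graph U H23) (g : graph U H) :
  low \o i1 = low1 -> low \o i2 = up23 \o j2 -> up = up23 \o j3 ->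
  (exists u, O1 u && I2 u) -> (exists u, O2 u && I3 u) ->
  (forall u, ~~ (O1 u && O2 u)) ->
  wf I1 O1 x -> wf I2 O2 y -> wf I3 O3 z ->
  wf (compI I2 O2 I3) (compO O2 I3 O3) g'' ->
  wf (compI I1 O1 (compI I2 O2 I3)) (compO O1 (compI I2 O2 I3) (compO O2 I3 O3)) g ->
  parts i1 i2 (flip x) (flip y) f12 a' -> parts low up f12 (flip z) (flip g) a12 ->
  glue j2 j3 a2' I2 O2 I3 O3 y z g'' ->
  glue low1 up23 a1 I1 O1 (compI I2 O2 I3) (compO O2 I3 O3) x g'' g ->
  exists g', [/\ flip g' = f12, wf (compI I1 O1 I2) (compO O1 I2 O2) g',
    glue i1 i2 a' I1 O1 I2 O2 x y g'
    & glue low up a12 (compI I1 O1 I2) (compO O1 I2 O2) I3 O3 g' z g].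
Proof.
move=> e1 e2 e3 [k12 K12] [k23 K23] O12 wx wy wz wg'' wg p12 p G'' G.
have d'' := glue_dual (flipK wy) (flipK wz) G''.
have d := glue_dual (flipK wx) (flipK wg'') G.
have f12K : involutive f12.
  move=> h; case: (parts_cover p12 h) => -[s ->].
    by rewrite !(f_low p12) (flipK wx).
  by rewrite !(f_up p12) (flipK wy).
have [|||gd [Ef wd Gd1 Gd2]] := glue_chain (esym e3) (esym e2) (esym e1) _ _ _ (wf_dual wz) (wf_dual wy)
  (wf_dual wx) (wf_dual wg'') (wf_dual wg) (parts_dual (flipK wx) p12) (parts_dual f12K p) d'' d.
- by exists k23; rewrite andbC.
- by exists k12; rewrite andbC.
- by move=> u; rewrite andbC.
have fd : involutive (flip (dual gd)) := flipK wd.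
exists (dual gd); split=> //; first exact: wf_dual wd.
- by apply: (glue_dual_dual (flipK wx) (flipK wy) fd); rewrite dualK //= Ef.
- by apply: (glue_dual_dual fd (flipK wz) (flipK wg)); rewrite dualK.
Qed.

(** Dual to [glue_above]: z is glued above both x and y. *)
Lemma glue_below (H1 H2 H3 H13 H23 H : finType) (i1 : H1 -> H13) (i3 : H3 -> H13)
    (low2 : H2 -> H) (up13 : H13 -> H) (k2 : H2 -> H23) (k3 : H3 -> H23)
    (low1 : H1 -> H) (up23 : H23 -> H)
    (a' : {perm H13}) (a2 a1 : {perm H}) (b' f23 : {perm H23}) I1 O1 I2 O2 I3 O3
    (x : graph U H1) (y : graph U H2) (z : graph U H3) (g' : graph U H13) (g : graph U H) :
  up23 \o k3 = up13 \o i3 -> up23 \o k2 = low2 -> low1 = up13 \o i1 ->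
  (exists u, O1 u && I3 u) -> (exists u, O2 u && I3 u) ->
  (forall u, ~~ (O1 u && O2 u)) -> (forall u, ~~ (I1 u && O2 u)) ->
  (forall u, ~~ (O1 u && I2 u)) -> (forall u, ~~ (I1 u && I2 u)) ->
  wf I1 O1 x -> wf I2 O2 y -> wf I3 O3 z ->
  wf (compI I1 O1 I3) (compO O1 I3 O3) g' ->
  wf (compI I2 O2 (compI I1 O1 I3)) (compO O2 (compI I1 O1 I3) (compO O1 I3 O3)) g ->
  parts k2 k3 (flip y) (flip z) f23 b' -> parts low1 up23 (flip x) f23 (flip g) a1 ->
  glue i1 i3 a' I1 O1 I3 O3 x z g' ->
  glue low2 up13 a2 I2 O2 (compI I1 O1 I3) (compO O1 I3 O3) y g' g ->
  exists g'', [/\ flip g'' = f23, wf (compI I2 O2 I3) (compO O2 I3 O3) g'',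
    glue k2 k3 b' I2 O2 I3 O3 y z g''
    & glue low1 up23 a1 I1 O1 (compI I2 O2 I3) (compO O2 I3 O3) x g'' g].
Proof.
move=> e3 e2 e1 [u13 K13] [u23 K23] O1O2 I1O2 O1I2 I1I2 wx wy wz wg' wg p23 p G' G.
have d' := glue_dual (flipK wx) (flipK wz) G'.
have d := glue_dual (flipK wy) (flipK wg') G.
have f23K : involutive f23.
  move=> h; case: (parts_cover p23 h) => -[s ->].
    by rewrite !(f_low p23) (flipK wy).
  by rewrite !(f_up p23) (flipK wz).
have [||gd [Ef wd Gd1 Gd2]] := glue_above e3 e2 e1 _ _ O1O2 I1O2 O1I2 I1I2 (wf_dual wz) (wf_dual wx)
  (wf_dual wy) (wf_dual wg') (wf_dual wg) (parts_dual (flipK wy) p23) (parts_dual (flipK wx) p) d' d.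
- by exists u13; rewrite andbC.
- by exists u23; rewrite andbC.
have fd : involutive (flip (dual gd)) := flipK wd.
exists (dual gd); split=> //; first exact: wf_dual wd.
- by apply: (glue_dual_dual (flipK wy) (flipK wz) fd); rewrite dualK //= Ef.
- by apply: (glue_dual_dual (flipK wx) fd (flipK wg)); rewrite dualK.
Qed.

Definition giso (H H' : finType) (th : H -> H') (g : graph U H) (g' : graph U H') :=
  [/\ forall h, rot g' (th h) = th (rot g h), forall h, flip g' (th h) = th (flip g h),
      forall h, vert g' (th h) = vert g h & forall h, bnd g' (th h) = bnd g h].

(** Gluing is invariant under isomorphisms of the three graphs that respect
    the inclusions. *)
Lemma glue_map (H1 H2 H H1' H2' H' : finType) (th1 : H1 -> H1') (th2 : H2 -> H2') (th : H -> H')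
    (low : H1 -> H) (up : H2 -> H) (low' : H1' -> H') (up' : H2' -> H')
    (a : {perm H}) (a' : {perm H'}) I1 O1 I2 O2 x y g x' y' g' :
  bijective th1 -> bijective th2 -> bijective th ->
  (forall h, low' (th1 h) = th (low h)) -> (forall h, up' (th2 h) = th (up h)) ->
  (forall h, a' (th h) = th (a h)) ->
  giso th1 x x' -> giso th2 y y' -> giso th g g' ->
  glue low up a I1 O1 I2 O2 x y g -> glue low' up' a' I1 O1 I2 O2 x' y' g'.
Proof.
move=> b1 b2 b lowE upE aE [rx fx vx bx] [ry fy vy by_] [rg fg vg bg] G.
have thI := bij_inj b; have p := glue_parts G.
have [t1 t1K K1] := b1; have [t2 t2K K2] := b2; have [t tK Kt] := b.
have rgV h : (rot g')^-1%g (th h) = th ((rot g)^-1%g h).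
  by apply: (@perm_inj _ (rot g')); rewrite permKV rg permKV.
have ryV h : (rot y')^-1%g (th2 h) = th2 ((rot y)^-1%g h).
  by apply: (@perm_inj _ (rot y')); rewrite permKV ry permKV.
have wE h : (a' * (rot g')^-1)%g (th h) = th ((a * (rot g)^-1)%g h).
  by rewrite !permM aE rgV.
split.
- split.
  + by move=> h h'; rewrite -[h]K1 -[h']K1 !lowE => /thI /(low_inj p) ->.
  + by move=> h h'; rewrite -[h]K2 -[h']K2 !upE => /thI /(up_inj p) ->.
  + by move=> h h'; rewrite -[h]K1 -[h']K2 lowE upE => /thI /(low_up p).
  + move=> h; case: (parts_cover p (t h)) => -[s Es]; [left; exists (th1 s)|right; exists (th2 s)].
      by rewrite lowE -Es Kt.
    by rewrite upE -Es Kt.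
  + by move=> h; rewrite -[h]K1 lowE fg (f_low p) fx lowE.
  + by move=> h; rewrite -[h]K2 upE fg (f_up p) fy upE.
  + by move=> h; rewrite -[h]K1 lowE aE (a_low p) fx lowE.
  + by move=> h; rewrite -[h]K2 upE aE (a_up p).
- exact: ret_map thI b1 rg rx lowE (glue_low G).
- exact: ret_map thI b2 wE ryV upE (glue_up G).
- have [L [Lo s1 s2 Ll Lu]] := glue_mid G; exists (L \o t); split.
  + move=> h h'; rewrite /= Lo -(porbit_map _ _ thI wE).
    by rewrite !Kt.
  + by move=> h; rewrite -{1}[h]Kt vg; apply: s1.
  + by move=> h; rewrite -{2}[h]Kt bg; apply: s2.
  + by move=> h; rewrite -[h]K1 lowE /= tK bx Ll.
  + by move=> h; rewrite -[h]K2 upE /= tK vy Lu.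
- by move=> h; rewrite -[h]K1 lowE vg vx (glue_vert G).
- by move=> h; rewrite -[h]K2 upE bg by_ (glue_bnd G).
Qed.

Lemma conj_perm (H H' : finType) (th : H -> H') (a : {perm H}) : bijective th ->
  exists a' : {perm H'}, forall h, a' (th h) = th (a h).
Proof.
case=> t tK Kt.
have I : injective (fun h => th (a (t h))).
  by move=> h h' /(can_inj tK)/perm_inj/(can_inj Kt).
by exists (perm I) => h; rewrite permE tK.
Qed.

End DualAssociativity.

Section Names.

Definition name := (nat * nat)%type.

(** A name is a label together with a tag that tells the blocks of labels
    apart. *)
Definition nb t {n} (i : 'I_n) : name := (t, val i).
Definition nsum a b (f : 'I_a -> name) (g : 'I_b -> name) : 'I_(a + b) -> name :=
  fun i => match split i with inl x => f x | inr y => g y end.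
Definition rng n (f : 'I_n -> name) : pred name := fun u => [exists i, f i == u].

(** Distinct labels have distinct names, with tags in ts. For names built from
    blocks, disjointness becomes a computation on tags. *)
Definition named (ts : seq nat) n (f : 'I_n -> name) :=
  injective f /\ forall i, (f i).1 \in ts.

Lemma nsuml a b (f : 'I_a -> name) (g : 'I_b -> name) i : nsum f g (lshift b i) = f i.
Proof. by rewrite /nsum split_lshift. Qed.
Lemma nsumr a b (f : 'I_a -> name) (g : 'I_b -> name) i : nsum f g (rshift a i) = g i.
Proof. by rewrite /nsum split_rshift. Qed.

Lemma rng_f n (f : 'I_n -> name) i : rng f (f i).
Proof. by apply/existsP; exists i. Qed.

Lemma rngP n (f : 'I_n -> name) u : reflect (exists i, f i = u) (rng f u).
Proof. by apply: (iffP existsP) => -[i /eqP Ei]; exists i => //; apply/eqP. Qed.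

Lemma rng_nsum a b (f : 'I_a -> name) (g : 'I_b -> name) u :
  rng (nsum f g) u = rng f u || rng g u.
Proof.
apply/rngP/orP => [[i <-]|].
  by case: (split_ordP i) => j ->; rewrite ?nsuml ?nsumr; [left|right]; apply: rng_f.
by case=> /rngP[i <-]; [exists (lshift b i); rewrite nsuml | exists (rshift a i); rewrite nsumr].
Qed.

Lemma named_nb t n : named [:: t] (@nb t n).
Proof. by split=> [i j [] /val_inj //|i]; rewrite inE. Qed.

Lemma named_disj s1 s2 m n (f : 'I_m -> name) (g : 'I_n -> name) : named s1 f -> named s2 g ->
  ~~ has (mem s1) s2 -> forall i j, f i != g j.
Proof.
move=> [_ f1] [_ f2] /hasPn D i j; apply/eqP => E.
by have := D _ (f2 j); rewrite /= -E f1.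
Qed.

Lemma named_rng s1 s2 m n (f : 'I_m -> name) (g : 'I_n -> name) : named s1 f -> named s2 g ->
  ~~ has (mem s1) s2 -> forall u, ~~ (rng f u && rng g u).
Proof.
move=> nf ng D u; apply/negP => /andP[/rngP[i <-] /rngP[j E]].
by have := named_disj nf ng D i j; rewrite E eqxx.
Qed.

Lemma named_nsum s1 s2 m n (f : 'I_m -> name) (g : 'I_n -> name) : named s1 f -> named s2 g ->
  ~~ has (mem s1) s2 -> named (s1 ++ s2) (nsum f g).
Proof.
move=> nf ng D; have D' := named_disj nf ng D; case: nf ng => fI f1 [gI g1]; split.
  move=> i j; case: (split_ordP i) => i' ->; case: (split_ordP j) => j' ->;
    rewrite ?nsuml ?nsumr; last by move/gI->.
  - by move/fI->.
  - by move=> E; have := D' i' j'; rewrite E eqxx.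
  - by move=> E; have := D' j' i'; rewrite E eqxx.
by move=> i; case: (split_ordP i) => j ->; rewrite ?nsuml ?nsumr mem_cat ?f1 ?g1 ?orbT.
Qed.

(** A ribbon graph as a named graph. Renaming labels of the ribbon graph is
    the same as composing the naming functions with the inverse renaming. *)
Definition nm k m n (f : 'I_m -> name) (g : 'I_n -> name) (G : ribbon k m n) : graph name (hedge k) :=
  Graph (rg_rot G) (hflip k) (g \o rg_vert G) (f \o rg_bnd G).

Lemma hflipE k (h : hedge k) : hflip k h = (h.1, ~~ h.2).
Proof. by rewrite permE. Qed.

Lemma hflipK k : involutive (hflip k).
Proof. by case=> e b; rewrite !hflipE /= negbK. Qed.

Lemma hedge_inh k : k != 0%N -> inhabited (hedge k).
Proof. by case: k => // k _; exists; exact: (ord0, true). Qed.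

Lemma hedge0 (h : hedge 0) : False.
Proof. by case: h => -[]. Qed.

Lemma rng1 n (f : 'I_n -> name) : n = 1%N -> exists u, rng f =1 pred1 u.
Proof.
move=> e; subst n; exists (f ord0) => u; rewrite /= eq_sym; apply/rngP/eqP => [[i]|<-].
  by rewrite (ord1 i).
by exists ord0.
Qed.

Lemma nm_wf k m n (f : 'I_m -> name) (g : 'I_n -> name) (G : ribbon k m n) :
  injective f -> injective g -> rg_wf G -> wf (rng g) (rng f) (nm f g G).
Proof.
move=> fI gI /and4P[/forallP vG /forallP bG sG /forallP cG]; split.
- exact: hflipK.
- by move=> x y; rewrite /= (inj_eq gI); apply: (eqP (forallP (vG x) y)).
- by move=> x y; rewrite /= (inj_eq fI); apply: (eqP (forallP (bG x) y)).
- split=> [h|]; first exact: rng_f.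
  case: eqP sG => [k0 /andP[_ /eqP n1]|/eqP k0 /andP[/forallP vS _]]; [right|left]; split.
  + by case=> h; subst k; case: (hedge0 h).
  + exact: rng1.
  + exact: hedge_inh.
  + by move=> u /rngP[i <-]; have /existsP[h /eqP <-] := vS i; exists h.
- split=> [h|]; first exact: rng_f.
  case: eqP sG => [k0 /andP[/eqP n1 _]|/eqP k0 /andP[_ /forallP vS]]; [right|left]; split.
  + by case=> h; subst k; case: (hedge0 h).
  + exact: rng1.
  + exact: hedge_inh.
  + by move=> u /rngP[i <-]; have /existsP[h /eqP <-] := vS i; exists h.
move=> P Pr Pf x y; have := forallP (cG x) y.
apply: (@closed_connect _ _ P) => {}x {}y /orP[] /eqP ->; first exact/esym/Pr.
exact/esym/Pf.
Qed.

Lemma rng_card1 n (f : 'I_n -> name) u : injective f -> rng f =1 pred1 u -> n = 1%N.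
Proof.
move=> fI E; case: n f fI E => [|[|n]] f fI E //.
  by have := E u; rewrite /= eqxx => /rngP[[]].
have /eqP : pred1 u (f ord0) by rewrite -E rng_f.
have /eqP <- : pred1 u (f ord_max) by rewrite -E rng_f.
by move/fI.
Qed.

(** A named graph on directed edges comes from a ribbon graph as soon as its
    sets of names have the right number of elements, which [wf] ensures. *)
Lemma unname k m n (f : 'I_m -> name) (g : 'I_n -> name) (X : graph name (hedge k)) :
  injective f -> injective g -> flip X = hflip k -> wf (rng g) (rng f) X ->
  exists G, rg_wf G /\ nm f g G = X.
Proof.
move=> fI gI fX wX.
have [v Hv] := choice (fun h => rngP g (vert X h) (fills_mem h (vert_fills wX))).
have [b Hb] := choice (fun h => rngP f (bnd X h) (fills_mem h (bnd_fills wX))).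
exists (rot X, [ffun h => v h], [ffun h => b h]); split; last first.
  case: X fX wX v Hv b Hb => r fl vt bd /= -> _ v Hv b Hb.
  by rewrite /nm; congr Graph; apply: funext => h; rewrite /= /rg_vert /rg_bnd /= ffunE.
apply/and4P; split.
- apply/forallP => x; apply/forallP => y.
  by rewrite !ffunE -(inj_eq gI) !Hv (vert_orbit wX).
- apply/forallP => x; apply/forallP => y.
  by rewrite !ffunE -(inj_eq fI) !Hb (bnd_orbit wX) /face fX.
- case: eqP => [k0|/eqP/hedge_inh[h0]].
    have nh : ~ inhabited (hedge k) by case=> h; subst k; case: (hedge0 h).
    have [u1 E1] := fills_point (vert_fills wX) nh.
    have [u2 E2] := fills_point (bnd_fills wX) nh.
    by rewrite (rng_card1 gI E1) (rng_card1 fI E2).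
  apply/andP; split; apply/forallP => i; apply/existsP.
    have [h Eh] := fills_onto h0 (vert_fills wX) (rng_f g i).
    by exists h; rewrite ffunE -(inj_eq gI) Hv Eh.
  have [h Eh] := fills_onto h0 (bnd_fills wX) (rng_f f i).
  by exists h; rewrite ffunE -(inj_eq fI) Hb Eh.
- apply/forallP => x; apply/forallP => y; set e := (fun _ => _).
  have er z t : t \in porbit (rot X) z -> connect e z t.
    case/mem_porbitP=> l ->; elim: l => [|l IH] /=; first exact: connect0.
    by apply: connect_trans IH (connect1 _); rewrite /e /rg_rot /= eqxx.
  have ef z : connect e z (hflip k z) by apply: connect1; rewrite /e eqxx orbT.
  rewrite -(wf_conn wX (P := connect e x) _ _ x y) ?connect0 // => z; last first.
    rewrite fX; apply/idP/idP => H; apply: connect_trans H _; last exact: ef.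
    by rewrite -{2}[z](hflipK z).
  apply/idP/idP => H; apply: connect_trans H _; apply: er; rewrite ?(iter_in_porbit _ 1) //.
  by rewrite porbit_step porbit_id.
Qed.

Lemma nm_relab k m n m' n' (f : 'I_m' -> name) (g : 'I_n' -> name) (f0 : obij m m') (g0 : obij n n')
    (G : ribbon k m n) : nm f g (rg_relab f0 g0 G) = nm (f \o f0) (g \o g0) G.
Proof. by congr Graph; apply: funext => h /=; rewrite ffunE. Qed.

Lemma nm_inj k m n (f : 'I_m -> name) (g : 'I_n -> name) : injective f -> injective g ->
  injective (@nm k m n f g).
Proof.
move=> fI gI [[r v] b] [[r' v'] b'] [] /= er ev eb.
by congr ((_, _), _) => //; apply/ffunP => h; [apply: gI; have := congr1 (fun F => F h) ev
  | apply: fI; have := congr1 (fun F => F h) eb].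
Qed.

Lemma hflip_lowE k2 k1 h : hflip_low k2 k1 h = (h.1, (k2 <= h.1)%N (+) h.2).
Proof. by rewrite permE. Qed.

Lemma hedge_parts k2 k1 :
  parts (@hedge_low k2 k1) (@hedge_up k2 k1) (hflip k1) (hflip k2) (hflip (k2 + k1)) (hflip_low k2 k1).
Proof.
split.
- by move=> [e b] [e' b'] [/addnI/val_inj -> ->].
- by move=> [e b] [e' b'] [/val_inj -> ->].
- by move=> [e b] [e' b'] [E _]; have := ltn_ord e'; rewrite -E ltnNge leq_addr.
- case=> e b; case: (split_ordP e) => j ->; first by right; exists (j, b).
  by left; exists (j, b).
- by move=> h; rewrite !hflipE.
- by move=> h; rewrite !hflipE.
- by move=> [e b]; rewrite hflip_lowE hflipE /= /hedge_low /= leq_addr addTb.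
- by move=> [e b]; rewrite hflip_lowE /= leqNgt ltn_ord.
Qed.

Section GlueP.
Variables (c k1 m1 n1 k2 m2 n2 : nat) (s1 s2 s3 s4 s5 : seq nat).
Variables (mu1 : 'I_m1 -> name) (ka : 'I_c -> name) (nu1 : 'I_n1 -> name).
Variables (mu2 : 'I_m2 -> name) (nu2 : 'I_n2 -> name).
Hypotheses (M1 : named s1 mu1) (Ka : named s2 ka) (N1 : named s3 nu1)
  (M2 : named s4 mu2) (N2 : named s5 nu2).
Hypothesis fresh : uniq (s1 ++ s2 ++ s3 ++ s4 ++ s5).

Lemma fresh_disj : [/\ [/\ ~~ has (mem s1) s2, ~~ has (mem s1) s3, ~~ has (mem s1) s4 & ~~ has (mem s1) s5],
  [/\ ~~ has (mem s2) s3, ~~ has (mem s2) s4 & ~~ has (mem s2) s5],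
  ~~ has (mem s3) s4 /\ ~~ has (mem s3) s5 & ~~ has (mem s4) s5].
Proof.
move: fresh; rewrite !cat_uniq !has_cat !negb_or.
by case/and3P=> _ /and4P[-> -> -> ->] /and3P[_ /and3P[-> -> ->] /and3P[_ /andP[-> ->] /and3P[_ -> _]]].
Qed.

Lemma compI_rng : compI (rng nu1) (rng (nsum mu1 ka)) (rng (nsum ka nu2)) = rng (nsum nu1 nu2).
Proof.
have [[d12 d13 d14 d15] [d23 d24 d25] [d34 d35] d45] := fresh_disj.
apply: funext => u; rewrite /compI !rng_nsum.
have := named_rng M1 N2 d15 u; have := named_rng Ka N2 d25 u; have := named_rng N1 Ka.
by case: (rng mu1 u); case: (rng ka u); case: (rng nu1 u); case: (rng nu2 u).
Qed.

Lemma compO_rng : compO (rng (nsum mu1 ka)) (rng (nsum ka nu2)) (rng mu2) = rng (nsum mu1 mu2).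
Proof.
have [[d12 d13 d14 d15] [d23 d24 d25] [d34 d35] d45] := fresh_disj.
apply: funext => u; rewrite /compO !rng_nsum.
have := named_rng M1 N2 d15 u; have := named_rng Ka N2 d25 u; have := named_rng M1 Ka d12 u.
by case: (rng mu1 u); case: (rng ka u); case: (rng mu2 u); case: (rng nu2 u).
Qed.

Lemma comp_rng : compI (rng nu1) (rng (nsum mu1 ka)) (rng (nsum ka nu2)) = rng (nsum nu1 nu2) /\
  compO (rng (nsum mu1 ka)) (rng (nsum ka nu2)) (rng mu2) = rng (nsum mu1 mu2).
Proof using M1 Ka N1 M2 N2 fresh. by split; [apply: compI_rng | apply: compO_rng]. Qed.

(** The blocks of labels are M1, N1 (own to G1), M2, N2 (own to G2) and the
    block of glued labels, whose naming function ka is shared by the two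
    graphs. *)
Lemma glueP (G2 : ribbon k2 m2 (c + n2)) (G1 : ribbon k1 (m1 + c) n1)
    (G : ribbon (k2 + k1) (m1 + m2) (n1 + n2)) : rg_wf G2 -> rg_wf G1 -> rg_wf G ->
  rg_glued G2 G1 G <->
  glue (@hedge_low k2 k1) (@hedge_up k2 k1) (hflip_low k2 k1)
    (rng nu1) (rng (nsum mu1 ka)) (rng (nsum ka nu2)) (rng mu2)
    (nm (nsum mu1 ka) nu1 G1) (nm mu2 (nsum ka nu2) G2) (nm (nsum mu1 mu2) (nsum nu1 nu2) G).
Proof.
have [[d12 d13 d14 d15] [d23 d24 d25] [d34 d35] d45] := fresh_disj.
have [MKI _] := named_nsum M1 Ka d12; have [KNI _] := named_nsum Ka N2 d25.
have [MMI _] := named_nsum M1 M2 d14; have [NNI _] := named_nsum N1 N2 d35.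
move=> w2 w1 w.
have W1 := nm_wf MKI (proj1 N1) w1; have W2 := nm_wf (proj1 M2) KNI w2.
have W := nm_wf MMI NNI w.
split.
  case/and5P=> /first_returnP rl /first_returnP ru /forallP c3 /forallP c4 /and3P[/forallP c5 /forallP c6 /forallP c7].
  have [cI cO] := comp_rng.
  apply: glue_of_labels => //=; rewrite ?cI ?cO //.
  - exact: hedge_parts.
  - move=> u; rewrite rng_nsum.
    have := named_rng Ka N1; have := named_rng N1 N2 d35 u.
    have D : ~~ has (mem s3) s2 by rewrite has_sym.
    by have := named_rng N1 Ka D u; case: (rng nu1 u); case: (rng ka u); case: (rng nu2 u).
  - move=> u; rewrite rng_nsum.
    have := named_rng M1 M2 d14 u; have := named_rng Ka M2 d24 u.
    by case: (rng mu1 u); case: (rng ka u); case: (rng mu2 u).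
  - move=> h h' E; have := forallP (c3 h) h'.
    case: (split_ordP (rg_bnd G1 h)) E => i Ei; case: (split_ordP (rg_vert G2 h')) => j Ej;
      rewrite Ei Ej /= ?nsuml ?nsumr => E.
    + by have := named_disj M1 Ka d12 i j; rewrite E eqxx.
    + by have := named_disj M1 N2 d15 i j; rewrite E eqxx.
    + by rewrite (proj1 Ka _ _ E) => /forallP/(_ j); rewrite !eqxx.
    + by have := named_disj Ka N2 d25 i j; rewrite E eqxx.
  - by move=> h; rewrite (eqP (c4 h)) nsuml.
  - move=> h; case: (split_ordP (rg_vert G2 h)) => j Ej.
      by rewrite Ej nsuml rng_nsum rng_f orbT.
    by rewrite Ej nsumr => _; have /implyP := forallP (c5 h) j; rewrite Ej eqxx => /(_ isT)/eqP ->; rewrite nsumr.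
  - move=> h; case: (split_ordP (rg_bnd G1 h)) => j Ej; last first.
      by rewrite Ej nsumr rng_nsum rng_f.
    by rewrite Ej nsuml => _; have /implyP := forallP (c6 h) j; rewrite Ej eqxx => /(_ isT)/eqP ->; rewrite nsuml.
  - by move=> h; rewrite (eqP (c7 h)) nsumr.
case=> p rl ru [L [Lo st1 st2 Ll Lu]] gv gb; apply/and5P; split.
- exact/first_returnP.
- exact/first_returnP.
- apply/forallP => h; apply/forallP => h'; apply/forallP => i; apply/implyP => /andP[/eqP E1 /eqP E2].
  by rewrite -[_ \in _]Lo Ll Lu /= E1 E2 nsumr nsuml.
- by apply/forallP => h; apply/eqP/NNI; rewrite nsuml; apply: gv.
apply/and3P; split.
- apply/forallP => h; apply/forallP => i; apply/implyP => /eqP E; apply/eqP/NNI; rewrite nsumr.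
  have := st1 (hedge_up k1 h); rewrite Lu /step /= E nsumr rng_nsum.
  have -> : rng mu1 (nu2 i) || rng ka (nu2 i) = false.
    have := named_rng M1 N2 d15 (nu2 i); have := named_rng Ka N2 d25 (nu2 i).
    by rewrite rng_f !andbT => /negbTE -> /negbTE ->.
  by case: (rng nu1 _) => //= /eqP.
- apply/forallP => h; apply/forallP => i; apply/implyP => /eqP E; apply/eqP/MMI; rewrite nsuml.
  have := st2 (hedge_low k2 h); rewrite Ll /step /= E nsuml rng_nsum.
  have D : ~~ has (mem s2) s1 by rewrite has_sym.
  have -> : rng ka (mu1 i) || rng nu2 (mu1 i) = false.
    have := named_rng M1 N2 d15 (mu1 i); have := named_rng Ka M1 D (mu1 i).
    by rewrite rng_f /= andbT => /negbTE -> /negbTE ->.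
  by case/andP=> _ /eqP.
- by apply/forallP => h; apply/eqP/MMI; rewrite nsumr; apply: gb.
Qed.
End GlueP.

End Names.

(** * Ribbon graphs as named graphs: change of labels and of numbering *)

Section Bijections.

Lemma oidE n i : oid n i = i.
Proof. by rewrite /oid /obij_fun /= ffunE. Qed.

Lemma obij_ext m n (f g : obij m n) : f =1 g -> f = g.
Proof. by move=> E; apply: val_inj; apply/ffunP. Qed.

Lemma ocompE m n p (g : obij n p) (f : obij m n) i : ocomp g f i = g (f i).
Proof. by rewrite {1}/obij_fun /= ffunE. Qed.

Lemma osumE a b a' b' (f : obij a a') (g : obij b b') i : osum f g i = osum_fun f g i.
Proof. by rewrite {1}/obij_fun /= ffunE. Qed.

Lemma osum_id a b : osum (oid a) (oid b) = oid (a + b).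
Proof.
apply: obij_ext => i; rewrite osumE oidE /osum_fun.
by case: (split_ordP i) => j ->; rewrite ?split_lshift ?split_rshift oidE.
Qed.

End Bijections.

Section Transport.

Definition hmap k k' (s : obij k k') (r : 'I_k -> bool) (h : hedge k) : hedge k' :=
  (s h.1, h.2 (+) r h.1).

(** G' is G after renumbering its edges by s, reversing some according to r,
    and renaming its boundaries and vertices by f and g. Both isomorphisms and
    relabellings are special cases. *)
Definition rg_rel k k' m m' n n' (s : obij k k') (r : 'I_k -> bool) (f : obij m m') (g : obij n n')
    (G : ribbon k m n) (G' : ribbon k' m' n') := forall h,
  [/\ rg_rot G' (hmap s r h) = hmap s r (rg_rot G h),
      rg_vert G' (hmap s r h) = g (rg_vert G h) & rg_bnd G' (hmap s r h) = f (rg_bnd G h)].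

Lemma hmap_inj k k' (s : obij k k') r : injective (hmap s r).
Proof. by move=> [e b] [e' b'] [/obij_inj <- /addIb ->]. Qed.

Lemma hmap_bij k k' (s : obij k k') r : bijective (hmap s r).
Proof.
apply: inj_card_bij (@hmap_inj _ _ s r) _.
by rewrite !card_prod !card_ord (obij_eq_dom s).
Qed.

Lemma rng_obij n n' (f : 'I_n' -> name) (s : obij n n') : rng (f \o s) = rng f.
Proof.
apply: funext => u; apply/rngP/rngP => -[i <-]; first by exists (s i).
by have [j <-] := obij_surj s i; exists j.
Qed.

Lemma named_obij t n n' (f : 'I_n' -> name) (s : obij n n') : named t f -> named t (f \o s).
Proof. by case=> fI ft; split=> [i j /= /fI /obij_inj //|i]; apply: ft. Qed.

Lemma nsum_osum a b a' b' (f : 'I_a' -> name) (g : 'I_b' -> name) (s : obij a a') (t : obij b b') :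
  nsum f g \o osum s t = nsum (f \o s) (g \o t).
Proof.
apply: funext => i; rewrite /= /osum /obij_fun /= ffunE /osum_fun.
by case: (split_ordP i) => j ->; rewrite ?split_lshift ?split_rshift ?nsuml ?nsumr.
Qed.

Lemma rel_giso k k' m m' n n' (s : obij k k') r (f : obij m m') (g : obij n n')
    (G : ribbon k m n) (G' : ribbon k' m' n') F F' :
  rg_rel s r f g G G' -> giso (hmap s r) (nm (F \o f) (F' \o g) G) (nm F F' G').
Proof.
move=> R; split=> h /=; case: (R h) => e1 e2 e3; rewrite ?e1 ?e2 ?e3 //.
by rewrite !hflipE /hmap /= addNb.
Qed.

Lemma giso_sym (U : eqType) (H H' : finType) (th : H -> H') (ti : H' -> H) (g : graph U H) g' :
  cancel th ti -> cancel ti th -> giso th g g' -> giso ti g' g.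
Proof.
move=> tK Kt [er ef ev eb]; split=> h.
- by rewrite -{2}[h]Kt er tK.
- by rewrite -{2}[h]Kt ef tK.
- by rewrite -{2}[h]Kt ev.
- by rewrite -{2}[h]Kt eb.
Qed.

Lemma wf_map (U : eqType) (H H' : finType) (th : H -> H') I O (g : graph U H) g' :
  bijective th -> giso th g g' -> wf I O g -> wf I O g'.
Proof.
move=> b [er ef ev eb] w; have [ti tK Kt] := b; have thI := can_inj tK.
have inh : inhabited H' <-> inhabited H by split=> -[h]; exists; [apply: ti h|apply: th h].
have fc h : face g' (th h) = th (face g h).
  by apply: (@perm_inj _ (rot g')); rewrite !permM permKV ef er permKV.
split.
- by move=> h; rewrite -[h]Kt !ef (flipK w).
- by move=> h h'; rewrite -[h]Kt -[h']Kt !ev (porbit_map _ _ thI er) (vert_orbit w).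
- by move=> h h'; rewrite -[h]Kt -[h']Kt !eb (porbit_map _ _ thI fc) (bnd_orbit w).
- split=> [h|]; first by rewrite -[h]Kt ev (fills_mem _ (vert_fills w)).
  case: (vert_fills w) => _ [[i on]|[ni E]]; [left|right]; split; rewrite ?inh //.
  by move=> u /on[h <-]; exists (th h).
- split=> [h|]; first by rewrite -[h]Kt eb (fills_mem _ (bnd_fills w)).
  case: (bnd_fills w) => _ [[i on]|[ni E]]; [left|right]; split; rewrite ?inh //.
  by move=> u /on[h <-]; exists (th h).
move=> P Pr Pf h h'; rewrite -[h]Kt -[h']Kt.
by apply: (wf_conn w (P := P \o th)) => t /=; rewrite -?er -?ef.
Qed.

Lemma nm_wfV k m n (f : 'I_m -> name) (g : 'I_n -> name) (G : ribbon k m n) :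
  injective f -> injective g -> wf (rng g) (rng f) (nm f g G) -> rg_wf G.
Proof.
by move=> fI gI /(unname fI gI (erefl : flip (nm f g G) = _))[G' [w /(nm_inj fI gI) <-]].
Qed.

Lemma rel_wf k k' m m' n n' (s : obij k k') r (f : obij m m') (g : obij n n')
    (G : ribbon k m n) (G' : ribbon k' m' n') :
  rg_rel s r f g G G' -> rg_wf G -> rg_wf G'.
Proof.
move=> R w; have [[F0 _] [F1 _]] := (named_nb 0 m', named_nb 0 n').
have F0f : injective (@nb 0 m' \o f) := inj_comp F0 (@obij_inj _ _ f).
have F1g : injective (@nb 0 n' \o g) := inj_comp F1 (@obij_inj _ _ g).
apply: (nm_wfV F0 F1); apply: (wf_map (hmap_bij s r) (rel_giso (nb 0) (nb 0) R)).
by have := nm_wf F0f F1g w; rewrite !rng_obij.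
Qed.

Lemma rel_ex k k' m m' n n' (s : obij k k') r (f : obij m m') (g : obij n n') (G : ribbon k m n) :
  exists G' : ribbon k' m' n', rg_rel s r f g G G'.
Proof.
have [t tK Kt] := hmap_bij s r.
have I : injective (fun h => hmap s r (rg_rot G (t h))).
  by move=> h h' /hmap_inj/perm_inj/(can_inj Kt).
exists (perm I, [ffun h => g (rg_vert G (t h))], [ffun h => f (rg_bnd G (t h))]) => h.
by rewrite /rg_rot /rg_vert /rg_bnd /= permE !ffunE tK.
Qed.

Lemma rel_inj k k' m m' n n' (s : obij k k') r (f : obij m m') (g : obij n n')
    (G1 G2 : ribbon k m n) (G' : ribbon k' m' n') :
  rg_rel s r f g G1 G' -> rg_rel s r f g G2 G' -> G1 = G2.
Proof.
case: G1 G2 => [[r1 v1] b1] [[r2 v2] b2] R1 R2.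
congr ((_, _), _); [apply/permP|apply/ffunP|apply/ffunP] => h;
  case: (R1 h) (R2 h) => e1 e2 e3 [e1' e2' e3'].
- by apply: (@hmap_inj _ _ s r); rewrite -e1 e1'.
- by apply: (@obij_inj _ _ g); rewrite -e2 e2'.
- by apply: (@obij_inj _ _ f); rewrite -e3 e3'.
Qed.

Section RelGlued.
Variables (c c' k1 k1' m1 m1' n1 n1' k2 k2' m2 m2' n2 n2' : nat).
Variables (s2 : obij k2 k2') (r2 : 'I_k2 -> bool) (s1 : obij k1 k1') (r1 : 'I_k1 -> bool).
Variables (h : obij c c') (f1 : obij m1 m1') (g1 : obij n1 n1') (f2 : obij m2 m2') (g2 : obij n2 n2').
Variable rr : 'I_(k2 + k1) -> bool.
Hypotheses (rr2 : forall i, rr (lshift k1 i) = r2 i) (rr1 : forall i, rr (rshift k2 i) = r1 i).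

Lemma hmap_low x : hedge_low k2' (hmap s1 r1 x) = hmap (osum s2 s1) rr (hedge_low k2 x).
Proof.
by rewrite /hmap /hedge_low /= rr1 /osum /obij_fun /= ffunE /osum_fun split_rshift.
Qed.

Lemma hmap_up x : hedge_up k1' (hmap s2 r2 x) = hmap (osum s2 s1) rr (hedge_up k1 x).
Proof.
by rewrite /hmap /hedge_up /= rr2 /osum /obij_fun /= ffunE /osum_fun split_lshift.
Qed.

Lemma hmap_hflip_low x :
  hflip_low k2' k1' (hmap (osum s2 s1) rr x) = hmap (osum s2 s1) rr (hflip_low k2 k1 x).
Proof.
have p := hedge_parts k2 k1; have p' := hedge_parts k2' k1'.
case: (parts_cover p x) => -[t ->].
  rewrite -hmap_low (a_low p') (a_low p) -hmap_low; congr (hedge_low _ _).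
  by rewrite !hflipE /hmap /= addNb.
by rewrite -hmap_up (a_up p') (a_up p) -hmap_up.
Qed.

(** Gluing is equivariant. This gives at once that composition is well defined
    on classes and that it is compatible with relabellings. *)
Lemma rel_glued (G2 : ribbon k2 m2 (c + n2)) (G2' : ribbon k2' m2' (c' + n2'))
    (G1 : ribbon k1 (m1 + c) n1) (G1' : ribbon k1' (m1' + c') n1') G G' :
  rg_wf G2 -> rg_wf G1 -> rg_wf G ->
  rg_rel s2 r2 f2 (osum h g2) G2 G2' -> rg_rel s1 r1 (osum f1 h) g1 G1 G1' ->
  rg_rel (osum s2 s1) rr (osum f1 f2) (osum g1 g2) G G' ->
  rg_glued G2 G1 G = rg_glued G2' G1' G'.
Proof.
move=> w2 w1 w R2 R1 R.
have w2' := rel_wf R2 w2; have w1' := rel_wf R1 w1; have w' := rel_wf R w.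
have P' := glueP (named_nb 0 m1') (named_nb 1 c') (named_nb 2 n1') (named_nb 3 m2')
  (named_nb 4 n2') isT w2' w1' w'.
have P := glueP (named_obij f1 (named_nb 0 m1')) (named_obij h (named_nb 1 c'))
  (named_obij g1 (named_nb 2 n1')) (named_obij f2 (named_nb 3 m2'))
  (named_obij g2 (named_nb 4 n2')) isT w2 w1 w.
rewrite -!nsum_osum !rng_obij in P.
have Q2 := rel_giso (nb 3) (nsum (nb 1) (nb 4)) R2.
have Q1 := rel_giso (nsum (nb 0) (nb 1)) (nb 2) R1.
have Q := rel_giso (nsum (nb 0) (nb 3)) (nsum (nb 2) (nb 4)) R.
have [t2 t2K K2] := hmap_bij s2 r2; have [t1 t1K K1] := hmap_bij s1 r1.
have [t tK Kt] := hmap_bij (osum s2 s1) rr.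
apply/idP/idP => [/P|/P'] gl; [apply/P'|apply/P].
  apply: glue_map (hmap_bij s1 r1) (hmap_bij s2 r2) (hmap_bij _ rr) _ _ _ Q1 Q2 Q gl.
  - exact: hmap_low.
  - exact: hmap_up.
  - exact: hmap_hflip_low.
apply: glue_map _ _ _ _ _ _ (giso_sym t1K K1 Q1) (giso_sym t2K K2 Q2) (giso_sym tK Kt Q) gl.
- by exists (hmap s1 r1).
- by exists (hmap s2 r2).
- by exists (hmap (osum s2 s1) rr).
- by move=> x; apply: (can_inj tK); rewrite Kt -hmap_low K1.
- by move=> x; apply: (can_inj tK); rewrite Kt -hmap_up K2.
- by move=> x; apply: (can_inj tK); rewrite Kt -hmap_hflip_low Kt.
Qed.
End RelGlued.

Lemma glued_uniq c k1 m1 n1 k2 m2 n2 (G2 : ribbon k2 m2 (c + n2)) (G1 : ribbon k1 (m1 + c) n1) G G' :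
  rg_wf G2 -> rg_wf G1 -> rg_wf G -> rg_wf G' ->
  rg_glued G2 G1 G -> rg_glued G2 G1 G' -> rg_rot G = rg_rot G' -> G = G'.
Proof.
move=> w2 w1 w w' gl gl' E.
have nmd : forall t n, named [:: t] (nb t (n := n)) := named_nb.
have [I1 _] := named_nsum (nmd 0 m1) (nmd 1 c) isT; have [I2 _] := named_nsum (nmd 1 c) (nmd 4 n2) isT.
have [I3 _] := named_nsum (nmd 0 m1) (nmd 3 m2) isT; have [I4 _] := named_nsum (nmd 2 n1) (nmd 4 n2) isT.
have P := glueP (nmd 0 m1) (nmd 1 c) (nmd 2 n1) (nmd 3 m2) (nmd 4 n2) isT w2 w1.
have [Ev Eb] := glue_uniq (nm_wf I1 (proj1 (nmd 2 n1)) w1) (nm_wf (proj1 (nmd 3 m2)) I2 w2)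
  (nm_wf I3 I4 w) (nm_wf I3 I4 w') (proj1 (P _ w) gl) (proj1 (P _ w') gl') (erefl _) E.
by apply: (nm_inj I3 I4); rewrite /nm E; congr Graph; apply: funext.
Qed.
End Transport.

(** * Associativity of the gluing of ribbon graphs *)

Lemma glue_transport (U : eqType) (H1 H2 H H' : finType) (low : H1 -> H) (up : H2 -> H)
    (th : H -> H') (a : {perm H}) I1 O1 I2 O2 (x : graph U H1) (y : graph U H2) g g' :
  bijective th -> giso th g g' -> glue low up a I1 O1 I2 O2 x y g ->
  exists a', glue (th \o low) (th \o up) a' I1 O1 I2 O2 x y g'.
Proof.
move=> b iso gl; have [a' Ha'] := conj_perm a b.
exists a'; apply: (glue_map (th1 := id) (th2 := id) _ _ b _ _ Ha' _ _ iso gl) => //.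
- by exists id.
- by exists id.
Qed.

Section NameShuffles.
Variables (a b c d : nat).
Variables (f : 'I_a -> name) (g : 'I_b -> name) (h : 'I_c -> name) (i : 'I_d -> name).

Lemma nsum_omid : nsum (nsum f h) (nsum g i) \o omid a b c d = nsum (nsum f g) (nsum h i).
Proof.
apply: funext => t; rewrite /= /omid /obij_fun /= ffunE /omid_fun.
case: (split_ordP t) => u ->; rewrite ?(split_lshift, split_rshift, nsuml, nsumr);
  by case: (split_ordP u) => x ->; rewrite ?(split_lshift, split_rshift, nsuml, nsumr).
Qed.

Lemma nsum_oswapr : nsum (nsum f h) g \o oswapr a b c = nsum (nsum f g) h.
Proof.
apply: funext => t; rewrite /= /oswapr /obij_fun /= ffunE /oswapr_fun.
case: (split_ordP t) => u ->; rewrite ?(split_lshift, split_rshift, nsuml, nsumr) //.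
by case: (split_ordP u) => x ->; rewrite ?(split_lshift, split_rshift, nsuml, nsumr).
Qed.

Lemma nsum_oswapl : nsum g (nsum f h) \o oswapl a b c = nsum f (nsum g h).
Proof.
apply: funext => t; rewrite /= /oswapl /obij_fun /= ffunE /oswapl_fun.
case: (split_ordP t) => u ->; rewrite ?(split_lshift, split_rshift, nsuml, nsumr) //.
by case: (split_ordP u) => x ->; rewrite ?(split_lshift, split_rshift, nsuml, nsumr).
Qed.

Lemma nsum_oassocV : nsum (nsum f g) h \o oassocV a b c = nsum f (nsum g h).
Proof.
apply: funext => t; rewrite /= /oassocV /ocast /obij_fun /= ffunE.
case: (split_ordP t) => u ->; rewrite ?(nsuml, nsumr).
  by rewrite (_ : cast_ord _ _ = lshift c (lshift b u)) ?nsuml //; apply: val_inj.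
case: (split_ordP u) => x ->; rewrite ?(nsuml, nsumr).
  by rewrite (_ : cast_ord _ _ = lshift c (rshift a x)) ?nsuml ?nsumr //; apply: val_inj.
rewrite (_ : cast_ord _ _ = rshift (a + b) x) ?nsumr //.
by apply: val_inj; rewrite /= addnA.
Qed.

Lemma nsum_oassoc : nsum f (nsum g h) \o oassoc a b c = nsum (nsum f g) h.
Proof.
rewrite -nsum_oassocV; apply: funext => t /=; congr (nsum _ _ _).
by rewrite /oassocV /oassoc /ocast /obij_fun /= !ffunE; apply: val_inj.
Qed.
End NameShuffles.

Lemma comp_oid n (f : 'I_n -> name) : f \o oid n = f.
Proof. by apply: funext => t; rewrite /= oidE. Qed.

Lemma giso_symE (U : eqType) (H H' : finType) (th : H -> H') (g : graph U H) g' : bijective th ->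
  giso th g g' -> exists ti, [/\ cancel th ti, cancel ti th & giso ti g' g].
Proof. by case=> ti tK Kt iso; exists ti; split=> //; apply: giso_sym Kt iso. Qed.

Lemma hmap0 k k' (s : obij k k') h : hmap s (fun=> false) h = (s h.1, h.2).
Proof. by rewrite /hmap addbF. Qed.

Lemma meet_rng c a b (ka : 'I_c -> name) (f : 'I_a -> name) (g : 'I_b -> name) :
  0 < c -> exists u, rng (nsum f ka) u && rng (nsum ka g) u.
Proof.
by case: c ka => // c ka _; exists (ka ord0); rewrite !rng_nsum !rng_f orbT.
Qed.

Section ChainGlued.
Variables (j k l m1 n1 m2 n2 m3 n3 k1 k2 k3 : nat).
Variables (X : ribbon k1 (m1 + j + k) n1) (Y : ribbon k2 (m2 + l) (k + n2))
  (Z : ribbon k3 m3 (j + (l + n3))).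
Hypotheses (wX : rg_wf X) (wY : rg_wf Y) (wZ : rg_wf Z) (hk : 0 < k) (hl : 0 < l).
Variables (G : ribbon (k3 + (k2 + k1)) ((m1 + m2) + m3) ((n1 + n2) + n3)).
Variables (GR : ribbon ((k3 + k2) + k1) (m1 + (m2 + m3)) (n1 + (n2 + n3))).
Let s := ocast (addnA k3 k2 k1).
Hypothesis rel : rg_rel s (fun=> false) (oassoc m1 m2 m3) (oassoc n1 n2 n3) G GR.
Hypothesis wG : rg_wf G.
Let wGR : rg_wf GR := rel_wf rel wG.

Notation M1 := (@nb 0 m1). Notation J := (@nb 1 j). Notation Kk := (@nb 2 k).
Notation N1 := (@nb 3 n1). Notation M2 := (@nb 4 m2). Notation L := (@nb 5 l).
Notation N2 := (@nb 6 n2). Notation M3 := (@nb 7 m3). Notation N3 := (@nb 8 n3).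
Let nn t n : named [:: t] (@nb t n) := named_nb t n.

Let I1 := rng N1. Let O1 := rng (nsum (nsum M1 J) Kk).
Let I2 := rng (nsum Kk N2). Let O2 := rng (nsum M2 L).
Let I3 := rng (nsum J (nsum L N3)). Let O3 := rng M3.
Let x := nm (nsum (nsum M1 J) Kk) N1 X.
Let y := nm (nsum M2 L) (nsum Kk N2) Y.
Let z := nm M3 (nsum J (nsum L N3)) Z.
Let nG' (G' : ribbon (k2 + k1) (m1 + j + (m2 + l)) (n1 + n2)) :=
  nm (nsum (nsum M1 J) (nsum M2 L)) (nsum N1 N2) G'.
Let nG'' (G'' : ribbon (k3 + k2) (m2 + m3) (k + n2 + (j + n3))) :=
  nm (nsum M2 M3) (nsum (nsum Kk N2) (nsum J N3)) G''.
Let g := nm (nsum (nsum M1 M2) M3) (nsum (nsum N1 N2) N3) G.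
Let gR := nm (nsum M1 (nsum M2 M3)) (nsum N1 (nsum N2 N3)) GR.

Let inj_b1 : injective (nsum (nsum M1 J) Kk).
Proof. exact: proj1 (named_nsum (named_nsum (nn 0 m1) (nn 1 j) isT) (nn 2 k) isT). Qed.
Let inj_v2 : injective (nsum Kk N2).
Proof. exact: proj1 (named_nsum (nn 2 k) (nn 6 n2) isT). Qed.
Let inj_b2 : injective (nsum M2 L).
Proof. exact: proj1 (named_nsum (nn 4 m2) (nn 5 l) isT). Qed.
Let inj_v3 : injective (nsum J (nsum L N3)).
Proof. exact: proj1 (named_nsum (nn 1 j) (named_nsum (nn 5 l) (nn 8 n3) isT) isT). Qed.

Let setI12 : compI I1 O1 I2 = rng (nsum N1 N2).
Proof. exact: (proj1 (comp_rng (named_nsum (nn 0 m1) (nn 1 j) isT) (nn 2 k) (nn 3 n1)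
  (named_nsum (nn 4 m2) (nn 5 l) isT) (nn 6 n2) isT)). Qed.
Let setO12 : compO O1 I2 O2 = rng (nsum (nsum M1 J) (nsum M2 L)).
Proof. exact: (proj2 (comp_rng (named_nsum (nn 0 m1) (nn 1 j) isT) (nn 2 k) (nn 3 n1)
  (named_nsum (nn 4 m2) (nn 5 l) isT) (nn 6 n2) isT)). Qed.
Let setI3 : I3 = rng (nsum (nsum J L) N3).
Proof. by rewrite /I3 -nsum_oassocV rng_obij. Qed.
Let setI3' : I3 = rng (nsum L (nsum J N3)).
Proof. by rewrite /I3 -nsum_oswapl rng_obij. Qed.
Let setO12' : compO O1 I2 O2 = rng (nsum (nsum M1 M2) (nsum J L)).
Proof. by rewrite setO12 -nsum_omid rng_obij. Qed.
Let fr2 := (named_nsum (nn 0 m1) (nn 4 m2) isT, named_nsum (nn 1 j) (nn 5 l) isT,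
  named_nsum (nn 3 n1) (nn 6 n2) isT).
Let setI123 : compI (compI I1 O1 I2) (compO O1 I2 O2) I3 = rng (nsum (nsum N1 N2) N3).
Proof.
rewrite setI12 setO12' setI3.
exact: (proj1 (comp_rng fr2.1.1 fr2.1.2 fr2.2 (nn 7 m3) (nn 8 n3) isT)).
Qed.
Let setO123 : compO (compO O1 I2 O2) I3 O3 = rng (nsum (nsum M1 M2) M3).
Proof.
rewrite setO12' setI3.
exact: (proj2 (comp_rng fr2.1.1 fr2.1.2 fr2.2 (nn 7 m3) (nn 8 n3) isT)).
Qed.
Let fr3 := named_nsum (nn 2 k) (nn 6 n2) isT.
Let fr3' := named_nsum (nn 1 j) (nn 8 n3) isT.
Let setI23 : compI I2 O2 I3 = rng (nsum (nsum Kk N2) (nsum J N3)).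
Proof. rewrite setI3'; exact: (proj1 (comp_rng (nn 4 m2) (nn 5 l) fr3 (nn 7 m3) fr3' isT)). Qed.
Let setO23 : compO O2 I3 O3 = rng (nsum M2 M3).
Proof. rewrite setI3'; exact: (proj2 (comp_rng (nn 4 m2) (nn 5 l) fr3 (nn 7 m3) fr3' isT)). Qed.
Let setI23' : compI I2 O2 I3 = rng (nsum (nsum Kk J) (nsum N2 N3)).
Proof. by rewrite setI23 -nsum_omid rng_obij. Qed.
Let setO1' : O1 = rng (nsum M1 (nsum Kk J)).
Proof. by rewrite /O1 -nsum_oswapr rng_obij -nsum_oassoc rng_obij. Qed.
Let fr4 := (named_nsum (nn 2 k) (nn 1 j) isT, named_nsum (nn 4 m2) (nn 7 m3) isT,
  named_nsum (nn 6 n2) (nn 8 n3) isT).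
Let setI : compI I1 O1 (compI I2 O2 I3) = rng (nsum N1 (nsum N2 N3)).
Proof. rewrite setI23' setO1'; exact: (proj1 (comp_rng (nn 0 m1) fr4.1.1 (nn 3 n1) fr4.1.2 fr4.2 isT)). Qed.
Let setO : compO O1 (compI I2 O2 I3) (compO O2 I3 O3) = rng (nsum M1 (nsum M2 M3)).
Proof. rewrite setI23' setO1' setO23; exact: (proj2 (comp_rng (nn 0 m1) fr4.1.1 (nn 3 n1) fr4.1.2 fr4.2 isT)). Qed.

Let P1 G' : rg_wf G' -> rg_glued Y X G' <->
  glue (@hedge_low k2 k1) (@hedge_up k2 k1) (hflip_low k2 k1) I1 O1 I2 O2 x y (nG' G').
Proof. exact (glueP (named_nsum (nn 0 m1) (nn 1 j) isT) (nn 2 k) (nn 3 n1)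
  (named_nsum (nn 4 m2) (nn 5 l) isT) (nn 6 n2) isT wY wX (G := G')). Qed.

Let P2 G' : rg_wf G' ->
  rg_glued (rg_relab (oid m3) (oassocV j l n3) Z) (rg_relab (omid m1 j m2 l) (oid _) G') G <->
  glue (@hedge_low k3 (k2 + k1)) (@hedge_up k3 (k2 + k1)) (hflip_low k3 (k2 + k1))
    (compI I1 O1 I2) (compO O1 I2 O2) I3 O3 (nG' G') z g.
Proof.
move=> wG'; have := glueP fr2.1.1 fr2.1.2 fr2.2 (nn 7 m3) (nn 8 n3) isT
  (rg_relab_wf (oid m3) (oassocV j l n3) wZ) (rg_relab_wf (omid m1 j m2 l) (oid _) wG') wG.
by rewrite !nm_relab !comp_oid nsum_omid nsum_oassocV -setO12' -setI3 -setI12.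
Qed.

Let P3 G'' : rg_wf G'' -> rg_glued (rg_relab (oid m3) (oswapl j l n3) Z) Y G'' <->
  glue (@hedge_low k3 k2) (@hedge_up k3 k2) (hflip_low k3 k2) I2 O2 I3 O3 y z (nG'' G'').
Proof.
move=> wG''; have := glueP (nn 4 m2) (nn 5 l) fr3 (nn 7 m3) fr3' isT
  (rg_relab_wf (oid m3) (oswapl j l n3) wZ) wY wG''.
by rewrite !nm_relab !comp_oid nsum_oswapl -setI3'.
Qed.

Let P4 G'' : rg_wf G'' ->
  rg_glued (rg_relab (oid _) (omid k n2 j n3) G'')
    (rg_relab (ocomp (oassoc m1 k j) (oswapr m1 j k)) (oid n1) X) GR <->
  glue (@hedge_low (k3 + k2) k1) (@hedge_up (k3 + k2) k1) (hflip_low (k3 + k2) k1)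
    I1 O1 (compI I2 O2 I3) (compO O2 I3 O3) x (nG'' G'') gR.
Proof.
move=> wG''; have := glueP (nn 0 m1) fr4.1.1 (nn 3 n1) fr4.1.2 fr4.2 isT
  (rg_relab_wf (oid _) (omid k n2 j n3) wG'')
  (rg_relab_wf (ocomp (oassoc m1 k j) (oswapr m1 j k)) (oid n1) wX) wGR.
have E : nsum M1 (nsum Kk J) \o ocomp (oassoc m1 k j) (oswapr m1 j k) = nsum (nsum M1 J) Kk.
  by rewrite -nsum_oswapr -nsum_oassoc; apply: funext => t; rewrite /= ocompE.
by rewrite !nm_relab !comp_oid nsum_omid E -setI23' -setO1' -setO23.
Qed.

Let th := hmap s (fun=> false).
Let thE h : th h = (cast_ord (addnA k3 k2 k1) h.1, h.2).
Proof. by rewrite /th hmap0 /s /ocast {1}/obij_fun /= ffunE. Qed.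
Let e1 : th \o @hedge_low k3 (k2 + k1) \o @hedge_low k2 k1 = @hedge_low (k3 + k2) k1.
Proof.
by apply: funext => h; rewrite /= thE /hedge_low /=; congr pair; apply: val_inj; rewrite /= addnA.
Qed.
Let e2 : th \o @hedge_low k3 (k2 + k1) \o @hedge_up k2 k1 = @hedge_up (k3 + k2) k1 \o @hedge_low k3 k2.
Proof.
by apply: funext => h; rewrite /= thE /hedge_low /hedge_up /=; congr pair; apply: val_inj.
Qed.
Let e3 : th \o @hedge_up k3 (k2 + k1) = @hedge_up (k3 + k2) k1 \o @hedge_up k3 k2.
Proof.
by apply: funext => h; rewrite /= thE /hedge_up /=; congr pair; apply: val_inj.
Qed.
Let iso : giso th g gR.
Proof.
have := rel_giso (nsum M1 (nsum M2 M3)) (nsum N1 (nsum N2 N3)) rel.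
by rewrite !nsum_oassoc.
Qed.

Let wx : wf I1 O1 x := nm_wf inj_b1 (proj1 (nn 3 n1)) wX.
Let wy : wf I2 O2 y := nm_wf inj_b2 inj_v2 wY.
Let wz : wf I3 O3 z := nm_wf (proj1 (nn 7 m3)) inj_v3 wZ.
Let inj_b' : injective (nsum (nsum M1 J) (nsum M2 L)).
Proof. exact: proj1 (named_nsum (named_nsum (nn 0 m1) (nn 1 j) isT) (named_nsum (nn 4 m2) (nn 5 l) isT) isT). Qed.
Let inj_v' : injective (nsum N1 N2) := proj1 fr2.2.
Let inj_b'' : injective (nsum M2 M3) := proj1 fr4.1.2.
Let inj_v'' : injective (nsum (nsum Kk N2) (nsum J N3)) := proj1 (named_nsum fr3 fr3' isT).
Let wg' G' : rg_wf G' -> wf (compI I1 O1 I2) (compO O1 I2 O2) (nG' G').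
Proof. by rewrite setI12 setO12 => w; apply: nm_wf inj_b' inj_v' w. Qed.
Let wg'' G'' : rg_wf G'' -> wf (compI I2 O2 I3) (compO O2 I3 O3) (nG'' G'').
Proof. by rewrite setI23 setO23 => w; apply: nm_wf inj_b'' inj_v'' w. Qed.
Let wgR : wf (compI (compI I1 O1 I2) (compO O1 I2 O2) I3) (compO (compO O1 I2 O2) I3 O3) gR.
Proof.
apply: wf_map (hmap_bij s _) iso _; rewrite setI123 setO123; apply: nm_wf wG.
  exact: proj1 (named_nsum fr2.1.1 (nn 7 m3) isT).
exact: proj1 (named_nsum fr2.2 (nn 8 n3) isT).
Qed.
Let wg : wf (compI I1 O1 (compI I2 O2 I3)) (compO O1 (compI I2 O2 I3) (compO O2 I3 O3)) g.
Proof.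
have [ti [tK Kt iso']] := giso_symE (hmap_bij s _) iso.
have bi : bijective ti by exists th.
apply: wf_map bi iso' _; rewrite setI setO; apply: nm_wf wGR.
  exact: proj1 (named_nsum (nn 0 m1) fr4.1.2 isT).
exact: proj1 (named_nsum (nn 3 n1) fr4.2 isT).
Qed.

Let K12 : exists u, O1 u && I2 u. Proof. exact: meet_rng. Qed.
Let K23 : exists u, O2 u && I3 u. Proof. rewrite setI3'; exact: meet_rng. Qed.
Let dI23 u : ~~ (I2 u && I3 u).
Proof. exact: named_rng fr3 (named_nsum (nn 1 j) (named_nsum (nn 5 l) (nn 8 n3) isT) isT) isT u. Qed.
Let dO12 u : ~~ (O1 u && O2 u).
Proof.
exact: named_rng (named_nsum (named_nsum (nn 0 m1) (nn 1 j) isT) (nn 2 k) isT)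
  (named_nsum (nn 4 m2) (nn 5 l) isT) isT u.
Qed.

(** Both sides describe the same total graphs: the tags 0, ..., 8 name the
    nine blocks of labels of x, y and z. *)
Lemma chain_glued :
  (exists G', [/\ rg_wf G', rg_glued Y X G' &
     rg_glued (rg_relab (oid m3) (oassocV j l n3) Z) (rg_relab (omid m1 j m2 l) (oid (n1 + n2)) G') G]) <->
  (exists G'', [/\ rg_wf G'', rg_glued (rg_relab (oid m3) (oswapl j l n3) Z) Y G'' &
     rg_glued (rg_relab (oid (m2 + m3)) (omid k n2 j n3) G'')
       (rg_relab (ocomp (oassoc m1 k j) (oswapr m1 j k)) (oid n1) X) GR]).
Proof.
split=> [[G' [w gl1 gl2]]|[G'' [w gl1 gl2]]].
  have [a12 gl2'] := glue_transport (hmap_bij s _) iso (proj1 (P2 w) gl2).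
  have [g'' [ef wgg c1 c2]] := glue_chain e1 e2 e3 K12 K23 dI23 wx wy wz (wg' w) wgR
    (hedge_parts k3 k2) (hedge_parts (k3 + k2) k1) (proj1 (P1 w) gl1) gl2'.
  have wgg' := wgg; rewrite setI23 setO23 in wgg'.
  have [G'' [w'' Eg]] := unname inj_b'' inj_v'' ef wgg'.
  by exists G''; split=> //; [apply/(P3 w'') | apply/(P4 w'')]; rewrite /nG'' Eg.
have [ti [tK Kt iso']] := giso_symE (hmap_bij s _) iso.
have bi : bijective ti by exists th.
have [a1 gl2'] := glue_transport bi iso' (proj1 (P4 w) gl2).
have tiE A (F F' : A -> _) : th \o F = F' -> F = ti \o F'.
  by move=> <-; apply: funext => h /=; rewrite tK.
have f1 := tiE _ (@hedge_low k3 (k2 + k1) \o @hedge_low k2 k1) _ e1.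
have f2 : @hedge_low k3 (k2 + k1) \o @hedge_up k2 k1 = (ti \o @hedge_up (k3 + k2) k1) \o @hedge_low k3 k2.
  exact: tiE _ (@hedge_low k3 (k2 + k1) \o @hedge_up k2 k1) _ e2.
have f3 : @hedge_up k3 (k2 + k1) = (ti \o @hedge_up (k3 + k2) k1) \o @hedge_up k3 k2 := tiE _ _ _ e3.
have [g' [ef wgg c1 c2]] := glue_chain_rev f1 f2 f3 K12 K23 dO12
  wx wy wz (wg'' w) wg (hedge_parts k2 k1) (hedge_parts k3 (k2 + k1)) (proj1 (P3 w) gl1) gl2'.
have wgg' := wgg; rewrite setI12 setO12 in wgg'.
have [G' [w' Eg]] := unname inj_b' inj_v' ef wgg'.
by exists G'; split=> //; [apply/(P1 w') | apply/(P2 w')]; rewrite /nG' Eg.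
Qed.
End ChainGlued.

Lemma rel_sym k k' m m' n n' (s : obij k k') (s' : obij k' k) (f : obij m m') (f' : obij m' m)
    (g : obij n n') (g' : obij n' n) (G : ribbon k m n) (G' : ribbon k' m' n') :
  cancel s s' -> cancel s' s -> cancel f f' -> cancel g g' ->
  rg_rel s (fun=> false) f g G G' -> rg_rel s' (fun=> false) f' g' G' G.
Proof.
move=> sK s'K fK gK R h.
have E t : hmap s' (fun=> false) (hmap s (fun=> false) t) = t.
  by case: t => e b; rewrite !hmap0 /= sK.
have -> : h = hmap s (fun=> false) (hmap s' (fun=> false) h).
  by case: h => e b; rewrite !hmap0 /= s'K.
case: (R (hmap s' (fun=> false) h)) => -> -> ->.
by rewrite !E fK gK.
Qed.

Lemma oswaplK a b c : cancel (oswapl a b c) (oswapl b a c).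
Proof. by move=> i; rewrite /oswapl /obij_fun /= !ffunE oswapl_funK. Qed.
Lemma oswaprK a b c : cancel (oswapr a b c) (oswapr a c b).
Proof. by move=> i; rewrite /oswapr /obij_fun /= !ffunE oswapr_funK. Qed.

Section AboveGlued.
Variables (k l m1 n1 m2 n2 m3 n3 k1 k2 k3 : nat).
Variables (X : ribbon k1 (m1 + l + k) n1) (Y : ribbon k2 m2 (k + n2)) (Z : ribbon k3 m3 (l + n3)).
Hypotheses (wX : rg_wf X) (wY : rg_wf Y) (wZ : rg_wf Z) (hk : 0 < k) (hl : 0 < l).
Variables (G : ribbon (k3 + (k2 + k1)) ((m1 + m2) + m3) ((n1 + n2) + n3)).
Variables (GR : ribbon (k2 + (k3 + k1)) ((m1 + m3) + m2) ((n1 + n3) + n2)).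
Let s := oswapl k3 k2 k1.
Hypothesis rel : rg_rel s (fun=> false) (oswapr m1 m2 m3) (oswapr n1 n2 n3) G GR.
Hypothesis wG : rg_wf G.
Let wGR : rg_wf GR := rel_wf rel wG.

Notation M1 := (@nb 0 m1). Notation L := (@nb 1 l). Notation Kk := (@nb 2 k).
Notation N1 := (@nb 3 n1). Notation M2 := (@nb 4 m2). Notation N2 := (@nb 5 n2).
Notation M3 := (@nb 6 m3). Notation N3 := (@nb 7 n3).
Let nn t n : named [:: t] (@nb t n) := named_nb t n.

Let I1 := rng N1. Let O1 := rng (nsum (nsum M1 L) Kk).
Let I2 := rng (nsum Kk N2). Let O2 := rng M2.
Let I3 := rng (nsum L N3). Let O3 := rng M3.
Let x := nm (nsum (nsum M1 L) Kk) N1 X.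
Let y := nm M2 (nsum Kk N2) Y.
Let z := nm M3 (nsum L N3) Z.
Let nG' (G' : ribbon (k2 + k1) (m1 + l + m2) (n1 + n2)) :=
  nm (nsum (nsum M1 L) M2) (nsum N1 N2) G'.
Let nG'' (G'' : ribbon (k3 + k1) (m1 + k + m3) (n1 + n3)) :=
  nm (nsum (nsum M1 Kk) M3) (nsum N1 N3) G''.
Let g := nm (nsum (nsum M1 M2) M3) (nsum (nsum N1 N2) N3) G.
Let gR := nm (nsum (nsum M1 M3) M2) (nsum (nsum N1 N3) N2) GR.

Let m1l := named_nsum (nn 0 m1) (nn 1 l) isT.
Let m1k := named_nsum (nn 0 m1) (nn 2 k) isT.
Let m12 := named_nsum (nn 0 m1) (nn 4 m2) isT.
Let m13 := named_nsum (nn 0 m1) (nn 6 m3) isT.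
Let n12 := named_nsum (nn 3 n1) (nn 5 n2) isT.
Let n13 := named_nsum (nn 3 n1) (nn 7 n3) isT.
Let kn2 := named_nsum (nn 2 k) (nn 5 n2) isT.
Let ln3 := named_nsum (nn 1 l) (nn 7 n3) isT.

Let c1 : compI I1 O1 I2 = rng (nsum N1 N2) /\ compO O1 I2 O2 = rng (nsum (nsum M1 L) M2).
Proof. exact: (comp_rng m1l (nn 2 k) (nn 3 n1) (nn 4 m2) (nn 5 n2) isT). Qed.
Let c1' : compO O1 I2 O2 = rng (nsum (nsum M1 M2) L).
Proof. by rewrite (proj2 c1) -nsum_oswapr rng_obij. Qed.
Let c2 : compI (compI I1 O1 I2) (compO O1 I2 O2) I3 = rng (nsum (nsum N1 N2) N3) /\
  compO (compO O1 I2 O2) I3 O3 = rng (nsum (nsum M1 M2) M3).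
Proof. rewrite (proj1 c1) c1'; exact: (comp_rng m12 (nn 1 l) n12 (nn 6 m3) (nn 7 n3) isT). Qed.
Let o1 : O1 = rng (nsum (nsum M1 Kk) L).
Proof. by rewrite /O1 -nsum_oswapr rng_obij. Qed.
Let c3 : compI I1 O1 I3 = rng (nsum N1 N3) /\ compO O1 I3 O3 = rng (nsum (nsum M1 Kk) M3).
Proof. rewrite o1; exact: (comp_rng m1k (nn 1 l) (nn 3 n1) (nn 6 m3) (nn 7 n3) isT). Qed.
Let c3' : compO O1 I3 O3 = rng (nsum (nsum M1 M3) Kk).
Proof. by rewrite (proj2 c3) -nsum_oswapr rng_obij. Qed.

Let P1 G' : rg_wf G' -> rg_glued Y X G' <->
  glue (@hedge_low k2 k1) (@hedge_up k2 k1) (hflip_low k2 k1) I1 O1 I2 O2 x y (nG' G').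
Proof. exact (glueP m1l (nn 2 k) (nn 3 n1) (nn 4 m2) (nn 5 n2) isT wY wX (G := G')). Qed.

Let P2 G' : rg_wf G' -> rg_glued Z (rg_relab (oswapr m1 l m2) (oid _) G') G <->
  glue (@hedge_low k3 (k2 + k1)) (@hedge_up k3 (k2 + k1)) (hflip_low k3 (k2 + k1))
    (compI I1 O1 I2) (compO O1 I2 O2) I3 O3 (nG' G') z g.
Proof.
move=> wG'; have := glueP m12 (nn 1 l) n12 (nn 6 m3) (nn 7 n3) isT
  wZ (rg_relab_wf (oswapr m1 l m2) (oid _) wG') wG.
by rewrite !nm_relab !comp_oid nsum_oswapr -c1' -(proj1 c1).
Qed.

Let P3 G'' : rg_wf G'' -> rg_glued Z (rg_relab (oswapr m1 l k) (oid n1) X) G'' <->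
  glue (@hedge_low k3 k1) (@hedge_up k3 k1) (hflip_low k3 k1) I1 O1 I3 O3 x z (nG'' G'').
Proof.
move=> wG''; have := glueP m1k (nn 1 l) (nn 3 n1) (nn 6 m3) (nn 7 n3) isT
  wZ (rg_relab_wf (oswapr m1 l k) (oid n1) wX) wG''.
by rewrite !nm_relab !comp_oid nsum_oswapr -o1.
Qed.

Let P4 G'' : rg_wf G'' -> rg_glued Y (rg_relab (oswapr m1 k m3) (oid _) G'') GR <->
  glue (@hedge_low k2 (k3 + k1)) (@hedge_up k2 (k3 + k1)) (hflip_low k2 (k3 + k1))
    (compI I1 O1 I3) (compO O1 I3 O3) I2 O2 (nG'' G'') y gR.
Proof.
move=> wG''; have := glueP m13 (nn 2 k) n13 (nn 4 m2) (nn 5 n2) isT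
  wY (rg_relab_wf (oswapr m1 k m3) (oid _) wG'') wGR.
by rewrite !nm_relab !comp_oid nsum_oswapr -c3' -(proj1 c3).
Qed.

Let th := hmap s (fun=> false).
Let thE h : th h = (oswapl_fun h.1, h.2).
Proof. by rewrite /th hmap0 /s /oswapl {1}/obij_fun /= ffunE. Qed.
Let e1 : @hedge_low k2 (k3 + k1) \o @hedge_low k3 k1 = (th \o @hedge_low k3 (k2 + k1)) \o @hedge_low k2 k1.
Proof.
by apply: funext => h; rewrite /= thE /hedge_low /oswapl_fun /= ?(split_lshift, split_rshift).
Qed.
Let e3 : @hedge_low k2 (k3 + k1) \o @hedge_up k3 k1 = th \o @hedge_up k3 (k2 + k1).
Proof.
by apply: funext => h; rewrite /= thE /hedge_up /oswapl_fun /= ?(split_lshift, split_rshift).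
Qed.
Let e2 : @hedge_up k2 (k3 + k1) = (th \o @hedge_low k3 (k2 + k1)) \o @hedge_up k2 k1.
Proof.
by apply: funext => h; rewrite /= thE /hedge_up /hedge_low /oswapl_fun /= ?(split_lshift, split_rshift).
Qed.
Let iso : giso th g gR.
Proof.
have := rel_giso (nsum (nsum M1 M3) M2) (nsum (nsum N1 N3) N2) rel.
by rewrite !nsum_oswapr.
Qed.

Let wx : wf I1 O1 x := nm_wf (proj1 (named_nsum m1l (nn 2 k) isT)) (proj1 (nn 3 n1)) wX.
Let wy : wf I2 O2 y := nm_wf (proj1 (nn 4 m2)) (proj1 kn2) wY.
Let wz : wf I3 O3 z := nm_wf (proj1 (nn 6 m3)) (proj1 ln3) wZ.
Let inj_b'' : injective (nsum (nsum M1 Kk) M3) := proj1 (named_nsum m1k (nn 6 m3) isT).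
Let inj_v'' : injective (nsum N1 N3) := proj1 n13.
Let wg' G' : rg_wf G' -> wf (compI I1 O1 I2) (compO O1 I2 O2) (nG' G').
Proof.
rewrite (proj1 c1) (proj2 c1) => w.
exact: nm_wf (proj1 (named_nsum m1l (nn 4 m2) isT)) (proj1 n12) w.
Qed.
Let wgR : wf (compI (compI I1 O1 I2) (compO O1 I2 O2) I3) (compO (compO O1 I2 O2) I3 O3) gR.
Proof.
apply: wf_map (hmap_bij s _) iso _; rewrite (proj1 c2) (proj2 c2); apply: nm_wf wG.
  exact: proj1 (named_nsum m12 (nn 6 m3) isT).
exact: proj1 (named_nsum n12 (nn 7 n3) isT).
Qed.
Let K12 : exists u, O1 u && I2 u. Proof. exact: meet_rng. Qed.
Let K13 : exists u, O1 u && I3 u. Proof. rewrite o1; exact: meet_rng. Qed.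

(** One implication is enough, since exchanging the roles of y and z gives the
    other one. *)
Lemma above_glued :
  (exists G', [/\ rg_wf G', rg_glued Y X G' &
     rg_glued Z (rg_relab (oswapr m1 l m2) (oid (n1 + n2)) G') G]) ->
  (exists G'', [/\ rg_wf G'', rg_glued Z (rg_relab (oswapr m1 l k) (oid n1) X) G'' &
     rg_glued Y (rg_relab (oswapr m1 k m3) (oid (n1 + n3)) G'') GR]).
Proof.
move=> [G' [w gl1 gl2]].
have [a12 gl2'] := glue_transport (hmap_bij s _) iso (proj1 (P2 w) gl2).
have [g'' [ef wgg d1 d2]] := glue_above e1 e3 e2 K12 K13 (named_rng kn2 ln3 isT)
  (named_rng (nn 4 m2) ln3 isT) (named_rng kn2 (nn 6 m3) isT) (named_rng (nn 4 m2) (nn 6 m3) isT)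
  wx wy wz (wg' w) wgR (hedge_parts k3 k1) (hedge_parts k2 (k3 + k1)) (proj1 (P1 w) gl1) gl2'.
have wgg' := wgg; rewrite (proj1 c3) (proj2 c3) in wgg'.
have [G'' [w'' Eg]] := unname inj_b'' inj_v'' ef wgg'.
by exists G''; split=> //; [apply/(P3 w'') | apply/(P4 w'')]; rewrite /nG'' Eg.
Qed.
End AboveGlued.

Section BelowGlued.
Variables (k l m1 n1 m2 n2 m3 n3 k1 k2 k3 : nat).
Variables (X : ribbon k1 (m1 + k) n1) (Y : ribbon k2 (m2 + l) n2) (Z : ribbon k3 m3 (k + (l + n3))).
Hypotheses (wX : rg_wf X) (wY : rg_wf Y) (wZ : rg_wf Z) (hk : 0 < k) (hl : 0 < l).
Variables (G : ribbon ((k3 + k1) + k2) (m2 + (m1 + m3)) (n2 + (n1 + n3))).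
Variables (GR : ribbon ((k3 + k2) + k1) (m1 + (m2 + m3)) (n1 + (n2 + n3))).
Let s := oswapr k3 k1 k2.
Hypothesis rel : rg_rel s (fun=> false) (oswapl m2 m1 m3) (oswapl n2 n1 n3) G GR.
Hypothesis wG : rg_wf G.
Let wGR : rg_wf GR := rel_wf rel wG.

Notation M1 := (@nb 0 m1). Notation Kk := (@nb 1 k). Notation N1 := (@nb 2 n1).
Notation M2 := (@nb 3 m2). Notation L := (@nb 4 l). Notation N2 := (@nb 5 n2).
Notation M3 := (@nb 6 m3). Notation N3 := (@nb 7 n3).
Let nn t n : named [:: t] (@nb t n) := named_nb t n.

Let I1 := rng N1. Let O1 := rng (nsum M1 Kk).
Let I2 := rng N2. Let O2 := rng (nsum M2 L).
Let I3 := rng (nsum Kk (nsum L N3)). Let O3 := rng M3.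
Let x := nm (nsum M1 Kk) N1 X.
Let y := nm (nsum M2 L) N2 Y.
Let z := nm M3 (nsum Kk (nsum L N3)) Z.
Let nG' (G' : ribbon (k3 + k1) (m1 + m3) (n1 + (l + n3))) :=
  nm (nsum M1 M3) (nsum N1 (nsum L N3)) G'.
Let nG'' (G'' : ribbon (k3 + k2) (m2 + m3) (n2 + (k + n3))) :=
  nm (nsum M2 M3) (nsum N2 (nsum Kk N3)) G''.
Let g := nm (nsum M2 (nsum M1 M3)) (nsum N2 (nsum N1 N3)) G.
Let gR := nm (nsum M1 (nsum M2 M3)) (nsum N1 (nsum N2 N3)) GR.

Let m1k := named_nsum (nn 0 m1) (nn 1 k) isT.
Let m2l := named_nsum (nn 3 m2) (nn 4 l) isT.
Let m13 := named_nsum (nn 0 m1) (nn 6 m3) isT.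
Let m23 := named_nsum (nn 3 m2) (nn 6 m3) isT.
Let ln3 := named_nsum (nn 4 l) (nn 7 n3) isT.
Let kn3 := named_nsum (nn 1 k) (nn 7 n3) isT.
Let n13 := named_nsum (nn 2 n1) (nn 7 n3) isT.
Let n23 := named_nsum (nn 5 n2) (nn 7 n3) isT.

Let c1 : compI I1 O1 I3 = rng (nsum N1 (nsum L N3)) /\ compO O1 I3 O3 = rng (nsum M1 M3).
Proof. exact: (comp_rng (nn 0 m1) (nn 1 k) (nn 2 n1) (nn 6 m3) ln3 isT). Qed.
Let c1' : compI I1 O1 I3 = rng (nsum L (nsum N1 N3)).
Proof. by rewrite (proj1 c1) -nsum_oswapl rng_obij. Qed.
Let c2 : compI I2 O2 (compI I1 O1 I3) = rng (nsum N2 (nsum N1 N3)) /\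
  compO O2 (compI I1 O1 I3) (compO O1 I3 O3) = rng (nsum M2 (nsum M1 M3)).
Proof. rewrite c1' (proj2 c1); exact: (comp_rng (nn 3 m2) (nn 4 l) (nn 5 n2) m13 n13 isT). Qed.
Let i3 : I3 = rng (nsum L (nsum Kk N3)).
Proof. by rewrite /I3 -nsum_oswapl rng_obij. Qed.
Let c3 : compI I2 O2 I3 = rng (nsum N2 (nsum Kk N3)) /\ compO O2 I3 O3 = rng (nsum M2 M3).
Proof. rewrite i3; exact: (comp_rng (nn 3 m2) (nn 4 l) (nn 5 n2) (nn 6 m3) kn3 isT). Qed.
Let c3' : compI I2 O2 I3 = rng (nsum Kk (nsum N2 N3)).
Proof. by rewrite (proj1 c3) -nsum_oswapl rng_obij. Qed.

Let P1 G' : rg_wf G' -> rg_glued Z X G' <->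
  glue (@hedge_low k3 k1) (@hedge_up k3 k1) (hflip_low k3 k1) I1 O1 I3 O3 x z (nG' G').
Proof. exact (glueP (nn 0 m1) (nn 1 k) (nn 2 n1) (nn 6 m3) ln3 isT wZ wX (G := G')). Qed.

Let P2 G' : rg_wf G' -> rg_glued (rg_relab (oid _) (oswapl n1 l n3) G') Y G <->
  glue (@hedge_low (k3 + k1) k2) (@hedge_up (k3 + k1) k2) (hflip_low (k3 + k1) k2)
    I2 O2 (compI I1 O1 I3) (compO O1 I3 O3) y (nG' G') g.
Proof.
move=> wG'; have := glueP (nn 3 m2) (nn 4 l) (nn 5 n2) m13 n13 isT
  (rg_relab_wf (oid _) (oswapl n1 l n3) wG') wY wG.
by rewrite !nm_relab !comp_oid nsum_oswapl -c1' -(proj2 c1).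
Qed.

Let P3 G'' : rg_wf G'' -> rg_glued (rg_relab (oid m3) (oswapl k l n3) Z) Y G'' <->
  glue (@hedge_low k3 k2) (@hedge_up k3 k2) (hflip_low k3 k2) I2 O2 I3 O3 y z (nG'' G'').
Proof.
move=> wG''; have := glueP (nn 3 m2) (nn 4 l) (nn 5 n2) (nn 6 m3) kn3 isT
  (rg_relab_wf (oid m3) (oswapl k l n3) wZ) wY wG''.
by rewrite !nm_relab !comp_oid nsum_oswapl -i3.
Qed.

Let P4 G'' : rg_wf G'' -> rg_glued (rg_relab (oid _) (oswapl n2 k n3) G'') X GR <->
  glue (@hedge_low (k3 + k2) k1) (@hedge_up (k3 + k2) k1) (hflip_low (k3 + k2) k1)
    I1 O1 (compI I2 O2 I3) (compO O2 I3 O3) x (nG'' G'') gR.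
Proof.
move=> wG''; have := glueP (nn 0 m1) (nn 1 k) (nn 2 n1) m23 n23 isT
  (rg_relab_wf (oid _) (oswapl n2 k n3) wG'') wX wGR.
by rewrite !nm_relab !comp_oid nsum_oswapl -c3' -(proj2 c3).
Qed.

Let th := hmap s (fun=> false).
Let thE h : th h = (oswapr_fun h.1, h.2).
Proof. by rewrite /th hmap0 /s /oswapr {1}/obij_fun /= ffunE. Qed.
Let e1 : @hedge_low (k3 + k2) k1 = (th \o @hedge_up (k3 + k1) k2) \o @hedge_low k3 k1.
Proof.
by apply: funext => h; rewrite /= thE /hedge_low /hedge_up /oswapr_fun /= ?(split_lshift, split_rshift).
Qed.
Let e2 : @hedge_up (k3 + k2) k1 \o @hedge_low k3 k2 = th \o @hedge_low (k3 + k1) k2.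
Proof.
by apply: funext => h; rewrite /= thE /hedge_low /hedge_up /oswapr_fun /= ?(split_lshift, split_rshift).
Qed.
Let e3 : @hedge_up (k3 + k2) k1 \o @hedge_up k3 k2 = (th \o @hedge_up (k3 + k1) k2) \o @hedge_up k3 k1.
Proof.
by apply: funext => h; rewrite /= thE /hedge_low /hedge_up /oswapr_fun /= ?(split_lshift, split_rshift).
Qed.
Let iso : giso th g gR.
Proof.
have := rel_giso (nsum M1 (nsum M2 M3)) (nsum N1 (nsum N2 N3)) rel.
by rewrite !nsum_oswapl.
Qed.

Let wx : wf I1 O1 x := nm_wf (proj1 m1k) (proj1 (nn 2 n1)) wX.
Let wy : wf I2 O2 y := nm_wf (proj1 m2l) (proj1 (nn 5 n2)) wY.
Let wz : wf I3 O3 z := nm_wf (proj1 (nn 6 m3)) (proj1 (named_nsum (nn 1 k) ln3 isT)) wZ.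
Let inj_b'' : injective (nsum M2 M3) := proj1 m23.
Let inj_v'' : injective (nsum N2 (nsum Kk N3)) := proj1 (named_nsum (nn 5 n2) kn3 isT).
Let wg' G' : rg_wf G' -> wf (compI I1 O1 I3) (compO O1 I3 O3) (nG' G').
Proof.
rewrite (proj1 c1) (proj2 c1) => w.
exact: nm_wf (proj1 m13) (proj1 (named_nsum (nn 2 n1) ln3 isT)) w.
Qed.
Let wgR : wf (compI I2 O2 (compI I1 O1 I3)) (compO O2 (compI I1 O1 I3) (compO O1 I3 O3)) gR.
Proof.
apply: wf_map (hmap_bij s _) iso _; rewrite (proj1 c2) (proj2 c2); apply: nm_wf wG.
  exact: proj1 (named_nsum (nn 3 m2) m13 isT).
exact: proj1 (named_nsum (nn 5 n2) n13 isT).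
Qed.
Let K13 : exists u, O1 u && I3 u. Proof. exact: meet_rng. Qed.
Let K23 : exists u, O2 u && I3 u. Proof. rewrite i3; exact: meet_rng. Qed.

(** The converse follows by exchanging the roles of x and y. *)
Lemma below_glued :
  (exists G', [/\ rg_wf G', rg_glued Z X G' &
     rg_glued (rg_relab (oid (m1 + m3)) (oswapl n1 l n3) G') Y G]) ->
  (exists G'', [/\ rg_wf G'', rg_glued (rg_relab (oid m3) (oswapl k l n3) Z) Y G'' &
     rg_glued (rg_relab (oid (m2 + m3)) (oswapl n2 k n3) G'') X GR]).
Proof.
move=> [G' [w gl1 gl2]].
have [a2 gl2'] := glue_transport (hmap_bij s _) iso (proj1 (P2 w) gl2).
have [g'' [ef wgg d1 d2]] := glue_below e3 e2 e1 K13 K23 (named_rng m1k m2l isT)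
  (named_rng (nn 2 n1) m2l isT) (named_rng m1k (nn 5 n2) isT) (named_rng (nn 2 n1) (nn 5 n2) isT)
  wx wy wz (wg' w) wgR (hedge_parts k3 k2) (hedge_parts (k3 + k2) k1) (proj1 (P1 w) gl1) gl2'.
have wgg' := wgg; rewrite (proj1 c3) (proj2 c3) in wgg'.
have [G'' [w'' Eg]] := unname inj_b'' inj_v'' ef wgg'.
by exists G''; split=> //; [apply/(P3 w'') | apply/(P4 w'')]; rewrite /nG'' Eg.
Qed.
End BelowGlued.

(** * Graphs with two edges, as tables *)

Section Tables.

(** The four half-edges of a graph with two edges: (false, b) belongs to edge
    0, which comes from the graph on top, and (true, b) to edge 1. *)
Definition corner := (bool * bool)%type.
Definition code (c : corner) : hedge (1 + 1) := (if c.1 then ord_max else ord0, c.2).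
Definition decode (h : hedge (1 + 1)) : corner := (h.1 != ord0, h.2).

Lemma codeK : cancel code decode.
Proof. by case=> [[] b]. Qed.

Lemma decodeK : cancel decode code.
Proof.
case=> e b; rewrite /decode /code /=; congr pair.
by apply: val_inj; case: e => [[|[|e]] lt] //=.
Qed.

Definition quad (A : Type) := (A * A * A * A)%type.
Definition mk4 A (f : corner -> A) : quad A :=
  (f (false, false), f (false, true), f (true, false), f (true, true)).
Definition get4 A (q : quad A) (c : corner) : A :=
  if c.1 then (if c.2 then q.2 else q.1.2) else (if c.2 then q.1.1.2 else q.1.1.1).

Lemma get4K A (f : corner -> A) c : get4 (mk4 f) c = f c.
Proof. by case: c => [[] []]. Qed.

Definition table := (quad corner * quad nat * quad nat)%type.
(** Rotation, vertex and boundary at each of the four half-edges, with labels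
    as plain numbers: this form can be computed with. *)
Definition tab m n (G : ribbon (1 + 1) m n) : table :=
  (mk4 (fun c => decode (rg_rot G (code c))), mk4 (fun c => val (rg_vert G (code c))),
   mk4 (fun c => val (rg_bnd G (code c)))).

(** Orbits have at most four points. *)
Definition orbit4 (f : corner -> corner) x := [:: x; f x; f (f x); f (f (f x))].
Definition next4 (f : corner -> corner) (A : pred corner) x :=
  if A (f x) then f x else if A (f (f x)) then f (f x) else
  if A (f (f (f x))) then f (f (f x)) else f (f (f (f x))).
(** The inverse of a bijection f, by search. *)
Definition inv4 (f : corner -> corner) x : corner :=
  if f (false, false) == x then (false, false) else if f (false, true) == x then (false, true) else
  if f (true, false) == x then (true, false) else (true, true).

Definition coded (s : {perm hedge (1 + 1)}) f := forall c, s (code c) = code (f c).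

Lemma card_orbit4 (s : {perm hedge (1 + 1)}) h : (#|porbit s h| <= 4)%N.
Proof. by apply: leq_trans (max_card _) _; rewrite card_prod card_ord card_bool. Qed.

Lemma coded_iter s f n x : coded s f -> iter n s (code x) = code (iter n f x).
Proof. by move=> sf; elim: n => //= n ->; rewrite sf. Qed.

Lemma coded_orbit s f x y : coded s f -> (code y \in porbit s (code x)) = (y \in orbit4 f x).
Proof.
move=> sf; apply/idP/idP.
  rewrite porbit_traject => /trajectP[i lt]; rewrite (coded_iter _ _ sf) => /(can_inj codeK) ->.
  have := leq_trans lt (card_orbit4 _ _); rewrite !inE.
  by case: i {lt} => [|[|[|[|i]]]] //= _; rewrite eqxx ?orbT.
rewrite !inE => /or4P[] /eqP ->.
- exact: porbit_id.
- by rewrite -[f x]/(iter 1 f x) -(coded_iter _ _ sf) iter_in_porbit.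
- by rewrite -[f _]/(iter 2 f x) -(coded_iter _ _ sf) iter_in_porbit.
- by rewrite -[f _]/(iter 3 f x) -(coded_iter _ _ sf) iter_in_porbit.
Qed.

(** First returns take at most four steps, so that they can be computed from
    the table. *)
Lemma coded_next_in s f (A : pred (hedge (1 + 1))) A' x y : coded s f ->
  (forall c, A (code c) = A' c) -> A' x -> next_in A s (code x) (code y) <-> y = next4 f A' x.
Proof.
move=> sf AA Ax.
have main : next_in A s (code x) (code (next4 f A' x)).
  have it n : iter n s (code x) = code (iter n f x) := coded_iter n x sf.
  rewrite /next4; case: ifP => [A1|A1].
    by exists 0%N; split; rewrite ?it ?AA.
  case: ifP => [A2|A2].
    by exists 1%N; split=> [||[|//]]; rewrite ?it ?AA //= A1.
  case: ifP => [A3|A3].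
    by exists 2%N; split=> [||[|[|//]]]; rewrite ?it ?AA //= ?A1 ?A2.
  exists 3%N; split=> [||[|[|[|//]]]]; rewrite ?it ?AA //= ?A1 ?A2 ?A3 //.
  have : iter #|porbit s (code x)| s (code x) = code x by exact: iter_porbit.
  have : (0 < #|porbit s (code x)|)%N by rewrite (cardD1 (code x)) porbit_id.
  have := card_orbit4 s (code x); move: #|_| => [|[|[|[|[|n]]]]] // _ _;
    rewrite it => /(can_inj codeK) /= E.
  - by rewrite E Ax in A1.
  - by rewrite E Ax in A2.
  - by rewrite E Ax in A3.
  - by rewrite E.
split=> [H|-> //]; exact: (can_inj codeK) (next_in_fun H main).
Qed.

Lemma coded_inv s f : coded s f -> coded s^-1%g (inv4 f).
Proof.
move=> sf c; apply: (@perm_inj _ s); rewrite permKV sf; congr code; rewrite /inv4.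
case: eqP => [-> //|n1]; case: eqP => [-> //|n2]; case: eqP => [-> //|n3].
have fI : injective f by move=> a b E; apply: (can_inj codeK); apply: (@perm_inj _ s); rewrite !sf E.
have [g gK Kg] := injF_bij fI.
by case E: (g c) => [[] []]; have := Kg c; rewrite E.
Qed.

Definition rho (t : table) := get4 t.1.1.
Definition tv (t : table) := get4 t.1.2.
Definition tb (t : table) := get4 t.2.

Lemma tab_coded m n (G : ribbon (1 + 1) m n) : coded (rg_rot G) (rho (tab G)).
Proof. by move=> c; rewrite /rho get4K decodeK. Qed.

Definition face4 (t : table) (c : corner) := inv4 (rho t) (c.1, ~~ c.2).
Definition mid4 (t : table) (c : corner) := inv4 (rho t) (c.1, c.1 (+) c.2).

Lemma hflip_coded : coded (hflip (1 + 1)) (fun c => (c.1, ~~ c.2)).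
Proof. by move=> c; rewrite hflipE. Qed.

Lemma hflip_low_coded : coded (hflip_low 1 1) (fun c => (c.1, c.1 (+) c.2)).
Proof. by case=> [[] b]; rewrite hflip_lowE. Qed.

Lemma coded_mul s f s' f' : coded s f -> coded s' f' -> coded (s * s')%g (f' \o f).
Proof. by move=> H H' c; rewrite permM H H'. Qed.

Lemma face_coded m n (G : ribbon (1 + 1) m n) : coded (rg_face G) (face4 (tab G)).
Proof. exact: coded_mul hflip_coded (coded_inv (tab_coded G)). Qed.

Lemma mid_coded m n (G : ribbon (1 + 1) m n) :
  coded (hflip_low 1 1 * (rg_rot G)^-1)%g (mid4 (tab G)).
Proof. exact: coded_mul hflip_low_coded (coded_inv (tab_coded G)). Qed.

Definition corners : seq corner := [:: (false, false); (false, true); (true, false); (true, true)].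

Definition labels_chk (t : table) :=
  all (fun x => all (fun y => (tv t x == tv t y) == (y \in orbit4 (rho t) x)) corners) corners &&
  all (fun x => all (fun y => (tb t x == tb t y) == (y \in orbit4 (face4 t) x)) corners) corners.

Lemma wf_labels_chk m n (G : ribbon (1 + 1) m n) : rg_wf G -> labels_chk (tab G).
Proof.
case/and4P=> /forallP vG /forallP bG _ _; apply/andP; split; apply/allP => x _; apply/allP => y _.
  have := forallP (vG (code x)) (code y).
  by rewrite (coded_orbit _ _ (tab_coded G)) /tv !get4K -val_eqE.
have := forallP (bG (code x)) (code y).
by rewrite (coded_orbit _ _ (face_coded G)) /tb !get4K -val_eqE.
Qed.

Definition small := ((bool -> bool) * (bool -> nat) * (bool -> nat))%type.
Definition small_of m n (G : ribbon 1 m n) : small :=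
  (fun b => (rg_rot G (ord0, b)).2, fun b => val (rg_vert G (ord0, b)),
   fun b => val (rg_bnd G (ord0, b))).

Definition bools := [:: false; true].

(** The seven conditions of [rg_glued], in the same order, in terms of tables. *)
Definition glued_chk (c m1 n1 : nat) (y x : small) (t : table) : bool :=
  [&& all (fun b => next4 (rho t) (fun z => z.1) (true, b) == (true, x.1.1 b)) bools,
      all (fun b => next4 (mid4 t) (fun z => ~~ z.1) (false, y.1.1 b) == (false, b)) bools,
      all (fun b => all (fun b' => (x.2 b == m1 + y.1.2 b') && (y.1.2 b' < c) ==>
             ((false, b') \in orbit4 (mid4 t) (true, b))) bools) bools,
      all (fun b => tv t (true, b) == x.1.2 b) bools,
      all (fun b => (c <= y.1.2 b) ==> (tv t (false, b) == n1 + (y.1.2 b - c))) bools,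
      all (fun b => (x.2 b < m1) ==> (tb t (true, b) == x.2 b)) bools
    & all (fun b => tb t (false, b) == m1 + y.2 b) bools].

Lemma all_bools (P : pred bool) : all P bools = [forall b, P b].
Proof.
apply/allP/forallP => H b; last by rewrite H.
by apply: H; case: b.
Qed.

Lemma forall_hedge1 (P : pred (hedge 1)) : [forall h, P h] = all (fun b => P (ord0, b)) bools.
Proof.
rewrite all_bools; apply/forallP/forallP => H h; first exact: H.
by rewrite (hedge1E h).
Qed.

Lemma up_code h : hedge_up 1 h = code (false, h.2).
Proof. by rewrite /hedge_up /code (hedge1E h) /=; congr pair; apply: val_inj. Qed.
Lemma low_code h : hedge_low 1 h = code (true, h.2).
Proof. by rewrite /hedge_low /code (hedge1E h) /=; congr pair; apply: val_inj. Qed.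

Lemma codom_up c : (code c \in codom (@hedge_up 1 1)) = ~~ c.1.
Proof.
apply/codomP/idP => [[h]|]; first by rewrite up_code => /(can_inj codeK) ->.
by case: c => [[] b] // _; exists (ord0, b); rewrite up_code.
Qed.
Lemma codom_low c : (code c \in codom (@hedge_low 1 1)) = c.1.
Proof.
apply/codomP/idP => [[h]|]; first by rewrite low_code => /(can_inj codeK) ->.
by case: c => [[] b] // _; exists (ord0, b); rewrite low_code.
Qed.

Lemma glued_tabE c m1 n1 m2 n2 (G2 : ribbon 1 m2 (c + n2)) (G1 : ribbon 1 (m1 + c) n1)
    (G : ribbon (1 + 1) (m1 + m2) (n1 + n2)) :
  rg_glued G2 G1 G = glued_chk c m1 n1 (small_of G2) (small_of G1) (tab G).
Proof.
have sm2 b : rg_rot G2 (ord0, b) = (ord0, (small_of G2).1.1 b) by rewrite -hedge1E.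
have sm1 b : rg_rot G1 (ord0, b) = (ord0, (small_of G1).1.1 b) by rewrite -hedge1E.
rewrite /rg_glued /glued_chk; congr [&& _, _, _, _, _, _ & _].
- apply/first_returnP/allP => H.
    move=> b _; have := H (ord0, b); rewrite !low_code sm1 /=.
    by move/(coded_next_in _ (tab_coded G) codom_low) => /(_ isT) /eqP; rewrite eq_sym.
  move=> h; rewrite (hedge1E h) !low_code sm1 /=.
  apply/(coded_next_in _ (tab_coded G) codom_low) => //.
  by apply/esym/eqP/H; case: h.2.
- apply/first_returnP/allP => H.
    move=> b _; have := H (rg_rot G2 (ord0, b)); rewrite permK !up_code sm2 /=.
    by move/(coded_next_in _ (mid_coded G) codom_up) => /(_ isT) /eqP; rewrite eq_sym.
  move=> h0; have [h ->] : exists h, h0 = rg_rot G2 h.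
    by exists ((rg_rot G2)^-1%g h0); rewrite permKV.
  rewrite permK (hedge1E h) !up_code sm2 /=.
  apply/(coded_next_in _ (mid_coded G) codom_up) => //.
  by apply/esym/eqP/H; case: h.2.
- rewrite forall_hedge1; apply: eq_all => b; rewrite forall_hedge1; apply: eq_all => b'.
  rewrite up_code low_code (coded_orbit _ _ (mid_coded G)) /=.
  apply/forallP/implyP => [H /andP[/eqP E lt]|H i].
    have := H (Ordinal lt); rewrite -!val_eqE /= E eqxx /= eqxx.
    by [].
  by apply/implyP => /andP[/eqP E1 /eqP E2]; apply: H; rewrite E1 E2 /= eqxx /=.
- rewrite forall_hedge1; apply: eq_all => b.
  by rewrite low_code -val_eqE /tv get4K.
- rewrite forall_hedge1; apply: eq_all => b; rewrite up_code /= /tv get4K.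
  apply/forallP/implyP => [H le|H i].
    have lt : (val (rg_vert G2 (ord0, b)) - c < n2)%N.
      by have := ltn_ord (rg_vert G2 (ord0, b)); rewrite /=; lia.
    have := H (Ordinal lt); rewrite -!val_eqE /= subnKC // eqxx /=.
    by [].
  apply/implyP => /eqP E; rewrite -val_eqE /= (eqP (H _)) E /= ?leq_addr //.
  by rewrite addKn.
- rewrite forall_hedge1; apply: eq_all => b; rewrite low_code /= /tb get4K.
  apply/forallP/implyP => [H lt|H i].
    by have := H (Ordinal lt); rewrite -!val_eqE /= eqxx.
  by apply/implyP => /eqP E; rewrite -val_eqE /= (eqP (H _)) E /=.
- rewrite forall_hedge1; apply: eq_all => b.
  by rewrite up_code -val_eqE /tb get4K.
Qed.

End Tables.

Section Enumeration.
Definition allq A (s : seq A) (P : pred (quad A)) :=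
  all (fun a => all (fun b => all (fun c => all (fun d => P (a, b, c, d)) s) s) s) s.

Lemma allqP (A : eqType) (s : seq A) P (f : corner -> A) :
  allq s P -> (forall c, f c \in s) -> P (mk4 f).
Proof.
move=> /allP H fs; have /allP{}H := H _ (fs (false, false)); have /allP{}H := H _ (fs (false, true)).
have /allP{}H := H _ (fs (true, false)); exact: H (fs (true, true)).
Qed.

Definition sloop : small := (negb, fun=> 0, fun b => nat_of_bool b).
Definition sedge : small := (id, fun b => nat_of_bool b, fun=> 0).

Lemma small_loop : small_of rg_loop = sloop.
Proof.
congr (_, _, _); apply: funext => b; rewrite /rg_rot /rg_vert /rg_bnd /= ?ffunE ?permE //=.
by rewrite inordK //; case: b.
Qed.

Lemma small_edge : small_of rg_edge = sedge.
Proof.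
congr (_, _, _); apply: funext => b; rewrite /rg_rot /rg_vert /rg_bnd /= ?ffunE ?perm1 //=.
by rewrite inordK //; case: b.
Qed.

Definition q4 (x y z t : nat) : quad nat := (x, y, z, t).
Definition h4 (x y z t : corner) : quad corner := (x, y, z, t).
Notation f0 := (false, false). Notation f1 := (false, true).
Notation e0 := (true, false). Notation e1 := (true, true).

(** In each table the half-edges come in the order f0, f1, e0, e1, where f is
    the edge of the graph on top; the rows give the rotation, the vertices and
    the boundaries. A1 and A2 are the two ways to place a loop in a corner of
    a loop, with different boundaries of the second loop left inside. *)
Definition A1 : table := (h4 f1 e0 e1 f0, q4 0 0 0 0, q4 1 2 0 2).
Definition A2 : table := (h4 e0 f0 e1 f1, q4 0 0 0 0, q4 1 2 0 1).
(** Paths with two edges, dual to A1 and A2; the middle vertex is 0, resp. 1. *)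
Definition B1 : table := (h4 e0 f1 f0 e1, q4 0 2 0 1, q4 0 0 0 0).
Definition B2 : table := (h4 e1 f1 e0 f0, q4 1 2 0 1, q4 0 0 0 0).
(** An edge composed with a loop. In Q4 and Q6 the two edges are parallel, in
    the other tables a loop at one of the two vertices has the edge on one of
    its two sides. *)
Definition Q1 : table := (h4 f1 e0 f0 e1, q4 0 0 0 1, q4 0 1 1 1).
Definition Q2 : table := (h4 f1 e1 e0 f0, q4 1 1 0 1, q4 0 1 1 1).
Definition Q3 : table := (h4 e0 f0 f1 e1, q4 0 0 0 1, q4 0 1 0 0).
Definition Q4 : table := (h4 e0 e1 f0 f1, q4 0 1 0 1, q4 0 1 1 0).
Definition Q5 : table := (h4 e1 f0 e0 f1, q4 1 1 0 1, q4 0 1 0 0).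
Definition Q6 : table := (h4 e1 e0 f1 f0, q4 1 0 0 1, q4 0 1 0 1).
(** A loop composed with an edge: the loop has the edge on side 1. *)
Definition W1 : table := (h4 e0 f1 e1 f0, q4 0 1 0 0, q4 1 1 0 1).
(** The two boundaries of a loop joined by an edge: one vertex, one boundary,
    genus one. *)
Definition V1 : table := (h4 e1 e0 f0 f1, q4 0 0 0 0, q4 0 0 0 0).

Definition zeros := q4 0 0 0 0.
Definition rot_chk c m1 (y x : small) (r : quad corner) :=
  let t := (r, zeros, zeros) : table in
  [&& uniq [seq get4 r c | c <- corners],
      all (fun b => next4 (rho t) (fun z => z.1) (true, b) == (true, x.1.1 b)) bools,
      all (fun b => next4 (mid4 t) (fun z => ~~ z.1) (false, y.1.1 b) == (false, b)) bools
    & all (fun b => all (fun b' => (x.2 b == m1 + y.1.2 b') && (y.1.2 b' < c) ==>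
             ((false, b') \in orbit4 (mid4 t) (true, b))) bools) bools].
Definition vert_chk c n1 (y x : small) (r : quad corner) (v : quad nat) :=
  let t := (r, v, zeros) : table in
  [&& all (fun b => tv t (true, b) == x.1.2 b) bools,
      all (fun b => (c <= y.1.2 b) ==> (tv t (false, b) == n1 + (y.1.2 b - c))) bools
    & all (fun z => all (fun z' => (tv t z == tv t z') == (z' \in orbit4 (rho t) z)) corners) corners].
Definition bnd_chk m1 (y x : small) (r : quad corner) (b : quad nat) :=
  let t := (r, zeros, b) : table in
  [&& all (fun b => (x.2 b < m1) ==> (tb t (true, b) == x.2 b)) bools,
      all (fun b => tb t (false, b) == m1 + y.2 b) bools
    & all (fun z => all (fun z' => (tb t z == tb t z') == (z' \in orbit4 (face4 t) z)) corners) corners].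

(** The tables in Ts are glued, and no others. The search first fixes the
    rotation, then the vertices, then the boundaries, and discards a partial
    table as soon as possible; so few tables are examined. *)
Definition enum_glued c m1 n1 m2 n2 y x (Ts : seq table) :=
  all (fun t => glued_chk c m1 n1 y x t) Ts &&
  allq corners (fun r => if rot_chk c m1 y x r then
    allq (iota 0 (n1 + n2)) (fun v => if vert_chk c n1 y x r v then
      allq (iota 0 (m1 + m2)) (fun b => if bnd_chk m1 y x r b then (r, v, b) \in Ts else true)
    else true) else true).

Lemma enum_gluedP c m1 n1 m2 n2 y x Ts (G : ribbon (1 + 1) (m1 + m2) (n1 + n2)) :
  enum_glued c m1 n1 m2 n2 y x Ts -> rg_wf G -> glued_chk c m1 n1 y x (tab G) = (tab G \in Ts).
Proof.
case/andP=> /allP back H /wf_labels_chk/andP[wv wb]; apply/idP/idP; last exact: back.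
case/and5P=> c1 c2 c3 c4 /and3P[c5 c6 c7].
have cc z : z \in corners by case: z => [[] []].
have io k (i : 'I_k) : val i \in iota 0 k by rewrite mem_iota ltn_ord.
have := allqP (f := fun c => decode (rg_rot G (code c))) H (fun=> cc _).
rewrite ifT; last first.
  apply/and4P; split=> //; rewrite map_inj_uniq //.
  by move=> a b; rewrite !get4K => /(can_inj decodeK)/perm_inj/(can_inj codeK).
move=> {}H; have := allqP (f := fun c => val (rg_vert G (code c))) H (fun=> io _ _).
rewrite ifT; last by apply/and3P; split.
move=> {}H; have := allqP (f := fun c => val (rg_bnd G (code c))) H (fun=> io _ _).
by rewrite ifT //; apply/and3P; split.
Qed.

Lemma enum_loop_loop : enum_glued 1 1 1 2 0 sloop sloop [:: A1; A2].
Proof. by vm_compute. Qed.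
Lemma enum_edge_edge : enum_glued 1 0 2 1 1 sedge sedge [:: B1; B2].
Proof. by vm_compute. Qed.
Lemma enum_loop_edge : enum_glued 1 0 2 2 0 sloop sedge [:: Q1; Q2; Q3; Q4; Q5; Q6].
Proof. by vm_compute. Qed.
Lemma enum_edge_loop : enum_glued 1 1 1 1 1 sedge sloop [:: W1].
Proof. by vm_compute. Qed.
Lemma enum_edge_loop2 : enum_glued 2 0 1 1 0 sedge sloop [:: V1].
Proof. by vm_compute. Qed.

Definition rev2 (r0 r1 : bool) (i : 'I_2) : bool := if i == ord0 then r0 else r1.
Definition hswap (r0 r1 : bool) (c : corner) : corner := (~~ c.1, c.2 (+) if c.1 then r1 else r0).
(** The effect on tables of exchanging the two edges, reversing edge 0 if r0
    and edge 1 if r1, and renaming labels by fn and gn. *)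
Definition tswap (r0 r1 : bool) (fn gn : nat -> nat) (t : table) : table :=
  (mk4 (fun c => hswap r0 r1 (rho t (hswap r1 r0 c))), mk4 (fun c => gn (tv t (hswap r1 r0 c))),
   mk4 (fun c => fn (tb t (hswap r1 r0 c)))).

Lemma hswapK r0 r1 c : hswap r0 r1 (hswap r1 r0 c) = c.
Proof. by case: c => [[] b]; rewrite /hswap /= addbK. Qed.

Lemma oshiftE n i : val (oshift n i) = i.+1 %% n.
Proof. by rewrite /oshift /obij_fun /= ffunE. Qed.

Lemma hmap_swap r0 r1 c : hmap (oshift 2) (rev2 r0 r1) (code c) = code (hswap r0 r1 c).
Proof. by case: c => [[] b]; rewrite /hmap /code /hswap /=; congr pair; apply: val_inj; rewrite oshiftE. Qed.

Lemma tab_rel r0 r1 m m' n n' (f : obij m m') (g : obij n n') fn gn (G : ribbon (1 + 1) m n)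
    (G' : ribbon (1 + 1) m' n') :
  (forall i, val (f i) = fn (val i)) -> (forall i, val (g i) = gn (val i)) ->
  rg_rel (oshift 2) (rev2 r0 r1) f g G G' -> tab G' = tswap r0 r1 fn gn (tab G).
Proof.
move=> fE gE R.
have H c : [/\ rg_rot G' (code c) = code (hswap r0 r1 (rho (tab G) (hswap r1 r0 c))),
    val (rg_vert G' (code c)) = gn (tv (tab G) (hswap r1 r0 c)) &
    val (rg_bnd G' (code c)) = fn (tb (tab G) (hswap r1 r0 c))].
  have := R (code (hswap r1 r0 c)); rewrite hmap_swap hswapK => -[-> -> ->].
  by rewrite (tab_coded G) hmap_swap gE fE /tv /tb !get4K.
have H1 c : decode (rg_rot G' (code c)) = hswap r0 r1 (rho (tab G) (hswap r1 r0 c)).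
  by case: (H c) => -> _ _; rewrite codeK.
have H2 c := (let: And3 _ e _ := H c in e); have H3 c := (let: And3 _ _ e := H c in e).
by rewrite /tab /mk4 !H1 !H2 !H3.
Qed.

Lemma rel_sym_swap r0 r1 m m' n n' (f : obij m m') (f' : obij m' m) (g : obij n n') (g' : obij n' n)
    (G : ribbon (1 + 1) m n) (G' : ribbon (1 + 1) m' n') :
  cancel f f' -> cancel g g' ->
  rg_rel (oshift 2) (rev2 r0 r1) f g G G' -> rg_rel (oshift 2) (rev2 r1 r0) f' g' G' G.
Proof.
move=> fK gK R h; rewrite -[h]decodeK; move: (decode h) => c.
have := R (code (hswap r1 r0 c)).
rewrite !hmap_swap hswapK => -[-> -> ->]; rewrite fK gK; split=> //.
by rewrite (tab_coded G) !hmap_swap hswapK.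
Qed.
End Enumeration.

Local Open Scope ring_scope.

(** * Operations on classes and their signs *)

Section Lift.
Variables (K : fieldType) (T : choiceType) (M : lmodType K).

(** A linear map that kills the relations does not depend on the choice of
    representatives. *)
Lemma fglift_proj (S : {freeg T / K} -> Prop) (f : T -> M) x :
  (forall s, S s -> fglift f s = 0) -> fglift f (lrepr (lproj S x)) = fglift f x.
Proof.
move=> H; apply/eqP; rewrite -subr_eq0 -linearB; apply/eqP.
elim: (lrepr_proj S x) => [|a s z Ss _ IH]; first exact: linear0.
by rewrite linearP /= IH addr0 H // scaler0.
Qed.

Lemma fglift1 (f : T -> M) z : fglift f << z >> = f z.
Proof. by rewrite liftU scale1r. Qed.

Lemma freegUZ (c : K) (z : T) : << c *g z >> = c *: << z >>.
Proof.
apply/eqP/freeg_eqP => y; rewrite -[c *: _]/(fgscale c _) coeff_fgscale !coeffU.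
by rewrite mul1r.
Qed.

Lemma freeg_lin (D : {freeg T / K}) : \sum_(z <- dom D) coeff z D *: << z >> = D.
Proof. by apply: etrans (freeg_sumE D); apply: eq_bigr => z _; rewrite -freegUZ. Qed.
End Lift.

Section Signs.

Definition operm k k' (s : obij k k') : {perm 'I_k} :=
  perm (inj_comp (@cast_ord_inj _ _ (esym (obij_eq_dom s))) (@obij_inj _ _ s)).

Lemma opermE k (s : obij k k) i : operm s i = s i.
Proof. by rewrite permE /= cast_ord_id. Qed.

Definition obij_perm k (s : {perm 'I_k}) : obij k k := obij_of (permK s) (permKV s).

Lemma obij_permE k (s : {perm 'I_k}) i : obij_perm s i = s i.
Proof. by rewrite /obij_perm /obij_fun /= ffunE. Qed.

(** Determinant of a block diagonal permutation matrix. *)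
Lemma odd_osum k2 k2' k1 k1' (s2 : obij k2 k2') (s1 : obij k1 k1') :
  odd_perm (operm (osum s2 s1)) = odd_perm (operm s2) (+) odd_perm (operm s1).
Proof.
have e2 := obij_eq_dom s2; have e1 := obij_eq_dom s1; subst k2' k1'.
pose M k (s : obij k k) : 'M[int]_k := perm_mx (operm s).
have detM k (s : obij k k) : \det (M k s) = (-1) ^+ operm s by apply: det_perm.
have : M _ (osum s2 s1) = block_mx (M _ s2) 0 0 (M _ s1).
  apply/matrixP => i j; case: (split_ordP i) => i' ->; case: (split_ordP j) => j' ->;
    rewrite ?block_mxEul ?block_mxEur ?block_mxEdl ?block_mxEdr /M !mxE !opermE osumE
      /osum_fun ?split_lshift ?split_rshift.
  - by rewrite (inj_eq (@lshift_inj _ _)).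
  - by rewrite eq_lrshift.
  - by rewrite eq_rlshift.
  - by rewrite (inj_eq (@rshift_inj _ _)).
move/(congr1 determinant); rewrite det_ublock !detM -signr_addb => /eqP.
by case: (odd_perm _); case: (_ (+) _).
Qed.

Definition oswap_fun a b (i : 'I_(a + b)) : 'I_(b + a) :=
  match split i with inl x => rshift b x | inr y => lshift a y end.
Fact oswap_funK a b : cancel (@oswap_fun a b) (@oswap_fun b a).
Proof.
by move=> i; rewrite /oswap_fun; case: (split_ordP i) => j ->; rewrite ?(split_lshift, split_rshift).
Qed.
Definition oswap a b : obij (a + b) (b + a) := obij_of (@oswap_funK a b) (@oswap_funK b a).

(** The cyclic shift has the sign of a cycle of length n. *)
Lemma odd_oshift n : odd_perm (operm (oshift n)) = odd n.-1.
Proof.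
case: n => [|n]; first by rewrite /= (_ : operm _ = 1%g) ?odd_perm1 //; apply/permP => -[].
have -> : operm (oshift n.+1) = lift_perm ord_max ord0 1%g.
  apply/permP => i; rewrite opermE /oshift /obij_fun /= ffunE; apply: val_inj => /=.
  have [j ->|->] := unliftP ord_max i.
    rewrite lift_perm_lift perm1 /= /bump leqNgt ltn_ord add0n /bump /=.
    by rewrite modn_small // ltnS ltn_ord.
  by rewrite lift_perm_id /= modnn.
by rewrite odd_lift_perm odd_perm1 addbF addbF.
Qed.

Lemma iter_oshift n N (i : 'I_N) : val (iter n (operm (oshift N)) i) = ((i + n) %% N)%N.
Proof.
elim: n => [|n IH]; first by rewrite addn0 modn_small.
rewrite iterS opermE /oshift {1}/obij_fun /= ffunE /= IH.
by rewrite -addn1 modnDml addn1 addnS.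
Qed.

(** The exchange of blocks of sizes a and b is the b-th power of the cyclic
    shift of a + b elements, so its parity is b (a + b - 1) = a b. *)
Lemma odd_oswap a b : odd_perm (operm (oswap a b)) = odd a && odd b.
Proof.
have -> : operm (oswap a b) = (operm (oshift (a + b)) ^+ b)%g.
  apply/permP => i; apply: val_inj; rewrite permX [RHS]iter_oshift permE /=.
  rewrite /oswap /obij_fun /= ffunE /oswap_fun.
  case: (split_ordP i) => j -> /=; rewrite ?split_lshift ?split_rshift /=.
    by rewrite addnC modn_small // ltn_add2r.
  by rewrite addnAC modnDl modn_small // ltn_addl.
have E N n : odd_perm (operm (oshift N) ^+ n)%g = odd n && odd N.-1.
  elim: n => [|n IH]; first by rewrite odd_perm1.
  by rewrite expgS odd_permM IH odd_oshift /=; case: (odd n); case: (odd _).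
rewrite E.
by case: b => [|b]; rewrite ?andbF // addnS /= oddD; case: (odd a); case: (odd b).
Qed.
End Signs.

Section Classes.
Variables (K : fieldType) (d : int).
Notation car := (rg_car K d).
Notation R := (RGra K d).

(** Multilinear identities need to be checked on classes of graphs only. *)
Lemma class_car_ext (M : lmodType K) m n p (F F' : car m n p -> M) :
  linear F -> linear F' ->
  (forall k (G : rg d m n p k), F (rg_class K G) = F' (rg_class K G)) -> F =1 F'.
Proof.
move=> lF lF' E x; rewrite -[x]lreprK -[lrepr x]freeg_lin.
elim: (dom (lrepr x)) => [|[k G] r IH].
  by rewrite !big_nil (linear0_of (@lproj_linear _ _ _)) !linear0_of.
by rewrite !big_cons lproj_linear lF lF' IH; congr (_ *: _ + _); apply: E.
Qed.

Lemma iso_class m n p k (s : {perm 'I_k}) (r : {ffun 'I_k -> bool}) (G G' : rg d m n p k) :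
  rg_iso s r (val G) (val G') -> rg_class K G' = rg_sign K d s r *: rg_class K G.
Proof.
move=> iso; apply/eqP; rewrite /rg_class -(linearZ_of (@lproj_linear _ _ _)).
by apply/lprojP/span_gen; exists k, s, r, G, G'.
Qed.

Lemma lift_null (M : lmodType K) m n p (phi : rg_basis d m n p -> M) :
  (forall k (s : {perm 'I_k}) r (G G' : rg d m n p k), rg_iso s r (val G) (val G') ->
     phi (Tagged (rg d m n p) G') = rg_sign K d s r *: phi (Tagged (rg d m n p) G)) ->
  forall x, rg_null x -> fglift phi x = 0.
Proof.
move=> H x [k [s [r [G [G' [iso ->]]]]]].
by rewrite linearB linearZ /= /rg_gen !fglift1 (H _ _ _ _ _ iso) subrr.
Qed.

Definition rgr m n m' n' p k (f : obij m m') (g : obij n n') (G : rg d m n p k) : rg d m' n' p k :=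
  exist _ (rg_relab f g (val G)) (rg_relab_proof f g G).

Lemma iso_relab m n m' n' k (f : obij m m') (g : obij n n') s r (G G' : ribbon k m n) :
  rg_iso s r G G' -> rg_iso s r (rg_relab f g G) (rg_relab f g G').
Proof.
move=> /forallP H; apply/forallP => h; have /and3P[e1 e2 e3] := H h.
by rewrite /rg_vert /rg_bnd /= e1 !ffunE (eqP e2) (eqP e3) !eqxx.
Qed.

Lemma relab_proj m n m' n' p (f : obij m m') (g : obij n n') (x : {freeg (rg_basis d m n p) / K}) :
  prelab f g (lproj _ x : R m n p) = fglift (fun b => rg_class K (rgr f g (tagged b))) x.
Proof.
apply: fglift_proj => s; apply: lift_null => k sg r G G' iso /=.
exact/iso_class/iso_relab.
Qed.

Lemma relab_class m n m' n' p k (f : obij m m') (g : obij n n') (G : rg d m n p k) :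
  prelab f g (rg_class K G : R m n p) = rg_class K (rgr f g G).
Proof. by rewrite relab_proj /rg_gen fglift1. Qed.

Lemma relab_linear m n m' n' p (f : obij m m') (g : obij n n') :
  linear (@prelab K R m n m' n' p f g).
Proof.
move=> a x y; rewrite -[x]lreprK -[y]lreprK -lproj_linear !relab_proj.
by rewrite linearP.
Qed.

Lemma class_ext m n p k (G G' : rg d m n p k) : val G = val G' -> rg_class K G = rg_class K G'.
Proof. by move/val_inj->. Qed.

Lemma relab_id m n p (x : R m n p) : prelab (oid m) (oid n) x = x.
Proof.
apply: (class_car_ext (M := R m n p) (F := @prelab K R m n m n p (oid m) (oid n)) (F' := id)) => // [|k G].
  exact: relab_linear.
rewrite relab_class; apply: class_ext; rewrite /rgr /=.
case: (val G) => [[r v] b]; rewrite /rg_relab; congr (_, _, _);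
  by apply/ffunP => h; rewrite ffunE oidE.
Qed.

Lemma relab_comp m n m' n' m'' n'' p (f : obij m m') (g : obij n n')
    (f' : obij m' m'') (g' : obij n' n'') (x : R m n p) :
  prelab f' g' (prelab f g x) = prelab (ocomp f' f) (ocomp g' g) x.
Proof.
apply: (class_car_ext (M := R m'' n'' p) (F := fun x : R m n p => prelab f' g' (prelab f g x))
  (F' := @prelab K R m n m'' n'' p (ocomp f' f) (ocomp g' g))).
- by move=> a u v; rewrite !relab_linear.
- exact: relab_linear.
move=> k G; rewrite !relab_class; apply: class_ext.
rewrite /rgr /= /rg_relab; congr (_, _, _); apply/ffunP => h; rewrite !ffunE /rg_vert /rg_bnd /= ?ffunE;
  by rewrite ocompE.
Qed.

Lemma relab_sum m n m' n' p (f : obij m m') (g : obij n n') (I : Type) (r : seq I) (P : pred I)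
    (F : I -> R m n p) :
  prelab f g (\sum_(i <- r | P i) F i) = \sum_(i <- r | P i) prelab f g (F i).
Proof.
have lin : {morph (@prelab K R m n m' n' p f g) : x y / x + y}.
  by move=> x y; have := relab_linear f g 1 x y; rewrite !scale1r.
exact: (big_morph _ lin (linear0_of (relab_linear f g))).
Qed.

Definition rel_sign k k' (s : obij k k') (r : 'I_k -> bool) : K :=
  rg_sign K d (operm s) (finfun r).

Lemma rel_class k k' m m' n n' p (s : obij k k') r (f : obij m m') (g : obij n n')
    (G : rg d m n p k) (G' : rg d m' n' p k') :
  rg_rel s r f g (val G) (val G') ->
  rg_class K G' = rel_sign s r *: (prelab f g (rg_class K G : R m n p) : R m' n' p).
Proof.
have e := obij_eq_dom s; subst k' => rel; rewrite relab_class; apply: iso_class.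
apply/forallP => h; have [e1 e2 e3] := rel h.
have E t : (operm s t.1, t.2 (+) (finfun r) t.1) = hmap s r t by rewrite opermE ffunE.
by rewrite !E /rg_vert /rg_bnd /= !ffunE e1 -/(rg_vert _) -/(rg_bnd _) e2 e3 !eqxx.
Qed.

(** All identities between sums of graphs below are instances of this change
    of summation index. *)
Lemma rel_sum k k' m m' n n' p (s : obij k k') r (f : obij m m') (g : obij n n')
    (P : pred (rg d m n p k)) (P' : pred (rg d m' n' p k')) :
  (forall G G', rg_rel s r f g (val G) (val G') -> P G = P' G') ->
  \sum_(G' | P' G') (rg_class K G' : R m' n' p) =
  rel_sign s r *: prelab f g (\sum_(G | P G) (rg_class K G : R m n p)).
Proof.
have ex (G : rg d m n p k) : exists G' : rg d m' n' p k', rg_rel s r f g (val G) (val G').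
  have [G' rel] := rel_ex s r f g (val G).
  have wG' : rg_wf G' && (k'%:Z * (1 - d) == p).
    by case/andP: (valP G) => w; rewrite (rel_wf rel w) -(obij_eq_dom s).
  by exists (exist _ G' wG').
have [tr Htr] := choice ex => H.
have trI : injective tr.
  move=> G1 G2 E; apply: val_inj; apply: rel_inj (Htr G1) _; rewrite E; exact: Htr.
have trB : bijective tr.
  apply: inj_card_bij trI _.
  have e1 := obij_eq_dom s; have e2 := obij_eq_dom f; have e3 := obij_eq_dom g.
  by subst k' m' n'.
(* Since s, f and g are bijections, both index types have equally many
   elements and the injection tr is a bijection. *)
rewrite (reindex tr); last exact: onW_bij.
rewrite (eq_bigl P); last by move=> G; rewrite (H _ _ (Htr G)).
rewrite relab_sum scaler_sumr.
by apply: eq_bigr => G _; apply: rel_class.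
Qed.

Lemma rel_sign_osum k2 k2' k1 k1' (s2 : obij k2 k2') r2 (s1 : obij k1 k1') r1
    (rr : 'I_(k2 + k1) -> bool) :
  (forall i, rr (lshift k1 i) = r2 i) -> (forall i, rr (rshift k2 i) = r1 i) ->
  rel_sign (osum s2 s1) rr = rel_sign s2 r2 * rel_sign s1 r1.
Proof.
move=> E2 E1; rewrite /rel_sign /rg_sign; case: ifP => _.
  rewrite big_split_ord /=; congr (_ * _); apply: eq_bigr => i _; rewrite !ffunE ?E1 ?E2 //.
by rewrite odd_osum signr_addb.
Qed.

(** The edges of the top graph come first, which makes the sign of the pair
    the product of the two signs. *)
Lemma comp_rel c c' k1 k1' m1 m1' n1 n1' k2 k2' m2 m2' n2 n2' p q t
    (s2 : obij k2 k2') r2 (s1 : obij k1 k1') r1 (h : obij c c') (f1 : obij m1 m1') (g1 : obij n1 n1')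
    (f2 : obij m2 m2') (g2 : obij n2 n2')
    (G2 : rg d m2 (c + n2) q k2) (G2' : rg d m2' (c' + n2') q k2')
    (G1 : rg d (m1 + c) n1 p k1) (G1' : rg d (m1' + c') n1' p k1') :
  rg_rel s2 r2 f2 (osum h g2) (val G2) (val G2') -> rg_rel s1 r1 (osum f1 h) g1 (val G1) (val G1') ->
  rg_comp K t G2' G1' = (rel_sign s2 r2 * rel_sign s1 r1) *:
    (prelab (osum f1 f2) (osum g1 g2) (rg_comp K t G2 G1 : R _ _ t) : R _ _ t).
Proof.
move=> R2 R1.
pose rr i := match split i with inl x => r2 x | inr y => r1 y end.
have E2 i : rr (lshift k1 i) = r2 i by rewrite /rr split_lshift.
have E1 i : rr (rshift k2 i) = r1 i by rewrite /rr split_rshift.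
rewrite -(rel_sign_osum s2 s1 E2 E1); apply: rel_sum => G G' rel.
case/andP: (valP G2) => w2 _; case/andP: (valP G1) => w1 _; case/andP: (valP G) => w _.
exact (rel_glued E2 E1 w2 w1 w R2 R1 rel).
Qed.

Lemma iso_rel k m n (s : {perm 'I_k}) (r : {ffun 'I_k -> bool}) (G G' : ribbon k m n) :
  rg_iso s r G G' -> rg_rel (obij_perm s) r (oid m) (oid n) G G'.
Proof.
move/forallP => H h; have /and3P[/eqP e1 /eqP e2 /eqP e3] := H h.
have E t : hmap (obij_perm s) r t = (s t.1, t.2 (+) r t.1) by rewrite /hmap obij_permE.
by rewrite !E !oidE e1 e2 e3.
Qed.

Lemma rel_sign_perm k (s : {perm 'I_k}) (r : {ffun 'I_k -> bool}) :
  rel_sign (obij_perm s) r = rg_sign K d s r.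
Proof.
rewrite /rel_sign; congr (rg_sign _ _ _ _).
  by apply/permP => i; rewrite opermE obij_permE.
by apply/ffunP => i; rewrite ffunE.
Qed.

Lemma rel_refl k m n (G : ribbon k m n) : rg_rel (oid k) (fun=> false) (oid m) (oid n) G G.
Proof.
move=> h; have E t : hmap (oid k) (fun=> false) t = t.
  by case: t => e b; rewrite /hmap oidE addbF.
by rewrite !E !oidE.
Qed.

Lemma rel_sign0 k : rel_sign (oid k) (fun=> false) = 1.
Proof.
rewrite /rel_sign /rg_sign; case: ifP => _.
  by rewrite big1 // => i _; rewrite ffunE.
have -> : operm (oid k) = 1%g by apply/permP => i; rewrite opermE oidE perm1.
by rewrite odd_perm1.
Qed.

Lemma comp_isol c k1 m1 n1 k2 m2 n2 p q t s r (G2 G2' : rg d m2 (c + n2) q k2)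
    (G1 : rg d (m1 + c) n1 p k1) :
  rg_iso s r (val G2) (val G2') -> rg_comp K t G2' G1 = rg_sign K d s r *: rg_comp K t G2 G1.
Proof.
move=> /iso_rel R2; have R1 := rel_refl (val G1).
rewrite -osum_id in R2; rewrite -{1}osum_id in R1.
by rewrite (comp_rel t R2 R1) rel_sign_perm rel_sign0 mulr1 !osum_id relab_id.
Qed.

Lemma comp_isor c k1 m1 n1 k2 m2 n2 p q t s r (G2 : rg d m2 (c + n2) q k2)
    (G1 G1' : rg d (m1 + c) n1 p k1) :
  rg_iso s r (val G1) (val G1') -> rg_comp K t G2 G1' = rg_sign K d s r *: rg_comp K t G2 G1.
Proof.
move=> /iso_rel R1; have R2 := rel_refl (val G2).
rewrite -[X in rg_rel _ _ _ X]osum_id in R2; rewrite -[X in rg_rel _ _ X _]osum_id in R1.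
by rewrite (comp_rel t R2 R1) rel_sign_perm rel_sign0 mul1r !osum_id relab_id.
Qed.

Section Comp.
Variables (c m1 n1 m2 n2 : nat) (p q t : int) (hk : (0 < c)%N) (e : q + p = t).

Lemma comp_proj (y : {freeg (rg_basis d m2 (c + n2) q) / K}) (x : {freeg (rg_basis d (m1 + c) n1 p) / K}) :
  pcompose hk e (lproj _ y : R m2 (c + n2)%N q) (lproj _ x : R (m1 + c)%N n1 p) =
  fglift (fun b2 => fglift (fun b1 => rg_comp K t (tagged b2) (tagged b1)) x) y.
Proof.
rewrite /= fglift_proj; last first.
  move=> z; apply: lift_null => k s r G G' iso.
  rewrite !fglift_sumE scaler_sumr; apply: eq_bigr => b _ /=.
  by rewrite (comp_isol _ _ iso) !scalerA mulrC.
apply: eq_fglift => b2; apply: fglift_proj => z; apply: lift_null => k s r G G' iso /=.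
exact: comp_isor.
Qed.

Lemma comp_class k2 k1 (Y : rg d m2 (c + n2) q k2) (X : rg d (m1 + c) n1 p k1) :
  pcompose hk e (rg_class K Y : R m2 (c + n2)%N q) (rg_class K X : R (m1 + c)%N n1 p) = rg_comp K t Y X.
Proof. by rewrite comp_proj /rg_gen !fglift1. Qed.

Lemma comp_linl (x : R (m1 + c)%N n1 p) :
  linear (fun y : R m2 (c + n2)%N q => pcompose hk e y x).
Proof.
move=> a y y'; rewrite -[x]lreprK -[y]lreprK -[y']lreprK -lproj_linear !comp_proj.
by rewrite linearP.
Qed.

Lemma comp_linr (y : R m2 (c + n2)%N q) :
  linear (fun x : R (m1 + c)%N n1 p => pcompose hk e y x).
Proof.
move=> a x x'; rewrite -[y]lreprK -[x]lreprK -[x']lreprK -lproj_linear !comp_proj.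
rewrite !fglift_sumE scaler_sumr -big_split /=; apply: eq_bigr => b _.
by rewrite linearP /= scalerDr !scalerA mulrC.
Qed.
End Comp.

End Classes.

(** * The laws of a properad *)

Lemma sum_two_step (M : zmodType) (I J : finType) (A : pred I) (B : I -> pred J) (F : J -> M) :
  (forall i i' j, A i -> A i' -> B i j -> B i' j -> i = i') ->
  \sum_(i | A i) \sum_(j | B i j) F j = \sum_(j | [exists i, A i && B i j]) F j.
Proof.
move=> uniq; rewrite (exchange_big_dep predT) //= [RHS]big_mkcond; apply: eq_bigr => j _.
case: ifP => [/existsP[i /andP[Ai Bi]]|/existsP no].
  rewrite (big_pred1 i) // => i'; apply/idP/eqP => [/andP[Ai' Bi']|->]; last by rewrite Ai Bi.
  exact: uniq Ai' Ai Bi' Bi.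
by rewrite big_pred0 // => i; apply/negP => ABi; apply: no; exists i.
Qed.

Section GluedFacts.
Variables (c k1 m1 n1 k2 m2 n2 : nat).
Variables (G2 : ribbon k2 m2 (c + n2)) (G1 : ribbon k1 (m1 + c) n1)
  (G : ribbon (k2 + k1) (m1 + m2) (n1 + n2)).

Lemma glued_low : rg_glued G2 G1 G -> ret (@hedge_low k2 k1) (rg_rot G) (rg_rot G1).
Proof. by case/andP=> /first_returnP. Qed.

Lemma glued_up : rg_glued G2 G1 G ->
  ret (@hedge_up k2 k1) (hflip_low k2 k1 * (rg_rot G)^-1)%g (rg_rot G2)^-1%g.
Proof. by case/and3P=> _ /first_returnP. Qed.
End GluedFacts.

(** When there is nothing to erase, the first return is the permutation
    itself. *)
Lemma ret_surj (T T' : finType) (j : T' -> T) s t : (forall z, exists x, z = j x) ->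
  ret j s t <-> forall x, s (j x) = j (t x).
Proof.
move=> surj; have all z : mem (codom j) z by have [x ->] := surj z; apply: codom_f.
split=> H x; last by exists 0%N; split=> //; apply: H.
by have [[|n] [En _ nA]] := H x; last by have := nA 0%N isT; rewrite all.
Qed.

Lemma ocastE m n (e : m = n) i : ocast e i = cast_ord e i.
Proof. by rewrite /ocast /obij_fun /= ffunE. Qed.

Lemma rel_relab k m n m' n' (f : obij m m') (g : obij n n') (G : ribbon k m n) :
  rg_rel (oid k) (fun=> false) f g G (rg_relab f g G).
Proof.
move=> h; have E t : hmap (oid k) (fun=> false) t = t by case: t => e b; rewrite hmap0 oidE.
by rewrite !E /rg_vert /rg_bnd /= !ffunE.
Qed.

Section Units.
Variables (k m n : nat).

Lemma glued_pointr (Y : ribbon k m (1 + n)) (G : ribbon (k + 0) (0 + m) (1 + n)) :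
  rg_wf Y -> rg_wf G ->
  rg_rel (ocast (esym (addn0 k))) (fun=> false) (oid m) (oid (1 + n)) Y G ->
  rg_glued (c := 1) (m1 := 0) Y rg_point G.
Proof.
move=> wY wG R.
have upE h : hedge_up 0 h = hmap (ocast (esym (addn0 k))) (fun=> false) h.
  by rewrite hmap0 /hedge_up ocastE; congr pair; apply: val_inj.
have fid : hflip_low k 0 = 1%g.
  apply/permP => h; rewrite hflip_lowE perm1; case: h => e b /=.
  have lt : (e < k)%N by have := ltn_ord e; rewrite [X in (_ < X)%N]addn0.
  by rewrite leqNgt lt.
apply/and5P; split.
- by apply/first_returnP => h; case: (hedge0 h).
- apply/first_returnP/ret_surj => [[e b]|h].
    by exists (cast_ord (addn0 k) e, b); congr pair; apply: val_inj.
  rewrite fid mul1g; apply: (@perm_inj _ (rg_rot G)); rewrite permKV !upE.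
  by case: (R ((rg_rot Y)^-1%g h)) => -> _ _; rewrite permKV.
- by apply/forallP => h; case: (hedge0 h).
- by apply/forallP => h; case: (hedge0 h).
apply/and3P; split.
- apply/forallP => h; apply/forallP => i; apply/implyP => /eqP E; rewrite upE.
  by case: (R h) => _ -> _; rewrite oidE E.
- by apply/forallP => h; case: (hedge0 h).
- apply/forallP => h; rewrite upE; case: (R h) => _ _ ->; rewrite oidE.
  by apply/eqP/val_inj.
Qed.

Lemma glued_pointl (X : ribbon k (m + 1) n) (G : ribbon (0 + k) (m + 1) (n + 0)) :
  rg_wf X -> rg_wf G ->
  rg_rel (oid k) (fun=> false) (oid (m + 1)) (ocast (esym (addn0 n))) X G ->
  rg_glued (c := 1) (n2 := 0) rg_point X G.
Proof.
move=> wX wG R.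
have lowE h : @hedge_low 0 k h = hmap (oid k) (fun=> false) h.
  by rewrite hmap0 /hedge_low oidE; congr pair; apply: val_inj.
apply/and5P; split.
- apply/first_returnP/ret_surj => [[e b]|h].
    by exists (e, b); congr pair; apply: val_inj.
  by rewrite !lowE; case: (R h).
- by apply/first_returnP => h; case: (hedge0 h).
- by apply/forallP => h; apply/forallP => h'; case: (hedge0 h').
- apply/forallP => h; rewrite lowE; case: (R h) => _ -> _.
  by rewrite ocastE; apply/eqP/val_inj.
apply/and3P; split.
- by apply/forallP => h; case: (hedge0 h).
- apply/forallP => h; apply/forallP => i; apply/implyP => /eqP E; rewrite lowE.
  by case: (R h) => _ _ ->; rewrite oidE E.
- by apply/forallP => h; case: (hedge0 h).
Qed.

(** The composite with a point has the rotation of the other graph, and a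
    composite is determined by its rotation. *)
Lemma glued_pointr_rot (Y : ribbon k m (1 + n)) (G G' : ribbon (k + 0) (0 + m) (1 + n)) :
  rg_glued (c := 1) (m1 := 0) Y rg_point G -> rg_glued (c := 1) (m1 := 0) Y rg_point G' ->
  rg_rot G = rg_rot G'.
Proof.
have surj (z : hedge (k + 0)) : exists x, z = hedge_up 0 x.
  by case: z => e b; exists (cast_ord (addn0 k) e, b); congr pair; apply: val_inj.
move=> /glued_up/(ret_surj _ _ surj) H /glued_up/(ret_surj _ _ surj) H'.
apply: (can_inj (@invgK _)); apply: (mulgI (hflip_low k 0)); apply/permP => z.
by have [x ->] := surj z; rewrite H H'.
Qed.

Lemma glued_pointl_rot (X : ribbon k (m + 1) n) (G G' : ribbon (0 + k) (m + 1) (n + 0)) :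
  rg_glued (c := 1) (n2 := 0) rg_point X G -> rg_glued (c := 1) (n2 := 0) rg_point X G' ->
  rg_rot G = rg_rot G'.
Proof.
have surj (z : hedge (0 + k)) : exists x, z = @hedge_low 0 k x.
  by case: z => e b; exists (e, b); congr pair; apply: val_inj.
move=> /glued_low/(ret_surj _ _ surj) H /glued_low/(ret_surj _ _ surj) H'.
by apply/permP => z; have [x ->] := surj z; rewrite H H'.
Qed.
End Units.

Section Laws.
Variables (K : fieldType) (d : int).
Notation R := (RGra K d).

Lemma relabP m n m' n' p (f : obij m m') (g : obij n n') a (x y : R m n p) :
  prelab f g (a *: x + y) = a *: prelab f g x + prelab f g y.
Proof. exact: relab_linear. Qed.

Lemma compPl c m1 n1 m2 n2 p q t (hk : (0 < c)%N) (e : q + p = t) a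
    (y y' : R m2 (c + n2)%N q) (x : R (m1 + c)%N n1 p) :
  pcompose hk e (a *: y + y') x = a *: pcompose hk e y x + pcompose hk e y' x.
Proof. exact: comp_linl. Qed.

Lemma compPr c m1 n1 m2 n2 p q t (hk : (0 < c)%N) (e : q + p = t) a
    (y : R m2 (c + n2)%N q) (x x' : R (m1 + c)%N n1 p) :
  pcompose hk e y (a *: x + x') = a *: pcompose hk e y x + pcompose hk e y x'.
Proof. exact: (comp_linr hk e y). Qed.

Lemma scaleP (V : lmodType K) (b a : K) (u v : V) :
  b *: (a *: u + v) = a *: (b *: u) + b *: v.
Proof. by rewrite scalerDr !scalerA mulrC. Qed.

Lemma comp_suml c m1 n1 m2 n2 p q t (hk : (0 < c)%N) (e : q + p = t) (I : Type) (r : seq I)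
    (P : pred I) (F : I -> R m2 (c + n2)%N q) (x : R (m1 + c)%N n1 p) :
  pcompose hk e (\sum_(i <- r | P i) F i) x = \sum_(i <- r | P i) pcompose hk e (F i) x.
Proof.
pose f (y : R m2 (c + n2)%N q) : R (m1 + m2)%N (n1 + n2)%N t := pcompose hk e y x.
have lin : {morph f : u v / u + v}.
  move=> u v; rewrite /f.
  by have := compPl hk e 1 u v x; rewrite !scale1r.
exact: (big_morph f lin (linear0_of (comp_linl hk e x))).
Qed.

Lemma comp_sumr c m1 n1 m2 n2 p q t (hk : (0 < c)%N) (e : q + p = t) (I : Type) (r : seq I)
    (P : pred I) (y : R m2 (c + n2)%N q) (F : I -> R (m1 + c)%N n1 p) :
  pcompose hk e y (\sum_(i <- r | P i) F i) = \sum_(i <- r | P i) pcompose hk e y (F i).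
Proof.
pose f (x : R (m1 + c)%N n1 p) : R (m1 + m2)%N (n1 + n2)%N t := pcompose hk e y x.
have lin : {morph f : u v / u + v}.
  move=> u v; rewrite /f.
  by have := compPr hk e 1 y u v; rewrite !scale1r.
exact: (big_morph f lin (linear0_of (comp_linr hk e y))).
Qed.

Lemma RGra_relab k m1 n1 m2 n2 k' m1' n1' m2' n2' p q r
    (hk : (0 < k)%N) (hk' : (0 < k')%N) (e : q + p = r)
    (h : obij k k') (f1 : obij m1 m1') (g1 : obij n1 n1')
    (f2 : obij m2 m2') (g2 : obij n2 n2')
    (y : R m2 (k + n2)%N q) (x : R (m1 + k)%N n1 p) :
  pcompose hk' e (prelab f2 (osum h g2) y) (prelab (osum f1 h) g1 x)
    = prelab (osum f1 f2) (osum g1 g2) (pcompose hk e y x).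
Proof.
move: x; apply: class_car_ext => [a u v|a u v|kx X].
- by rewrite relabP compPr.
- by rewrite compPr relabP.
move: y; apply: class_car_ext => [a u v|a u v|ky Y].
- by rewrite relabP compPl.
- by rewrite compPl relabP.
have E := @comp_rel K d _ _ _ _ _ _ _ _ _ _ _ _ _ _ _ _ r _ _ _ _ h f1 g1 f2 g2
  Y (rgr f2 (osum h g2) Y) X (rgr (osum f1 h) g1 X)
  (rel_relab f2 (osum h g2) (val Y)) (rel_relab (osum f1 h) g1 (val X)).
by rewrite !relab_class !comp_class E !rel_sign0 mulr1 scale1r.
Qed.

Lemma rel_sign_cast k k' (e : k = k') : rel_sign K d (ocast e) (fun=> false) = 1.
Proof.
subst k'; rewrite -(rel_sign0 K d k); congr (rel_sign _ _ _ _).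
by apply: obij_ext => i; rewrite ocastE oidE cast_ord_id.
Qed.

Lemma RGra_idr m n q (h1 : (0 < 1)%N) (e : q + 0 = q) (y : R m (1 + n)%N q) :
  pcompose (m1 := 0) h1 e y (pid R) = y.
Proof.
move: y; apply: class_car_ext => [a u v|a u v|k Y] //; first by rewrite compPl.
rewrite comp_class /rg_comp.
rewrite (@rel_sum K d _ _ _ _ _ _ q (ocast (esym (addn0 k))) (fun=> false) (oid m) (oid (1 + n)) (pred1 Y)).
  by rewrite rel_sign_cast scale1r big_pred1_eq relab_id.
move=> G G' rel; case/andP: (valP Y) (valP G) (valP G') => wY _ /andP[wG _] /andP[wG' _].
apply/eqP/idP => [EG|gl].
  by rewrite EG in rel; apply: glued_pointr wY wG' rel.
have [G0 rel0] := rel_ex (ocast (esym (addn0 k))) (fun=> false) (oid m) (oid (1 + n)) (val Y).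
have w0 := rel_wf rel0 wY.
have gl0 := glued_pointr wY w0 rel0.
have E := @glued_uniq 1 0 0 1 k m n (val Y) rg_point G0 (val G') wY rg_point_wf w0 wG' gl0 gl (glued_pointr_rot gl0 gl).
by apply: val_inj; rewrite E in rel0; apply: rel_inj rel rel0.
Qed.

Lemma RGra_idl m n p (h1 : (0 < 1)%N) (e : 0 + p = p) (x : R (m + 1)%N n p) :
  pcompose (n2 := 0) h1 e (pid R) x = prelab (oid _) (ocast (esym (addn0 n))) x.
Proof.
move: x; apply: class_car_ext => [a u v|a u v|k X] //; first by rewrite compPr.
  by rewrite relabP.
rewrite comp_class /rg_comp.
rewrite (@rel_sum K d _ _ _ _ _ _ p (oid k) (fun=> false) (oid (m + 1)) (ocast (esym (addn0 n))) (pred1 X)).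
  by rewrite rel_sign0 scale1r big_pred1_eq.
move=> G G' rel; case/andP: (valP X) (valP G) (valP G') => wX _ /andP[wG _] /andP[wG' _].
apply/eqP/idP => [EG|gl].
  by rewrite EG in rel; apply: glued_pointl wX wG' rel.
have [G0 rel0] := rel_ex (oid k) (fun=> false) (oid (m + 1)) (ocast (esym (addn0 n))) (val X).
have w0 := rel_wf rel0 wX.
have gl0 := glued_pointl wX w0 rel0.
have E := @glued_uniq 1 k m n 0 1 0 rg_point (val X) G0 (val G') rg_point_wf wX w0 wG' gl0 gl (glued_pointl_rot gl0 gl).
by apply: val_inj; rewrite E in rel0; apply: rel_inj rel rel0.
Qed.

Lemma deg_add k2 k1 (p q r : int) : k2%:Z * (1 - d) == q -> k1%:Z * (1 - d) == p -> q + p = r ->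
  (k2 + k1)%:Z * (1 - d) == r.
Proof. by move=> /eqP <- /eqP <- <-; rewrite PoszD mulrDl. Qed.

Lemma exists_rg m n p k (Q : pred (ribbon k m n)) : k%:Z * (1 - d) == p ->
  [exists G : rg d m n p k, Q (val G)] <-> exists G, rg_wf G /\ Q G.
Proof.
move=> deg; split=> [/existsP[G QG]|[G [wG QG]]].
  by exists (val G); case/andP: (valP G).
have pG : rg_wf G && (k%:Z * (1 - d) == p) by rewrite wG deg.
by apply/existsP; exists (exist _ G pG).
Qed.

Lemma rot_relab k m n m' n' (f : obij m m') (g : obij n n') (G : ribbon k m n) :
  rg_rot (rg_relab f g G) = rg_rot G.
Proof. by []. Qed.

Lemma rg_wfP m n p k (G : rg d m n p k) : rg_wf (val G).
Proof. by case/andP: (valP G). Qed.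

Lemma rg_degP m n p k (G : rg d m n p k) : k%:Z * (1 - d) == p.
Proof. by case/andP: (valP G). Qed.

End Laws.

Section BlockSigns.

Lemma odd_ocomp m n p (g : obij n p) (f : obij m n) :
  odd_perm (operm (ocomp g f)) = odd_perm (operm g) (+) odd_perm (operm f).
Proof.
have e1 := obij_eq_dom f; have e2 := obij_eq_dom g; subst n p.
have -> : operm (ocomp g f) = (operm f * operm g)%g.
  by apply/permP => i; rewrite permM !opermE ocompE.
by rewrite odd_permM addbC.
Qed.

Lemma odd_ocast m n (e : m = n) : odd_perm (operm (ocast e)) = false.
Proof.
subst n; rewrite (_ : operm _ = 1%g) ?odd_perm1 //.
by apply/permP => i; rewrite opermE ocastE cast_ord_id perm1.
Qed.

Lemma odd_oid n : odd_perm (operm (oid n)) = false.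
Proof.
rewrite (_ : operm _ = 1%g) ?odd_perm1 //.
by apply/permP => i; rewrite opermE oidE perm1.
Qed.

Lemma oswapE a b i : oswap a b i = oswap_fun i.
Proof. by rewrite /oswap /obij_fun /= ffunE. Qed.

Lemma odd_oswapl a b c : odd_perm (operm (oswapl a b c)) = odd a && odd b.
Proof.
have -> : oswapl a b c =
    ocomp (oassoc b a c) (ocomp (osum (oswap a b) (oid c)) (oassocV a b c)).
  apply: obij_ext => i; rewrite !ocompE /oassoc /oassocV !ocastE osumE.
  rewrite /oswapl {1}/obij_fun /= ffunE /oswapl_fun; apply: val_inj => /=.
  case: (split_ordP i) => u -> /=.
    rewrite (_ : cast_ord _ _ = lshift c (lshift b u)); last exact: val_inj.
    by rewrite /osum_fun split_lshift /= oswapE /oswap_fun split_lshift.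
  case: (split_ordP u) => v -> /=.
    rewrite (_ : cast_ord _ _ = lshift c (rshift a v)); last exact: val_inj.
    by rewrite /osum_fun split_lshift /= oswapE /oswap_fun split_rshift.
  rewrite (_ : cast_ord _ _ = rshift (a + b) v); last by apply: val_inj; rewrite /= addnA.
  by rewrite /osum_fun split_rshift /= oidE addnA.
by rewrite !odd_ocomp odd_osum /oassoc /oassocV !odd_ocast odd_oid odd_oswap !addbF.
Qed.

Lemma odd_oswapr a b c : odd_perm (operm (oswapr a b c)) = odd b && odd c.
Proof.
have -> : oswapr a b c =
    ocomp (oassocV a c b) (ocomp (osum (oid a) (oswap b c)) (oassoc a b c)).
  apply: obij_ext => i; rewrite !ocompE /oassoc /oassocV !ocastE osumE.
  rewrite /oswapr {1}/obij_fun /= ffunE /oswapr_fun; apply: val_inj => /=.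
  case: (split_ordP i) => u -> /=; last first.
    rewrite (_ : cast_ord _ _ = rshift a (rshift b u)); last by apply: val_inj; rewrite /= addnA.
    by rewrite /osum_fun split_rshift /= oswapE /oswap_fun split_rshift.
  case: (split_ordP u) => v -> /=.
    rewrite (_ : cast_ord _ _ = lshift (b + c) v); last exact: val_inj.
    by rewrite /osum_fun split_lshift /= oidE.
  rewrite (_ : cast_ord _ _ = rshift a (lshift c v)); last exact: val_inj.
  by rewrite /osum_fun split_rshift /= oswapE /oswap_fun split_lshift /= addnA.
by rewrite !odd_ocomp odd_osum /oassoc /oassocV !odd_ocast odd_oid odd_oswap addbF.
Qed.

Variables (K : fieldType) (d : int).

Lemma rel_sign_norev k k' (s : obij k k') :
  rel_sign K d s (fun=> false) = if odd `|d|%N then 1 else (-1) ^+ odd_perm (operm s).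
Proof.
rewrite /rel_sign /rg_sign; case: ifP => // _.
by rewrite big1 // => i _; rewrite ffunE.
Qed.

Lemma odd_abs1B : odd `|1 - d|%N = ~~ odd `|d|%N.
Proof. by case: d => n; lia. Qed.

(** An edge has degree 1 - d, which is even for d odd; for d even the degrees
    count edges modulo 2. *)
Lemma koszulE a b (q r : int) : a%:Z * (1 - d) == q -> b%:Z * (1 - d) == r ->
  koszul K q r = if odd `|d|%N then 1 else (-1) ^+ (odd a && odd b).
Proof.
move=> /eqP <- /eqP <-; rewrite /koszul -signr_odd !abszM !absz_nat !oddM odd_abs1B.
by case: (odd `|d|); rewrite /= ?andbF ?andbT.
Qed.

Lemma koszulC (p q : int) : koszul K p q = koszul K q p.
Proof. by rewrite /koszul mulnC. Qed.
End BlockSigns.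

Section Associativity.
Variables (K : fieldType) (d : int).
Notation R := (RGra K d).

(** The intermediate graph G' is the total graph with the edges of Z deleted,
    hence each total graph occurs once. *)
Lemma comp_comp_r a b m1 n1 m2 n2 m' n' m3 n3 p q r s t k1 k2 k3 (ha : (0 < a)%N) (hb : (0 < b)%N)
    (e' : q + p = s) (e : r + s = t) (f : obij (m1 + m2) (m' + b)) (g : obij (n1 + n2) n')
    (Z : rg d m3 (b + n3) r k3) (Y : rg d m2 (a + n2) q k2) (X : rg d (m1 + a) n1 p k1) :
  pcompose hb e (rg_class K Z : R m3 (b + n3)%N r)
    (prelab f g (pcompose ha e' (rg_class K Y : R m2 (a + n2)%N q) (rg_class K X : R (m1 + a)%N n1 p))) =
  \sum_(G : rg d (m' + m3) (n' + n3) t (k3 + (k2 + k1)) |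
     [exists G' : rg d (m1 + m2) (n1 + n2) s (k2 + k1),
        rg_glued (val Y) (val X) (val G') && rg_glued (val Z) (rg_relab f g (val G')) (val G)])
     rg_class K G :> R _ _ _.
Proof.
rewrite comp_class /rg_comp relab_sum comp_sumr.
under eq_bigr => G' _ do rewrite relab_class comp_class /rg_comp.
apply: sum_two_step => G1 G2 G A1 A2 B1 B2; apply: val_inj.
apply: glued_uniq A1 A2 _; try exact: rg_wfP.
have L1 := glued_low B1; have L2 := glued_low B2; rewrite !rot_relab in L1 L2.
exact (ret_fun (low_inj (hedge_parts k3 (k2 + k1))) L1 L2).
Qed.

(** The intermediate graph is now a contraction of the total graph, and again
    determined by it. *)
Lemma comp_comp_l a b m1 n1 m2 n2 m' n' m3 n3 p q r s t k1 k2 k3 (ha : (0 < a)%N) (hb : (0 < b)%N)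
    (e' : r + q = s) (e : s + p = t) (f : obij (m2 + m3) m') (g : obij (n2 + n3) (b + n'))
    (Z : rg d m3 (a + n3) r k3) (Y : rg d (m2 + a) n2 q k2) (X : rg d (m1 + b) n1 p k1) :
  pcompose hb e
    (prelab f g (pcompose ha e' (rg_class K Z : R m3 (a + n3)%N r) (rg_class K Y : R (m2 + a)%N n2 q)))
    (rg_class K X : R (m1 + b)%N n1 p) =
  \sum_(G : rg d (m1 + m') (n1 + n') t ((k3 + k2) + k1) |
     [exists G' : rg d (m2 + m3) (n2 + n3) s (k3 + k2),
        rg_glued (val Z) (val Y) (val G') && rg_glued (rg_relab f g (val G')) (val X) (val G)])
     rg_class K G :> R _ _ _.
Proof.
rewrite comp_class /rg_comp relab_sum comp_suml.
under eq_bigr => G' _ do rewrite relab_class comp_class /rg_comp.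
apply: sum_two_step => G1 G2 G A1 A2 B1 B2; apply: val_inj.
apply: glued_uniq A1 A2 _; try exact: rg_wfP.
apply: (can_inj (@invgK _)).
have L1 := glued_up B1; have L2 := glued_up B2; rewrite !rot_relab in L1 L2.
exact (ret_fun (up_inj (hedge_parts (k3 + k2) k1)) L1 L2).
Qed.

Lemma exists_rg2 m n p k (Q1 Q2 : pred (ribbon k m n)) : k%:Z * (1 - d) == p ->
  [exists G : rg d m n p k, Q1 (val G) && Q2 (val G)] <-> exists G, [/\ rg_wf G, Q1 G & Q2 G].
Proof.
move=> deg; apply: iff_trans (exists_rg (fun G => Q1 G && Q2 G) deg) _.
by split=> [[G [w /andP[]]]|[G [w q1 q2]]]; exists G; split=> //; apply/andP.
Qed.

(** Edges are numbered in the same order on both sides: no sign. *)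
Lemma RGra_chain j k l m1 n1 m2 n2 m3 n3 p q r s t u
    (hk : (0 < k)%N) (hl : (0 < l)%N) (hjl : (0 < j + l)%N) (hkj : (0 < k + j)%N)
    (eyx : q + p = s) (ezy : r + q = t) (e : r + s = u) (e' : t + p = u)
    (x : R (m1 + j + k)%N n1 p) (y : R (m2 + l)%N (k + n2)%N q)
    (z : R m3 (j + (l + n3))%N r) :
    prelab (oassoc m1 m2 m3) (oassoc n1 n2 n3)
      (pcompose hjl e (prelab (oid m3) (oassocV j l n3) z)
         (prelab (omid m1 j m2 l) (oid _) (pcompose hk eyx y x)))
    = pcompose hkj e'
        (prelab (oid _) (omid k n2 j n3)
           (pcompose hl ezy (prelab (oid m3) (oswapl j l n3) z) y))
        (prelab (ocomp (oassoc m1 k j) (oswapr m1 j k)) (oid n1) x).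
Proof.
move: x; apply: class_car_ext => [a v w|a v w|k1 X].
- by rewrite compPr relabP compPr relabP.
- by rewrite relabP compPr.
move: y; apply: class_car_ext => [a v w|a v w|k2 Y].
- by rewrite compPl relabP compPr relabP.
- by rewrite compPr relabP compPl.
move: z; apply: class_car_ext => [a v w|a v w|k3 Z].
- by rewrite relabP compPl relabP.
- by rewrite relabP compPl relabP compPl.
rewrite !relab_class comp_comp_r comp_comp_l; apply/esym.
rewrite -[RHS]scale1r -(rel_sign_cast K d (addnA k3 k2 k1)); apply: rel_sum => G GR rel.
have deg12 := deg_add (rg_degP Y) (rg_degP X) eyx.
have deg23 := deg_add (rg_degP Z) (rg_degP Y) ezy.
have C := chain_glued (rg_wfP X) (rg_wfP Y) (rg_wfP Z) hk hl rel (rg_wfP G).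
have E1 := exists_rg2 (fun G' => rg_glued (val Y) (val X) G') (fun G' =>
  rg_glued (rg_relab (oid m3) (oassocV j l n3) (val Z)) (rg_relab (omid m1 j m2 l) (oid (n1 + n2)) G')
    (val G)) deg12.
have E2 := exists_rg2 (fun G' => rg_glued (rg_relab (oid m3) (oswapl j l n3) (val Z)) (val Y) G')
  (fun G' => rg_glued (rg_relab (oid (m2 + m3)) (omid k n2 j n3) G')
    (rg_relab (ocomp (oassoc m1 k j) (oswapr m1 j k)) (oid n1) (val X)) (val GR)) deg23.
by apply/idP/idP => H; [apply/E2/C/E1 | apply/E1/C/E2].
Qed.

(** The edges of y and z are numbered in opposite orders on the two sides. *)
Lemma RGra_above k l m1 n1 m2 n2 m3 n3 p q r s t u
    (hk : (0 < k)%N) (hl : (0 < l)%N)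
    (eyx : q + p = s) (ezx : r + p = t) (e : r + s = u) (e' : q + t = u)
    (x : R (m1 + l + k)%N n1 p) (y : R m2 (k + n2)%N q) (z : R m3 (l + n3)%N r) :
    pcompose hl e z (prelab (oswapr m1 l m2) (oid _) (pcompose hk eyx y x))
    = koszul K q r *: prelab (oswapr m1 m3 m2) (oswapr n1 n3 n2)
        (pcompose hk e' y (prelab (oswapr m1 k m3) (oid _)
           (pcompose hl ezx z (prelab (oswapr m1 l k) (oid n1) x)))).
Proof.
move: x; apply: class_car_ext => [a v w|a v w|k1 X].
- by rewrite compPr relabP compPr.
- by rewrite relabP compPr relabP compPr relabP scaleP.
move: y; apply: class_car_ext => [a v w|a v w|k2 Y].
- by rewrite compPl relabP compPr.
- by rewrite compPl relabP scaleP.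
move: z; apply: class_car_ext => [a v w|a v w|k3 Z].
- by rewrite compPl.
- by rewrite compPl relabP compPr relabP scaleP.
rewrite !relab_class !comp_comp_r.
have -> : koszul K q r = rel_sign K d (oswapl k2 k3 k1) (fun=> false).
  by rewrite rel_sign_norev odd_oswapl (koszulE K (rg_degP Y) (rg_degP Z)).
apply: rel_sum => GR G rel.
have deg12 := deg_add (rg_degP Y) (rg_degP X) eyx.
have deg13 := deg_add (rg_degP Z) (rg_degP X) ezx.
have rel' := rel_sym (@oswaplK k2 k3 k1) (@oswaplK k3 k2 k1) (@oswaprK m1 m3 m2)
  (@oswaprK n1 n3 n2) rel.
(* The other implication applies to x with its last two blocks exchanged. *)
have XX : rg_relab (oswapr m1 k l) (oid n1) (rg_relab (oswapr m1 l k) (oid n1) (val X)) = val X.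
  case: (val X) => [[rr v] b]; congr (_, _, _); apply/ffunP => h;
    by rewrite /rg_vert /rg_bnd /= !ffunE ?oidE ?oswaprK.
have E1 := exists_rg2 (fun G' => rg_glued (val Y) (val X) G') (fun G' =>
  rg_glued (val Z) (rg_relab (oswapr m1 l m2) (oid (n1 + n2)) G') (val G)) deg12.
have E2 := exists_rg2 (fun G' => rg_glued (val Z) (rg_relab (oswapr m1 l k) (oid n1) (val X)) G')
  (fun G' => rg_glued (val Y) (rg_relab (oswapr m1 k m3) (oid (n1 + n3)) G') (val GR)) deg13.
apply/idP/idP => [/E2 H|/E1 H]; [apply/E1|apply/E2].
  have wX' : rg_wf (rg_relab (oswapr m1 l k) (oid n1) (val X)) by exact/rg_relab_wf/rg_wfP.
  have := above_glued wX' (rg_wfP Z) (rg_wfP Y) hl hk rel (rg_wfP GR) H.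
  by rewrite XX.
exact (above_glued (rg_wfP X) (rg_wfP Y) (rg_wfP Z) hk hl rel' (rg_wfP G) H).
Qed.

Lemma RGra_below k l m1 n1 m2 n2 m3 n3 p q r s t u
    (hk : (0 < k)%N) (hl : (0 < l)%N)
    (ezx : r + p = s) (ezy : r + q = t) (e : s + q = u) (e' : t + p = u)
    (x : R (m1 + k)%N n1 p) (y : R (m2 + l)%N n2 q) (z : R m3 (k + (l + n3))%N r) :
    pcompose hl e (prelab (oid _) (oswapl n1 l n3) (pcompose hk ezx z x)) y
    = koszul K p q *: prelab (oswapl m1 m2 m3) (oswapl n1 n2 n3)
        (pcompose hk e' (prelab (oid _) (oswapl n2 k n3)
           (pcompose hl ezy (prelab (oid m3) (oswapl k l n3) z) y)) x).
Proof.
move: x; apply: class_car_ext => [a v w|a v w|k1 X].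
- by rewrite compPr relabP compPl.
- by rewrite compPr relabP scaleP.
move: y; apply: class_car_ext => [a v w|a v w|k2 Y].
- by rewrite compPr.
- by rewrite compPr relabP compPl relabP scaleP.
move: z; apply: class_car_ext => [a v w|a v w|k3 Z].
- by rewrite compPl relabP compPl.
- by rewrite relabP compPl relabP compPl relabP scaleP.
rewrite !relab_class !comp_comp_l.
have -> : koszul K p q = rel_sign K d (oswapr k3 k2 k1) (fun=> false).
  by rewrite rel_sign_norev odd_oswapr koszulC (koszulE K (rg_degP Y) (rg_degP X)).
apply: rel_sum => GR G rel.
have deg13 := deg_add (rg_degP Z) (rg_degP X) ezx.
have deg23 := deg_add (rg_degP Z) (rg_degP Y) ezy.
have rel' := rel_sym (@oswaprK k3 k2 k1) (@oswaprK k3 k1 k2) (@oswaplK m1 m2 m3)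
  (@oswaplK n1 n2 n3) rel.
(* The other implication applies to z with its first two blocks exchanged. *)
have ZZ : rg_relab (oid m3) (oswapl l k n3) (rg_relab (oid m3) (oswapl k l n3) (val Z)) = val Z.
  case: (val Z) => [[rr v] b]; congr (_, _, _); apply/ffunP => h;
    by rewrite /rg_vert /rg_bnd /= !ffunE ?oidE ?oswaplK.
have E1 := exists_rg2 (fun G' => rg_glued (val Z) (val X) G') (fun G' =>
  rg_glued (rg_relab (oid (m1 + m3)) (oswapl n1 l n3) G') (val Y) (val G)) deg13.
have E2 := exists_rg2 (fun G' => rg_glued (rg_relab (oid m3) (oswapl k l n3) (val Z)) (val Y) G')
  (fun G' => rg_glued (rg_relab (oid (m2 + m3)) (oswapl n2 k n3) G') (val X) (val GR)) deg23.
apply/idP/idP => [/E2 H|/E1 H]; [apply/E1|apply/E2].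
  have wZ' : rg_wf (rg_relab (oid m3) (oswapl k l n3) (val Z)) by exact/rg_relab_wf/rg_wfP.
  have := below_glued (rg_wfP Y) (rg_wfP X) wZ' hl hk rel (rg_wfP GR) H.
  by rewrite ZZ.
exact (below_glued (rg_wfP X) (rg_wfP Y) (rg_wfP Z) hk hl rel' (rg_wfP G) H).
Qed.

Lemma RGra_is_properad : is_properad R.
Proof.
split.
- exact: relab_linear.
- exact: relab_id.
- exact: relab_comp.
- exact: comp_linl.
- by move=> *; apply: comp_linr.
- exact: RGra_relab.
- exact: RGra_idr.
- exact: RGra_idl.
- exact: RGra_chain.
- exact: RGra_above.
- exact: RGra_below.
Qed.
End Associativity.

(** * The relations of involutive Lie bialgebras *)

Section Relations.
Variables (K : fieldType) (d : int).
Notation R := (RGra K d).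

(** The class of the graph with table T, or 0 if there is none. As a sum over
    graphs it is defined without choosing one. *)
Definition table_class m n p (T : table) : R m n p :=
  \sum_(G : rg d m n p (1 + 1) | tab (val G) == T) rg_class K G.

Lemma sum_tables m n p (Ts : seq table) : uniq Ts ->
  \sum_(G : rg d m n p (1 + 1) | tab (val G) \in Ts) rg_class K G = \sum_(T <- Ts) table_class m n p T.
Proof.
elim: Ts => [|T Ts IH] /=; first by rewrite big_nil big_pred0.
case/andP=> nT /IH {}IH; rewrite big_cons -IH (bigID (fun G : rg d m n p _ => tab (val G) == T)) /=.
congr (_ + _); apply: eq_bigl => G; rewrite inE.
  by case: (tab _ == T); rewrite ?andbF.
case: eqP => [->|_]; rewrite ?andbT ?andbF //.
exact/esym/negbTE.
Qed.

Lemma comp_tables c m1 n1 m2 n2 p q t (Y : rg d m2 (c + n2) q 1) (X : rg d (m1 + c) n1 p 1)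
    (y x : small) (Ts : seq table) :
  small_of (val Y) = y -> small_of (val X) = x -> enum_glued c m1 n1 m2 n2 y x Ts -> uniq Ts ->
  rg_comp K t Y X = \sum_(T <- Ts) table_class (m1 + m2) (n1 + n2) t T.
Proof.
move=> Ey Ex en uTs; rewrite /rg_comp -sum_tables //; apply: eq_bigl => G.
by rewrite glued_tabE Ey Ex (enum_gluedP en (rg_wfP G)).
Qed.

Definition swap_sign (r0 r1 : bool) : K :=
  if odd `|d|%N then (-1) ^+ r0 * (-1) ^+ r1 else -1.

Lemma rel_sign_swap r0 r1 : rel_sign K d (oshift 2) (rev2 r0 r1) = swap_sign r0 r1.
Proof.
rewrite /rel_sign /rg_sign /swap_sign; case: ifP => _.
  by rewrite !big_ord_recl big_ord0 !ffunE mulr1.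
by rewrite odd_oshift expr1.
Qed.

(** Two tables that correspond under [tswap] have the same class up to sign.
    Both directions of the correspondence are asked for on the given tables
    only, where they are computed. *)
Lemma table_class_swap r0 r1 m n m' n' p (f : obij m m') (f' : obij m' m) (g : obij n n') (g' : obij n' n)
    fn fn' gn gn' T T' :
  cancel f f' -> cancel g g' ->
  (forall i, val (f i) = fn (val i)) -> (forall i, val (f' i) = fn' (val i)) ->
  (forall i, val (g i) = gn (val i)) -> (forall i, val (g' i) = gn' (val i)) ->
  tswap r0 r1 fn gn T = T' -> tswap r1 r0 fn' gn' T' = T ->
  table_class m' n' p T' = swap_sign r0 r1 *: prelab f g (table_class m n p T).
Proof.
move=> fK gK fE f'E gE g'E ET ET'; rewrite -rel_sign_swap; apply: rel_sum => G G' rel.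
have rel' := rel_sym_swap fK gK rel.
apply/eqP/eqP => E; first by rewrite (tab_rel fE gE rel) E.
by rewrite (tab_rel f'E g'E rel') E.
Qed.

Lemma exprN1z (a : int) : (-1 : K) ^ a = (-1) ^+ odd `|a|%N.
Proof.
case: a => n; first by rewrite -exprnP signr_odd.
by rewrite NegzE -exprz_inv -exprnP invrN1 abszN signr_odd.
Qed.

Lemma oid1E n i : val (oid n i) = id (val i).
Proof. by rewrite oidE. Qed.

Lemma oidK n : cancel (oid n) (oid n).
Proof. by move=> i; rewrite !oidE. Qed.

Let sh n (i : nat) := (i.+1 %% n)%N.
Let sh3V (i : nat) := ((i.+1 %% 3).+1 %% 3)%N.

Definition shift3V := ocomp (oshift 3) (oshift 3).

Lemma shift3VE i : val (shift3V i) = (((val i).+1 %% 3).+1 %% 3)%N.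
Proof. by rewrite /shift3V ocompE !oshiftE. Qed.

Lemma shift3K : cancel (oshift 3) shift3V.
Proof. by move=> i; apply: val_inj; rewrite shift3VE oshiftE; case: i => [[|[|[|]]]]. Qed.

Lemma shift2K : cancel (oshift 2) (oshift 2).
Proof. by move=> i; apply: val_inj; rewrite !oshiftE; case: i => [[|[|]]]. Qed.

Lemma shift3_cube : ocomp (ocomp (oshift 3) (oshift 3)) (oshift 3) = oid 3.
Proof.
by apply: obij_ext => i; apply: val_inj; rewrite !ocompE !oshiftE oidE; case: i => [[|[|[|]]]].
Qed.

Lemma oid_oid n : ocomp (oid n) (oid n) = oid n.
Proof. by apply: obij_ext => i; rewrite ocompE !oidE. Qed.

Let lp : rg d 2 1 (1 - d) 1 := exist _ rg_loop (rg_loop_proof d).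
Let ed : rg d 1 2 (1 - d) 1 := exist _ rg_edge (rg_edge_proof d).

Lemma loop_sym : prelab (oshift 2) (oid 1) (RGra_loop K d) = (-1) ^ d *: RGra_loop K d.
Proof.
rewrite relab_class exprN1z.
have iso : rg_iso 1 [ffun=> true] rg_loop (rg_relab (oshift 2) (oid 1) rg_loop).
  apply/forallP => h; rewrite /rg_rot /rg_vert /rg_bnd /= !ffunE perm1 !hflipE /=.
  rewrite perm1 !addbT eqxx oidE eqxx /= -val_eqE oshiftE.
  by case: h.2; rewrite /= !inordK.
have -> : rg_class K (rgr (oshift 2) (oid 1) lp) = rg_sign K d (1%g : {perm 'I_1}) [ffun=> true] *: rg_class K lp.
  exact: (@iso_class K d _ _ _ _ _ _ lp (rgr (oshift 2) (oid 1) lp) iso).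
congr (_ *: _); rewrite /rg_sign.
by case: ifP => _; rewrite ?odd_perm1 // big_ord1 ffunE.
Qed.

Lemma edge_sym : prelab (oid 1) (oshift 2) (RGra_edge K d) = (-1) ^ d *: RGra_edge K d.
Proof.
rewrite relab_class exprN1z.
have iso : rg_iso 1 [ffun=> true] rg_edge (rg_relab (oid 1) (oshift 2) rg_edge).
  apply/forallP => h; rewrite /rg_rot /rg_vert /rg_bnd /= !ffunE !perm1 /=.
  rewrite !addbT eqxx oidE eqxx andbT /= -val_eqE oshiftE.
  by case: h.2; rewrite /= !inordK.
have -> : rg_class K (rgr (oid 1) (oshift 2) ed) = rg_sign K d (1%g : {perm 'I_1}) [ffun=> true] *: rg_class K ed.
  exact: (@iso_class K d _ _ _ _ _ _ ed (rgr (oid 1) (oshift 2) ed) iso).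
congr (_ *: _); rewrite /rg_sign.
by case: ifP => _; rewrite ?odd_perm1 // big_ord1 ffunE.
Qed.

Let dd : int := 1 - d + (1 - d).

Lemma loop_loop : pcompose (k := 1) (m1 := 1) (n2 := 0) isT erefl (RGra_loop K d) (RGra_loop K d)
  = table_class 3 1 dd A1 + table_class 3 1 dd A2.
Proof.
apply: etrans (@comp_class K d 1 1 1 2 0 _ _ dd isT erefl 1 1 lp lp) _.
apply: etrans (@comp_tables 1 1 1 2 0 _ _ dd lp lp _ _ _ small_loop small_loop enum_loop_loop isT) _.
by rewrite !big_cons big_nil addr0.
Qed.

Lemma edge_edge : pcompose (k := 1) (m1 := 0) (n2 := 1) isT erefl (RGra_edge K d) (RGra_edge K d)
  = table_class 1 3 dd B1 + table_class 1 3 dd B2.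
Proof.
apply: etrans (@comp_class K d 1 0 2 1 1 _ _ dd isT erefl 1 1 ed ed) _.
apply: etrans (@comp_tables 1 0 2 1 1 _ _ dd ed ed _ _ _ small_edge small_edge enum_edge_edge isT) _.
by rewrite !big_cons big_nil addr0.
Qed.

Lemma loop_edge : pcompose (k := 1) (m1 := 0) (n2 := 0) isT erefl (RGra_loop K d) (RGra_edge K d)
  = \sum_(T <- [:: Q1; Q2; Q3; Q4; Q5; Q6]) table_class 2 2 dd T.
Proof.
apply: etrans (@comp_class K d 1 0 2 2 0 _ _ dd isT erefl 1 1 lp ed) _.
exact: (@comp_tables 1 0 2 2 0 _ _ dd lp ed _ _ _ small_loop small_edge enum_loop_edge isT).
Qed.

Lemma edge_loop (e : 1 - d + (1 - d) = dd) :
  pcompose (k := 1) (m1 := 1) (n2 := 1) isT e (RGra_edge K d) (RGra_loop K d) = table_class 2 2 dd W1.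
Proof.
apply: etrans (@comp_class K d 1 1 1 1 1 _ _ dd isT e 1 1 ed lp) _.
apply: etrans (@comp_tables 1 1 1 1 1 _ _ dd ed lp _ _ _ small_edge small_loop enum_edge_loop isT) _.
by rewrite big_seq1.
Qed.

Lemma edge_loop2 : pcompose (k := 2) (m1 := 0) (n2 := 0) isT erefl (RGra_edge K d) (RGra_loop K d)
  = table_class 1 1 dd V1.
Proof.
apply: etrans (@comp_class K d 2 0 1 1 0 _ _ dd isT erefl 1 1 ed lp) _.
apply: etrans (@comp_tables 2 0 1 1 0 _ _ dd ed lp _ _ _ small_edge small_loop enum_edge_loop2 isT) _.
by rewrite big_seq1.
Qed.

(** Exchanging the edges and reversing one of them is odd, for d even by the
    exchange and for d odd by the reversal. *)
Lemma swap_sign1 r : swap_sign r (~~ r) = -1.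
Proof. by rewrite /swap_sign; case: ifP => // _; case: r; rewrite ?mulr1 ?mul1r. Qed.

(** The way the Jacobi identities hold: the sum of two graphs has the form u -
    rot u, and rot has order 3. *)
Lemma rotation_sum (V : lmodType K) (rot : V -> V) (u : V) : linear rot -> rot (rot (rot u)) = u ->
  let w := -1 *: rot u + u in w + rot w + rot (rot w) = 0.
Proof.
move=> lin cube w; rewrite /w !lin cube !scaleN1r; move: (rot (rot u)) => b; move: (rot u) => a.
rewrite [- a + u]addrC [- b + a]addrC [u - a + _]addrA subrK.
by apply/eqP; rewrite addr_eq0 opprD opprK.
Qed.

Lemma RGra_lieb : [pchar K] =i pred0 ->
  lieb_relations (c := d) (d := d) (RGra_loop K d) (RGra_edge K d).
Proof.
move=> charK; split; cbv zeta.
- exact: loop_sym.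
- exact: edge_sym.
- rewrite loop_loop.
  have -> : table_class 3 1 dd A1 = -1 *: prelab (oshift 3) (oid 1) (table_class 3 1 dd A2).
    rewrite -(swap_sign1 true).
    exact: (@table_class_swap _ _ _ _ _ _ _ _ shift3V _ (oid 1) (sh 3) sh3V id id A2 A1 shift3K (@oidK 1)
      (@oshiftE 3) shift3VE (@oid1E 1) (@oid1E 1)).
  apply: (rotation_sum (rot := @prelab K R 3 1 3 1 dd (oshift 3) (oid 1))).
    exact: relab_linear.
  by rewrite !relab_comp !oid_oid shift3_cube relab_id.
- rewrite edge_edge [table_class 1 3 dd B1 + _]addrC.
  have -> : table_class 1 3 dd B2 = -1 *: prelab (oid 1) (oshift 3) (table_class 1 3 dd B1).
    rewrite -(swap_sign1 true).
    exact: (@table_class_swap _ _ _ _ _ _ _ (oid 1) (oid 1) _ shift3V id id (sh 3) sh3V B1 B2 (@oidK 1) shift3K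
      (@oid1E 1) (@oid1E 1) (@oshiftE 3) shift3VE).
  apply: (rotation_sum (rot := @prelab K R 1 3 1 3 dd (oid 1) (oshift 3))).
    exact: relab_linear.
  by rewrite !relab_comp !oid_oid shift3_cube relab_id.
(* The two graphs with parallel edges cancel; the other four are the four
   terms of the right-hand side. *)
- rewrite loop_edge edge_loop !big_cons big_nil addr0.
  have -> : table_class 2 2 dd Q6 = - table_class 2 2 dd Q4.
    rewrite -scaleN1r -(swap_sign1 false) -[X in _ *: X]relab_id.
    exact: (@table_class_swap _ _ _ _ _ _ _ _ (oid 2) _ (oid 2) id id id id Q4 Q6 (@oidK 2) (@oidK 2)
      (@oid1E 2) (@oid1E 2) (@oid1E 2) (@oid1E 2)).
  have -> : table_class 2 2 dd Q1 = swap_sign false false *: table_class 2 2 dd W1.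
    rewrite -[X in _ *: X]relab_id.
    exact: (@table_class_swap _ _ _ _ _ _ _ _ (oid 2) _ (oid 2) id id id id W1 Q1 (@oidK 2) (@oidK 2)
      (@oid1E 2) (@oid1E 2) (@oid1E 2) (@oid1E 2)).
  have -> : table_class 2 2 dd Q2 = swap_sign true false *: prelab (oid 2) (oshift 2) (table_class 2 2 dd W1).
    exact: (@table_class_swap _ _ _ _ _ _ _ _ (oid 2) _ (oshift 2) id id (sh 2) (sh 2) W1 Q2 (@oidK 2) shift2K
      (@oid1E 2) (@oid1E 2) (@oshiftE 2) (@oshiftE 2)).
  have -> : table_class 2 2 dd Q3 = swap_sign false true *: prelab (oshift 2) (oid 2) (table_class 2 2 dd W1).
    exact: (@table_class_swap _ _ _ _ _ _ _ _ (oshift 2) _ (oid 2) (sh 2) (sh 2) id id W1 Q3 shift2K (@oidK 2)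
      (@oshiftE 2) (@oshiftE 2) (@oid1E 2) (@oid1E 2)).
  have -> : table_class 2 2 dd Q5 = swap_sign true true *: prelab (oshift 2) (oshift 2) (table_class 2 2 dd W1).
    exact: (@table_class_swap _ _ _ _ _ _ _ _ (oshift 2) _ (oshift 2) (sh 2) (sh 2) (sh 2) (sh 2) W1 Q5 shift2K shift2K
      (@oshiftE 2) (@oshiftE 2) (@oshiftE 2) (@oshiftE 2)).
  move: (table_class 2 2 dd Q4) (table_class 2 2 dd W1) => q w.
  have e1 : (1%:Z * (1 - d) == 1 - d) by rewrite mul1r.
  rewrite (koszulE K e1 e1) !exprN1z (_ : odd `|d + d| = false) ?expr0 ?scale1r; last by lia.
  have E6 (a b c e u : R 2%N 2%N dd) : a + (b + (c + (u + (e - u)))) = a + b + c + e.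
    by rewrite [u + _]addrC subrK !addrA.
  rewrite E6 !scalerDr !scalerA /swap_sign; case: ifP => _;
    rewrite /= ?expr0 ?expr1 ?mul1r ?mulr1 ?mulrNN ?mul1r ?scale1r //.
- rewrite edge_loop2.
  have E : table_class 1 1 dd V1 = - table_class 1 1 dd V1.
    rewrite -scaleN1r -(swap_sign1 true) -[X in _ *: X]relab_id.
    exact: (@table_class_swap _ _ _ _ _ _ _ _ (oid 1) _ (oid 1) id id id id V1 V1 (@oidK 1) (@oidK 1)
      (@oid1E 1) (@oid1E 1) (@oid1E 1) (@oid1E 1)).
  have : 2%:R *: table_class 1 1 dd V1 = 0 by rewrite scaler_nat mulr2n {1}E addNr.
  move/eqP; rewrite scaler_eq0 => /orP[|/eqP //].
  by rewrite (proj1 (pcharf0P K) charK).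
Qed.

End Relations.

Theorem theorem4p2p3 (K : fieldType) (charK : [pchar K] =i pred0) (d : int) :
  exists (RGraP : is_properad (RGra K d))
         (s : properad_morphism (Lieb K d d) (Properad RGraP)),
    s 2%N 1%N (1 - d) (lieb_cobracket K d d) = RGra_loop K d /\
    s 1%N 2%N (1 - d) (lieb_bracket K d d) = RGra_edge K d.
Proof.
exists (RGra_is_properad K d); pose P := Properad (RGra_is_properad K d).
have DB : @lieb_relations K d d P (RGra_loop K d) (RGra_edge K d) := RGra_lieb d charK.
pose v m n p : Lieb K d d m n p -> P m n p := @lieb_val K d d P (RGra_loop K d) (RGra_edge K d) m n p.
pose L m n p := GRing.isLinear.Build K _ _ *:%R (v m n p) (lieb_val_linear DB (m := m) (n := n) (p := p)).
pose phi m n p : {linear Lieb K d d m n p -> P m n p} := HB.pack (v m n p) (L m n p).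
have rel := @lieb_val_relab _ _ _ _ _ _ DB.
have mon := @lieb_val_mon _ _ _ _ _ _ DB.
have cmp := @lieb_val_comp _ _ _ _ _ _ DB.
exists (@PropMorphism K (Lieb K d d) P phi rel (mon _ _ _ (LId d d)) cmp).
by split; apply: mon.
Qed.
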